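(* Let $v$ be a weight on $\mathbb{D}$ which satisfies condition $(B)$, and assume that there is some $\epsilon>0$ with $$\sup_{n=1,2,\ldots}\frac{\int_0^1 r^{n-n^{\epsilon}}v(r)\,dr}{\int_0^1 r^n v(r)\,dr}<\infty .$$ Let $a\in L^1$ be real valued and radial such that the restriction $a|_{[\delta,1[}$ is differentiable for some $\delta\in\,]0,1[$ with $$\limsup_{r\to1}a'(r)<\infty\quad\text{or}\quad \liminf_{r\to1}a'(r)>-\infty .$$ If $$\limsup_{r\to1}|a(r)\log(1-r)|<\infty ,$$ then $T_a$ is a bounded operator $H_v^\infty\to H_v^\infty$. If $$\limsup_{r\to1}|a(r)\log(1-r)|=0 ,$$ then $T_a$ is compact on $H_v^\infty$.
   Context: $\mathbb{D}$ is the open unit disc of $\mathbb{C}$. A weight $v$ on $\mathbb{D}$ is a continuous strictly positive function with $v(z)=v(|z|)$ for all $z\in\mathbb{D}$, $\lim_{|z|\to1}v(z)=0$ and $v(r)\ge v(s)$ if $0<r<s<1$. $H_v^\infty$ is the Banach space of holomorphic $h:\mathbb{D}\to\mathbb{C}$ with $\|h\|_v:=\sup_{z\in\mathbb{D}}|h(z)|v(|z|)<\infty$. $L^1$ is taken with respect to (unweighted) Lebesgue area measure on $\mathbb{D}$. A function $a\in L^1$ is radial if $a(z)=a(|z|)$ for almost all $z$; we then regard $a$ as a function of $r=|z|\in[0,1[$. Toeplitz operator: $T_ah=P_v(a\cdot h)$, where $P_v$ is the orthogonal projection of $L_v^2=L^2(\mathbb{D},v(r)\,r\,dr\,d\varphi)$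 onto its subspace $A_v^2$ of holomorphic functions. For radial $a\in L^1$ it is the Taylor coefficient multiplier: for $h(z)=\sum_{n\ge0}h_nz^n$, $$T_ah(z)=\sum_{n=0}^\infty\gamma_nh_nz^n,\qquad \gamma_n=\frac{\int_0^1r^{2n+1}v(r)a(r)\,dr}{\int_0^1r^{2n+1}v(r)\,dr}.$$ Condition $(B)$: for each (real) $m>0$ let $r_m$ be a point where $r\mapsto r^mv(r)$ attains its absolute maximum on $[0,1]$ (with $v(1)=0$). The weight $v$ satisfies $(B)$ if $$\forall b_1>1\ \exists b_2>1\ \exists c>0\ \forall m,n>0:\quad \Big(\frac{r_m}{r_n}\Big)^m\frac{v(r_m)}{v(r_n)}\le b_1\ \text{ and }\ m,n,|m-n|\ge c\ \Rightarrow\ \Big(\frac{r_n}{r_m}\Big)^n\frac{v(r_n)}{v(r_m)}\le b_2 ,$$ where $m,n$ are real numbers, not necessarily integers. *)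

(* Defs.v *)
From HB Require Import structures.
From mathcomp Require Import all_boot all_order all_algebra.
From mathcomp Require Import all_classical all_reals all_analysis.
From mathcomp Require Import complex.

Set Implicit Arguments.
Unset Strict Implicit.
Unset Printing Implicit Defensive.
Import Order.TTheory GRing.Theory Num.Theory.
Import numFieldNormedType.Exports.
Import ComplexField.Normc.
Local Open Scope classical_set_scope.
Local Open Scope ring_scope.
Local Open Scope complex_scope.

(* The norm, the order and the topology of a module over the field R[i] take
   values in R[i] itself; normc is the real-valued modulus.  The topology of the
   complex plane is carried by the regular module R[i]^o, on which derivable
   is complex differentiability. *)
Notation Cplx R := (R[i]^o).

Definition disc (R : realType) : set (Cplx R) := [set z | normc z < 1].

Lemma disc0 (R : realType) : @disc R 0.
Proof.
change (normc (0 : R[i]) < 1).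
by have -> : normc (0 : R[i]) = 0 by exact: normc0.
Qed.

(* A radial function f, read as a function of r = |z|. *)
Definition radial_part (R : realType) (f : Cplx R -> R) (r : R) : R := f r%:C.

(* The values of a weight outside the disc are irrelevant. *)
Record weight (R : realType) := Weight {
  weight_fun :> Cplx R -> R;
  weight_continuous : forall z, disc z -> {for z, continuous weight_fun};
  weight_gt0 : forall z, disc z -> 0 < weight_fun z;
  weight_radial : forall z, disc z -> weight_fun z = weight_fun (normc z)%:C;
  weight_cvg0 : radial_part weight_fun r @[r --> 1^'-] --> 0;
  weight_noninc : forall r s : R, 0 < r -> r < s -> s < 1 ->
    radial_part weight_fun s <= radial_part weight_fun r }.

Definition holomorphic (R : realType) (h : Cplx R -> Cplx R) : Prop :=
  forall z, disc z -> derivable h z 1.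

Section Hinfty_pred.
Variables (R : realType) (v : weight R).

Definition weighted_values (h : Cplx R -> Cplx R) : set R :=
  [set normc (h z) * v (normc z)%:C | z in @disc R].

(* Functions on the disc are represented by functions on the plane that vanish
   off the disc, so that equality of elements is equality on the disc. *)
Definition Hinfty_subset : set (Cplx R -> Cplx R) :=
  [set h | [/\ holomorphic h, has_ubound (weighted_values h) &
    forall z, ~ disc z -> h z = 0]].

Definition Hinfty_pred : {pred (Cplx R -> Cplx R)} := mem Hinfty_subset.

Lemma Hinfty_predP h : (h \in Hinfty_pred) = (h \in Hinfty_subset).
Proof. by []. Qed.

Lemma weight_rad_gt0 z : disc z -> 0 < v (normc z)%:C.
Proof. by move=> dz; rewrite -weight_radial//; exact: weight_gt0. Qed.

Lemma Hinfty_submod_closed : submod_closed Hinfty_pred.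
Proof.
split=> [|k f g].
  rewrite Hinfty_predP inE; split=> //.
  by exists 0 => _ [z _ <-]; rewrite normc0 mul0r.
rewrite !Hinfty_predP !inE => -[df [Mf Mfub] f0] [dg [Mg Mgub] g0]; split.
- move=> z dz; apply: derivableD; last exact: dg.
  by apply: derivableZ; exact: df.
- exists (normc k * Mf + Mg) => _ [z dz <-].
  have vz := weight_rad_gt0 dz.
  have := le_normcD (k * f z : Rcomplex R) (g z).
  move=> /(ler_wpM2r (ltW vz))/le_trans; apply.
  rewrite mulrDl normcM -mulrA lerD//.
    apply: ler_wpM2l; last by apply: Mfub; exists z.
    by case: k => ? ? /=; rewrite sqrtr_ge0.
  by apply: Mgub; exists z.
- move=> z dz.
  have -> : (k *: f + g) z = k *: f z + g z by [].
  by rewrite f0// g0// scaler0 addr0.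
Qed.

HB.instance Definition _ :=
  GRing.isSubmodClosed.Build _ _ Hinfty_pred Hinfty_submod_closed.

End Hinfty_pred.

Record Hinfty (R : realType) (v : weight R) := MkHinfty {
  Hinfty_fun :> Cplx R -> Cplx R;
  Hinfty_funP : Hinfty_fun \in Hinfty_pred v }.

HB.instance Definition _ (R : realType) (v : weight R) :=
  [isSub for @Hinfty_fun R v].
HB.instance Definition _ (R : realType) (v : weight R) :=
  [Choice of Hinfty v by <:].
HB.instance Definition _ (R : realType) (v : weight R) :=
  [SubChoice_isSubLmodule of Hinfty v by <:].

Section Hinfty_norm.
Variables (R : realType) (v : weight R).

Definition Hnorm (h : Hinfty v) : R := sup (weighted_values v h).

Lemma Hnorm_has_sup (h : Hinfty v) : has_sup (weighted_values v h).
Proof.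
split; last by have := Hinfty_funP h; rewrite Hinfty_predP inE => -[].
exists (normc (h 0) * v (normc (0 : Cplx R))%:C); exists 0 => //.
exact: disc0.
Qed.

Lemma Hnorm_ub (h : Hinfty v) z :
  disc z -> normc (h z) * v (normc z)%:C <= Hnorm h.
Proof. by move=> dz; apply: ub_le_sup; [case: (Hnorm_has_sup h)|exists z]. Qed.

Lemma Hnorm_le (h : Hinfty v) M :
  (forall z, disc z -> normc (h z) * v (normc z)%:C <= M) -> Hnorm h <= M.
Proof.
move=> hM; apply: ge_sup; first by case: (Hnorm_has_sup h).
by move=> _ [z dz <-]; exact: hM.
Qed.

Lemma normc_ge0 (z : Cplx R) : 0 <= normc z.
Proof. by case: z => ? ? /=; rewrite sqrtr_ge0. Qed.

Lemma Hnorm_ge0 (h : Hinfty v) : 0 <= Hnorm h.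
Proof.
apply: le_trans (Hnorm_ub h (@disc0 R)).
by apply: mulr_ge0; [exact: normc_ge0|apply/ltW/weight_rad_gt0; exact: disc0].
Qed.

Lemma HnormD (f g : Hinfty v) :
  (Hnorm (f + g))%:C <= (Hnorm f)%:C + (Hnorm g)%:C :> R[i].
Proof.
rewrite -rmorphD lecR; apply: Hnorm_le => z dz.
have := le_normcD (f z : Rcomplex R) (g z).
move=> /(ler_wpM2r (ltW (weight_rad_gt0 v dz)))/le_trans; apply.
by rewrite mulrDl lerD// Hnorm_ub.
Qed.

Lemma HnormZ_le (k : R[i]) (f : Hinfty v) :
  Hnorm (k *: f) <= normc k * Hnorm f.
Proof.
apply: Hnorm_le => z dz.
have -> : (k *: f) z = k * f z by [].
by rewrite normcM -mulrA ler_wpM2l ?normc_ge0 ?Hnorm_ub.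
Qed.

Lemma HnormZ (k : R[i]) (f : Hinfty v) :
  (Hnorm (k *: f))%:C = `|k| * (Hnorm f)%:C :> R[i].
Proof.
have -> : `|k| = (normc k)%:C by [].
rewrite -rmorphM; congr (_%:C); apply/eqP; rewrite eq_le HnormZ_le/=.
have [->|k0] := eqVneq k 0; first by rewrite normc0 mul0r Hnorm_ge0.
have nk0 : 0 < normc k.
  rewrite lt_neqAle normc_ge0 andbT eq_sym.
  by apply: contra k0 => /eqP/eq0_normc ->.
rewrite -ler_pdivlMl// -normcV.
by have := HnormZ_le k^-1 (k *: f); rewrite scalerA mulVf// scale1r.
Qed.

Lemma Hnorm_eq0 (f : Hinfty v) : (Hnorm f)%:C = 0 :> R[i] -> f = 0.
Proof.
move=> /complexI f0; apply: val_inj; apply/funext => z /=.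
have [dz|ndz] := pselect (disc z); last first.
  by have := Hinfty_funP f; rewrite Hinfty_predP inE => -[_ _ /(_ z ndz)].
apply: eq0_normc; apply/eqP; rewrite eq_le normc_ge0 andbT.
have := Hnorm_ub f dz; rewrite f0.
by rewrite pmulr_lle0// weight_rad_gt0.
Qed.

HB.instance Definition _ := @Lmodule_isNormed.Build R[i] (Hinfty v)
  (fun h => (Hnorm h)%:C) HnormD HnormZ Hnorm_eq0.

Lemma HnormE (h : Hinfty v) : `|h| = (Hnorm h)%:C.
Proof. by []. Qed.

End Hinfty_norm.

Section conditions.
Variables (R : realType) (v : weight R).
Let mu := @lebesgue_measure R.

(* Extended-valued, since the integral diverges at 0 for p <= -1. *)
Definition moment (p : R) : \bar R :=
  (\int[mu]_(r in `]0%R, 1%R[) (r `^ p * radial_part v r)%:E)%E.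

Definition moment_ratio_bounded : Prop :=
  exists2 eps : R, 0 < eps &
    (ereal_sup [set moment (n%:R - n%:R `^ eps) / moment n%:R
               | n in [set n : nat | (0 < n)%N]] < +oo)%E.

(* The weight extended to [0, 1] by v(1) = 0. *)
Definition weight_ext (r : R) : R := if r < 1 then radial_part v r else 0.

Definition is_argmax (m r : R) : Prop :=
  0 <= r <= 1 /\
  forall s, 0 <= s <= 1 -> s `^ m * weight_ext s <= r `^ m * weight_ext r.

(* The maximum point need not be unique; rho is a fixed choice of them:
   rho m is the chosen maximum point r_m of r^m v(r). *)
Definition condB : Prop :=
  exists2 rho : R -> R, (forall m, 0 < m -> is_argmax m (rho m)) &
  forall b1, 1 < b1 -> exists2 b2, 1 < b2 & exists2 c, 0 < c &
  forall m n, 0 < m -> 0 < n ->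
    (rho m / rho n) `^ m * (weight_ext (rho m) / weight_ext (rho n)) <= b1 ->
    c <= m -> c <= n -> c <= `|m - n| ->
    (rho n / rho m) `^ n * (weight_ext (rho n) / weight_ext (rho m)) <= b2.

End conditions.

Section symbols.
Variables (R : realType) (a : Cplx R -> R).
Let mu := @lebesgue_measure R.

Definition disc_xy : set (R * R) := [set p | disc (p.1 +i* p.2)].

(* Area measure on the plane is the product measure on R * R; its measurable
   sets are the Borel sets, so that a is a Borel representative of its class
   and its restriction to the radius [0, 1[ is Borel too. *)
Definition L1_disc : Prop :=
  (mu \x mu)%E.-integrable disc_xy (fun p => (a (p.1 +i* p.2))%:E).

Definition radial_ae : Prop :=
  {ae (mu \x mu)%E, forall p : R * R, disc_xy p ->
    a (p.1 +i* p.2) = a (normc (p.1 +i* p.2))%:C}.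

End symbols.

Section toeplitz.
Variables (R : realType) (v : weight R) (a : Cplx R -> R).
Let mu := @lebesgue_measure R.

Definition toeplitz_coef (n : nat) : R :=
  (\int[mu]_(r in `]0, 1[)
     (r ^+ n.*2.+1 * radial_part v r * radial_part a r)) /
  (\int[mu]_(r in `]0, 1[) (r ^+ n.*2.+1 * radial_part v r)).

Definition taylor_coef (h : Cplx R -> Cplx R) (n : nat) : Cplx R :=
  (derive1n n h 0 : R[i]) / (n`!)%:R.

(* When a is only in L^1, a * h need not be square integrable; for radial a the
   operator h |-> P_v (a * h) is the multiplier that sends the monomial z^n to
   toeplitz_coef n * z^n, and T is required to act so on Taylor series.
   T is the Toeplitz operator T_a on Hinfty v; the convergence of the defining
   series on the disc is part of the assertion. *)
Definition is_toeplitz (T : Hinfty v -> Hinfty v) : Prop :=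
  forall (h : Hinfty v) (z : Cplx R), disc z ->
    series (fun n => (toeplitz_coef n)%:C * taylor_coef h n * z ^+ n : Cplx R)
      @ \oo --> T h z.

End toeplitz.

Section operators.
Variables (R : realType) (V : normedModType R[i]).

Definition bounded_operator (T : V -> V) : Prop :=
  exists M : R, forall h, `|T h| <= M%:C * `|h|.

Definition compact_operator (T : V -> V) : Prop :=
  forall A : set V, bounded_set A -> precompact (T @` A).

End operators.

(* Main.v *)
(* Condition (B) yields exponents m_0 < m_1 < ... with m_(j+1) <= K m_j such that
   the ratios of consecutive normalized weights r^(m_j) v(r) decay geometrically
   away from the maximum points.  Hence the blocks m_j <= k < m_(j+1) of a Taylor
   series in H_v^oo contribute at a given radius with geometric weights.  On one
   block, partial sums cost a factor log m_j (Landau), and by Abel summation a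
   nonnegative nonincreasing multiplier beta with beta_k log k <= K costs only K.
   A one-sided bound K0 on a' makes a + K0 (1 - r) and K0 (1 - r) nonincreasing
   near 1, so the coefficients of T_a are, up to an exponentially small error, the
   difference of two such multipliers; their logarithmic decay comes from the
   moment condition, which localizes the moments of order n at
   1 - r < n^(-eps/2).  For the compactness, the tails of the multiplier have small
   norm, and bounded sequences converge coefficientwise along ultrafilters. *)
From HB Require Import structures.
Require Import Defs.
From mathcomp Require Import all_boot all_order all_algebra.
From mathcomp Require Import all_classical all_reals all_analysis.
From mathcomp Require Import complex measurable_realfun.
From mathcomp Require Import ring lra zify.
Set Implicit Arguments.
Unset Strict Implicit.
Unset Printing Implicit Defensive.
Import Order.TTheory GRing.Theory Num.Theory.
Import numFieldNormedType.Exports.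
Import ComplexField.Normc.
Local Open Scope classical_set_scope.
Local Open Scope ring_scope.
Local Open Scope complex_scope.

(** With x_m = log r_m and u_m = log v(r_m), the quotient in condition (B) is the exponential of
    D(m, n) = m (x_m - x_n) + u_m - u_n >= 0, so (B) says that a bound on D(m, n) bounds D(n, m).
    The bound on m_(j+1) / m_j makes log k comparable throughout a block: the logarithm lost by
    truncating the series is then the one that beta_k log k <= K pays back. Multiplier bounds are
    proved for sequences cut off below an index N, with one constant for all N; N = 0 gives
    boundedness and large N the small tails. Taylor series are derived from Goursat's theorem.
    Coefficient extraction, Parseval and the maximum principle for polynomials use averages over
    roots of unity, which are exact finite sums. Polar coordinates for the symbol are avoided: if
    none of the integrals along the ray converges, all coefficients of T_a have the default value 0;
    otherwise the finitely many early coefficients go into the exponentially small error. *)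

(** * The real-valued modulus of a complex number *)

Section ComplexNorm.
Context {R : realType}.
Implicit Types (x y z w : R[i]) (e : R).

Lemma ncD x y : normc (x + y) <= normc x + normc y.
Proof. exact: le_normcD. Qed.

Lemma ncN x : normc (- x) = normc x.
Proof. exact: normcN. Qed.

Lemma nc_distC x y : normc (x - y) = normc (y - x).
Proof. by rewrite -ncN opprB. Qed.

Lemma ncB x y : normc (x - y) <= normc x + normc y.
Proof. by rewrite -(ncN y); exact: ncD. Qed.

Lemma nc_triB x y : normc x <= normc y + normc (x - y).
Proof. by rewrite -{1}(subrK y x) addrC; exact: ncD. Qed.

Lemma ncR (r : R) : normc r%:C = `|r|.
Proof. by rewrite /= expr0n/= addr0 sqrtr_sqr. Qed.

Lemma nc_nat n : normc (n%:R : R[i]) = n%:R.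
Proof. by rewrite -[n%:R](rmorph_nat (real_complex R)) ncR normr_nat. Qed.

Lemma ncX x n : normc (x ^+ n) = normc x ^+ n.
Proof. by elim: n => [|n IH]; rewrite ?normc1// !exprS normcM IH. Qed.

Lemma nc_eq0 x : (normc x == 0) = (x == 0).
Proof. by apply/eqP/eqP => [/eq0_normc//|->]; exact: normc0. Qed.

Lemma nc_gt0 x : (0 < normc x) = (x != 0).
Proof. by rewrite lt_neqAle normc_ge0 andbT eq_sym nc_eq0. Qed.

Lemma ncE x : (normc x)%:C = `|x|.
Proof. by []. Qed.

Lemma nc_sum I (r : seq I) (P : pred I) (F : I -> R[i]) :
  normc (\sum_(i <- r | P i) F i) <= \sum_(i <- r | P i) normc (F i).
Proof.
elim/big_ind2 : _ => //; first by rewrite normc0.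
by move=> x a y b xa yb; apply: le_trans (ncD _ _) _; exact: lerD.
Qed.

Lemma nc_Re x : `|complex.Re x| <= normc x.
Proof.
case: x => a b /=; rewrite -sqrtr_sqr ler_wsqrtr//.
by rewrite lerDl sqr_ge0.
Qed.

Lemma nc_Im x : `|complex.Im x| <= normc x.
Proof.
case: x => a b /=; rewrite -sqrtr_sqr ler_wsqrtr//.
by rewrite lerDr sqr_ge0.
Qed.

Lemma ncRI x : normc x <= `|complex.Re x| + `|complex.Im x|.
Proof.
case: x => a b /=.
have h : 0 <= `|a| + `|b| by rewrite addr_ge0.
rewrite -[leRHS](ger0_norm h) -sqrtr_sqr ler_wsqrtr//.
rewrite sqrrD !real_normK ?num_real// -addrA lerD2l addrC lerDl.
by rewrite mulrn_wge0// mulr_ge0.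
Qed.

Lemma nc_conj x : normc x^*%C = normc x.
Proof. by case: x => a b /=; rewrite sqrrN. Qed.

Lemma ReB x y : complex.Re (x - y) = complex.Re x - complex.Re y.
Proof. by case: x y => [a b] [c d]. Qed.

Lemma ImB x y : complex.Im (x - y) = complex.Im x - complex.Im y.
Proof. by case: x y => [a b] [c d]. Qed.

Lemma nc_small_eq0 x : (forall e, 0 < e -> normc x <= e) -> x = 0.
Proof.
move=> h; apply/eqP; rewrite -nc_eq0 eq_le normc_ge0 andbT.
by apply/ler_addgt0Pl => e e0; rewrite addr0; exact: h.
Qed.

End ComplexNorm.

(** * Limits and complex differentiability in epsilon-delta form *)

Section ComplexTopology.
Context {R : realType}.
Implicit Types (f : Cplx R -> Cplx R) (z c l : Cplx R).

Lemma posC_real (e : R[i]) : 0 < e -> exists2 d : R, 0 < d & e = d%:C.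
Proof.
case: e => a b; rewrite ltcE/= => /andP[/eqP -> a0].
by exists a.
Qed.

Lemma cvgC_seqP (u : nat -> Cplx R) l : (u n @[n --> \oo] --> l) <->
  (forall e : R, 0 < e -> exists N, forall n, (N <= n)%N -> normc (l - u n) < e).
Proof.
split=> [/cvgrPdist_lt h e e0|h].
  have e0' : 0 < e%:C :> R[i] by rewrite ltcR.
  have [N _ hN] := h _ e0'.
  by exists N => n /hN /=; rewrite -ncE ltcR.
apply/cvgrPdist_lt => e /posC_real [d d0 ->].
have [N hN] := h d d0; exists N => // n /= /hN.
by rewrite -ncE ltcR.
Qed.

Lemma cvgC_seq_unique (u : nat -> Cplx R) l l' :
  u n @[n --> \oo] --> l -> u n @[n --> \oo] --> l' -> l = l'.
Proof. by move=> h1 h2; exact: (cvg_unique _ h1 h2). Qed.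

Lemma nbhsC_P z (P : Cplx R -> Prop) : (\forall w \near z, P w) <->
  (exists2 d : R, 0 < d & forall w, normc (w - z) < d -> P w).
Proof.
split=> [/nbhs_ballP [e /= /posC_real [d d0 ->] h]|[d d0 h]].
  exists d => // w wz; apply: h; rewrite /ball/= -ncE ltcR.
  by rewrite nc_distC.
apply/nbhs_ballP; exists d%:C => /=; first by rewrite ltcR.
by move=> w; rewrite /ball/= -ncE ltcR nc_distC; exact: h.
Qed.

(** The remainder form involves no division by w, so that remainders of power series can be summed
    term by term and rewritten in real coordinates. *)
Definition cdiff (f : R[i] -> R[i]) (z c : R[i]) := forall e : R, 0 < e ->
  exists2 d : R, 0 < d & forall w, normc w < d ->
    normc (f (z + w) - f z - c * w) <= e * normc w.

Lemma cdiff_is_derive f z c : cdiff f z c -> is_derive (z : Cplx R) (1 : Cplx R) f c.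
Proof.
move=> h.
have H : h^-1 *: (f (h *: (1 : Cplx R) + z) - f z) @[h --> (0 : Cplx R)^'] --> c.
  apply/cvgrPdist_le => e /posC_real [d d0 ->].
  have [d1 d10 h1] := h d d0.
  apply/nbhsC_P; exists d1 => // w; rewrite subr0 => wd1 w0.
  rewrite -ncE lecR.
  have nw : 0 < normc w by rewrite nc_gt0.
  rewrite -(ler_pM2r nw) -normcM -ncN.
  apply: le_trans (h1 w wd1); rewrite le_eqVlt; apply/orP; left; apply/eqP.
  congr normc.
  have -> : w^-1 *: (f (w *: (1 : Cplx R) + z) - f z) =
            w^-1 * (f (z + w) - f z) :> R[i].
    by rewrite (_ : w *: (1 : Cplx R) + z = z + w)// addrC; congr (_ + _); exact: mulr1.
  by field.
by apply: DeriveDef; [exact: cvgP H|exact: cvg_lim H].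
Qed.

Lemma derivable_cdiff f z : derivable f z (1 : Cplx R) -> exists c, cdiff f z c.
Proof.
move=> /cvg_ex [c H]; exists c => e e0.
move/cvgrPdist_le : H => /(_ e%:C); rewrite ltcR => /(_ e0) /nbhsC_P [d d0 h].
exists d => // w wd.
have [->|w0] := eqVneq w 0; first by rewrite addr0 !subrr mulr0 subrr normc0 mulr0.
have := h w; rewrite subr0 => /(_ wd w0); rewrite -ncE lecR.
have nw : 0 < normc w by rewrite nc_gt0.
rewrite -(ler_pM2r nw) -normcM -ncN; apply: le_trans.
rewrite le_eqVlt; apply/orP; left; apply/eqP.
congr normc.
have -> : w^-1 *: (f (w *: (1 : Cplx R) + z) - f z) =
          w^-1 * (f (z + w) - f z) :> R[i].
  by rewrite (_ : w *: (1 : Cplx R) + z = z + w)// addrC; congr (_ + _); exact: mulr1.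
by field.
Qed.

Lemma cdiff_derive1 f z c : cdiff f z c -> derive1 f z = c.
Proof. by move/cdiff_is_derive => h; rewrite derive1E; case: h. Qed.

Lemma cdiff_derivable f z c : cdiff f z c -> derivable f z (1 : Cplx R).
Proof. by move/cdiff_is_derive => [h _]. Qed.

End ComplexTopology.

(** * Convergent series and geometric majorants *)

Section Sums.
Context {R : realType}.
Implicit Types (u c : nat -> R[i]) (l : R[i]).

Definition hassum u l := forall e : R, 0 < e ->
  exists N, forall n, (N <= n)%N -> normc (l - \sum_(0 <= k < n) u k) < e.

Lemma hassumP u l : (series (u : nat -> Cplx R) n @[n --> \oo] --> (l : Cplx R)) <-> hassum u l.
Proof. exact: (cvgC_seqP (series (u : nat -> Cplx R))). Qed.

Lemma hassum_unique u l l' : hassum u l -> hassum u l' -> l = l'.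
Proof. by move=> /hassumP h /hassumP h'; exact: cvgC_seq_unique h h'. Qed.

Lemma hassum_ext u u' l : (forall k, u k = u' k) -> hassum u l -> hassum u' l.
Proof.
move=> uu' h e e0; have [N hN] := h e e0; exists N => n /hN.
by under eq_bigr do rewrite uu'.
Qed.

Lemma hassumD u u' l l' : hassum u l -> hassum u' l' ->
  hassum (fun k => u k + u' k) (l + l').
Proof.
move=> h h' e e0; have e20 : 0 < e / 2 by rewrite divr_gt0.
have [N hN] := h _ e20; have [N' hN'] := h' _ e20.
exists (maxn N N') => n; rewrite geq_max => /andP[/hN a /hN' b].
rewrite big_split/= opprD addrACA; apply: le_lt_trans (ncD _ _) _.
by rewrite (splitr e) ltrD.
Qed.

Lemma hassumZ (b : R[i]) u l : hassum u l -> hassum (fun k => b * u k) (b * l).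
Proof.
move=> h e e0.
have b0 : 0 < normc b + 1 by rewrite ltr_wpDl// normc_ge0.
have [N hN] := h _ (divr_gt0 e0 b0).
exists N => n /hN; rewrite -mulr_sumr -mulrBr normcM ltr_pdivlMr// => hh.
apply: le_lt_trans hh; rewrite mulrC ler_wpM2l ?normc_ge0// lerDl//.
Qed.

Lemma hassumB u u' l l' : hassum u l -> hassum u' l' ->
  hassum (fun k => u k - u' k) (l - l').
Proof.
move=> h /(hassumZ (-1)) h'; have := hassumD h h'.
rewrite mulN1r; apply: hassum_ext => k; by rewrite mulN1r.
Qed.

Lemma hassum_le u l (B : R) : hassum u l ->
  (forall N, exists2 n, (N <= n)%N & normc (\sum_(0 <= k < n) u k) <= B) -> normc l <= B.
Proof.
move=> h hB; apply/ler_addgt0Pr => e e0.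
have [N /(_ _ _) hN] := h e e0.
have [n Nn nB] := hB N.
apply: le_trans (nc_triB l (\sum_(0 <= k < n) u k)) _.
by rewrite lerD// ltW// hN.
Qed.

Lemma hassum_bounded u l (B : R) : hassum u l ->
  (forall n, normc (\sum_(0 <= k < n) u k) <= B) -> normc l <= B.
Proof. by move=> h hB; apply: (hassum_le h) => N; exists N. Qed.

Lemma hassum_term u l : hassum u l -> exists C : R, forall k, normc (u k) <= C.
Proof.
move=> h; have [N hN] := h 1 ltr01.
exists (\sum_(0 <= k < N) normc (u k) + 2) => k.
have [kN|Nk] := ltnP k N.
  rewrite (bigD1_seq k)/= ?mem_index_iota ?iota_uniq// -addrA lerDl addr_ge0//.
  by apply: sumr_ge0 => i _; exact: normc_ge0.
have h1 := hN k Nk; have h2 := hN k.+1 (leqW Nk).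
have -> : u k = (l - \sum_(0 <= k < k) u k) - (l - \sum_(0 <= k < k.+1) u k).
  by rewrite big_nat_recr//=; ring.
apply: le_trans (ncB _ _) _; rewrite ler_wpDl//.
  by apply: sumr_ge0 => i _; exact: normc_ge0.
by move: h1 h2; lra.
Qed.

(** With B = C / (1 - q) one has C q^n = B q^n - B q^(n+1). Hence the partial sums shifted by - B
    q^n increase, those shifted by B q^n decrease, and the supremum of the former is the sum. *)
Lemma geo_sum_real (u : nat -> R) (C q : R) : q < 1 ->
  (forall k, `|u k| <= C * q ^+ k) ->
  exists l : R, forall n, `|l - \sum_(0 <= k < n) u k| <= C / (1 - q) * q ^+ n.
Proof.
move=> q1 h; set B := C / (1 - q).
have q1' : 0 < 1 - q by rewrite subr_gt0.
have BE : B * (1 - q) = C by rewrite /B divfK// gt_eqF.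
pose s n := \sum_(0 <= k < n) u k.
have sS n : s n.+1 = s n + u n by rewrite /s big_nat_recr.
pose a n := s n - B * q ^+ n; pose b n := s n + B * q ^+ n.
have aS n : a n <= a n.+1.
  rewrite /a sS exprS; have := h n; rewrite ler_norml -BE => /andP[h1 h2].
  by rewrite -subr_ge0; move: h1; rewrite -subr_ge0; congr (0 <= _); ring.
have bS n : b n.+1 <= b n.
  rewrite /b sS exprS; have := h n; rewrite ler_norml -BE => /andP[h1 h2].
  by rewrite -subr_ge0; move: h2; rewrite -subr_ge0; congr (0 <= _); ring.
have ab n : a n <= b n.
  rewrite /a /b lerD2l; have : 0 <= B * q ^+ n.
    rewrite -(pmulr_lge0 _ q1') mulrAC BE.
    by apply: le_trans (h n); rewrite normr_ge0.
  by lra.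
have amono m n : (m <= n)%N -> a m <= a n.
  by apply: (homo_leq (r := fun x y : R => x <= y)) => //; exact: le_trans.
have bmono m n : (m <= n)%N -> b n <= b m.
  apply: (homo_leq (r := fun x y : R => y <= x)) => // x y z h1 h2.
  exact: le_trans h2 h1.
have abmn m n : a m <= b n.
  apply: le_trans (amono _ _ (leq_maxl m n)) _.
  by apply: le_trans (ab _) _; apply: bmono; exact: leq_maxr.
exists (sup (range a)) => n.
rewrite -/(s n) ler_norml; apply/andP; split.
  rewrite lerBrDl; have : a n <= sup (range a).
    by apply: ub_le_sup; [exists (b 0%N) => _ [m _ <-]; exact: abmn|exists n].
  by rewrite /a.
rewrite lerBlDl; apply: ge_sup; first by exists (a 0%N), 0%N.
by move=> _ [m _ <-]; exact: abmn.
Qed.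

Lemma Re_sum I (r : seq I) (F : I -> R[i]) :
  complex.Re (\sum_(i <- r) F i) = \sum_(i <- r) complex.Re (F i).
Proof.
elim: r => [|i r IH]; rewrite ?big_nil// !big_cons -IH.
by case: (F i) => a b; case: (\sum_(_ <- _) _).
Qed.

Lemma Im_sum I (r : seq I) (F : I -> R[i]) :
  complex.Im (\sum_(i <- r) F i) = \sum_(i <- r) complex.Im (F i).
Proof.
elim: r => [|i r IH]; rewrite ?big_nil// !big_cons -IH.
by case: (F i) => a b; case: (\sum_(_ <- _) _).
Qed.

Lemma geo_sum u (C q : R) : q < 1 -> (forall k, normc (u k) <= C * q ^+ k) ->
  exists l, forall n, normc (l - \sum_(0 <= k < n) u k) <= 2 * (C / (1 - q)) * q ^+ n.
Proof.
move=> q1 h.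
have [a ha] := geo_sum_real q1 (fun k => le_trans (nc_Re (u k)) (h k)).
have [b hb] := geo_sum_real q1 (fun k => le_trans (nc_Im (u k)) (h k)).
exists (a +i* b) => n; apply: le_trans (ncRI _) _.
rewrite ReB ImB Re_sum Im_sum/=.
apply: le_trans (lerD (ha n) (hb n)) _.
by rewrite le_eqVlt; apply/orP; left; apply/eqP; ring.
Qed.

Lemma geo_small (C q e : R) : 0 <= q < 1 -> 0 < e ->
  exists N, forall n, (N <= n)%N -> C * q ^+ n < e.
Proof.
move=> /andP[q0 q1] e0.
have : (fun n => C * q ^+ n) @ \oo --> (C * 0 : R).
  by apply: cvgMl_tmp; apply: cvg_expr; rewrite ger0_norm.
rewrite mulr0 => /cvgrPdist_lt /(_ e e0) [N _ hN].
exists N => n /hN /=; rewrite sub0r normrN; apply: le_lt_trans.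
exact: ler_norm.
Qed.

Lemma geo_hassum u (C q : R) : 0 <= q < 1 -> (forall k, normc (u k) <= C * q ^+ k) ->
  exists2 l, hassum u l & forall n, normc (l - \sum_(0 <= k < n) u k) <= 2 * (C / (1 - q)) * q ^+ n.
Proof.
move=> q01 h; have /andP[q0 q1] := q01.
have [l hl] := geo_sum q1 h; exists l => // e e0.
have [N hN] := geo_small (2 * (C / (1 - q))) q01 e0.
by exists N => n /hN; exact: le_lt_trans (hl n).
Qed.

(** By Bernoulli, (k + 1) h <= 1 + k h <= (1 + h)^k for 0 < h <= 1, so two factors k + 1 cost (1 +
    h)^(2k); the choice h = (1 - q) / 4 keeps q (1 + h)^2 below 1. *)
Lemma poly_geo (q : R) : 0 <= q < 1 -> exists q2 C2 : R,
  0 <= q2 < 1 /\ forall k, (k.+1%:R) ^+ 2 * q ^+ k <= C2 * q2 ^+ k.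
Proof.
move=> /andP[q0 q1]; pose h := (1 - q) / 4.
have h0 : 0 < h by rewrite divr_gt0// subr_gt0.
have h1 : h <= 1 by rewrite /h; lra.
exists (q * (1 + h) ^+ 2), (h ^- 2); split.
  rewrite mulr_ge0//=; last by rewrite exprn_ge0// addr_ge0// ltW.
  by rewrite /h expr2; nra.
clearbody h; move=> k; have h0' : h != 0 by rewrite gt_eqF.
have -> : k.+1%:R ^+ 2 * q ^+ k = (k.+1%:R * h) ^+ 2 * (h ^- 2 * q ^+ k).
  by rewrite exprMn; field.
have -> : h ^- 2 * (q * (1 + h) ^+ 2) ^+ k = ((1 + h) ^+ k) ^+ 2 * (h ^- 2 * q ^+ k).
  by rewrite [(q * _) ^+ k]exprMn [(_ ^+ k) ^+ 2]exprAC mulrA mulrC.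
rewrite ler_wpM2r//; first by rewrite mulr_ge0 ?invr_ge0 ?exprn_ge0 ?(ltW h0).
rewrite lerXn2r// ?nnegrE ?mulr_ge0 ?exprn_ge0 ?addr_ge0 ?(ltW h0)//.
apply: (@le_trans _ _ (1 + k%:R * h)).
  by rewrite -natr1 mulrDl mul1r addrC lerD2r.
elim: k => [|k IH]; first by rewrite expr0 mul0r addr0.
rewrite exprS; apply: le_trans (_ : (1 + h) * (1 + k%:R * h) <= _); last first.
  by rewrite ler_wpM2l// addr_ge0// ltW.
have : 0 <= k%:R :> R by rewrite ler0n.
by rewrite -natr1; nra.
Qed.

End Sums.

(** * Power series and their Taylor coefficients *)

Section PowerSeries.
Context {R : realType}.
Implicit Types (c : nat -> R[i]) (f : R[i] -> R[i]) (rad : R).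

Definition pseries c f rad := forall z, normc z < rad ->
  hassum (fun k => c k * z ^+ k) (f z).

Lemma pseries_growth c f rad s : pseries c f rad -> 0 <= s < rad ->
  exists C : R, forall k, normc (c k) * s ^+ k <= C.
Proof.
move=> h /andP[s0 s1].
have ns : normc s%:C = s by rewrite ncR ger0_norm.
have /h/hassum_term [C hC] : normc s%:C < rad by rewrite ns.
by exists C => k; have := hC k; rewrite normcM ncX ns.
Qed.

(** The terms are bounded at a radius t strictly between s and [rad]; going down to s gains the
    ratio s / t. *)
Lemma pseries_geo c f rad s : pseries c f rad -> 0 < s < rad ->
  exists C q : R, 0 <= q < 1 /\ forall k, normc (c k) * s ^+ k <= C * q ^+ k.
Proof.
move=> h /andP[s0 s1]; pose t := (s + rad) / 2.
have st : s < t by rewrite /t; lra.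
have tr : 0 <= t < rad by rewrite /t; lra.
have t0 : 0 < t by apply: lt_trans st.
have [C hC] := pseries_growth h tr.
exists C, (s / t); split.
  by rewrite divr_ge0 ?ltW//= ltr_pdivrMr// mul1r.
move=> k; rewrite expr_div_n mulrA ler_pdivlMr ?exprn_gt0//.
by rewrite mulrAC ler_wpM2r// exprn_ge0// ltW.
Qed.

(** The remainder for k + 1 is z + w times the remainder for k, plus k z^(k-1) w^2. The factor s^2
    on the left avoids the exponent k - 2. *)
Lemma expr_taylor2 (z w : R[i]) (s : R) k : 0 < s -> normc z <= s -> normc (z + w) <= s ->
  normc ((z + w) ^+ k - z ^+ k - k%:R * z ^+ k.-1 * w) * s ^+ 2 <=
  k%:R ^+ 2 * s ^+ k * normc w ^+ 2.
Proof.
move=> s0 zs zws; elim: k => [|k IH].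
  by rewrite !expr0 !mul0r subrr subr0 normc0 mul0r expr0n/= !mul0r.
have -> : (z + w) ^+ k.+1 - z ^+ k.+1 - k.+1%:R * z ^+ k.+1.-1 * w =
   (z + w) * ((z + w) ^+ k - z ^+ k - k%:R * z ^+ k.-1 * w) + k%:R * z ^+ k.-1 * w ^+ 2.
  case: k {IH} => [|k] /=; first by rewrite !expr0 !expr1; ring.
  by rewrite !exprS -[in RHS]natr1 -[in LHS]natr1 -[k.+1%:R]natr1; ring.
apply: le_trans (ler_wpM2r _ (ncD _ _)) _; first by rewrite exprn_ge0// ltW.
have -> : normc (k%:R * z ^+ k.-1 * w ^+ 2) = k%:R * normc z ^+ k.-1 * normc w ^+ 2.
  by rewrite normcM ncX normcM ncX nc_nat.
rewrite mulrDl normcM.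
have h1 : normc (z + w) * normc ((z + w) ^+ k - z ^+ k - k%:R * z ^+ k.-1 * w) * s ^+ 2
  <= s * (k%:R ^+ 2 * s ^+ k * normc w ^+ 2).
  rewrite -mulrA; apply: le_trans (ler_wpM2l _ IH); last exact: ltW.
  by rewrite ler_wpM2r// mulr_ge0 ?normc_ge0// exprn_ge0// ltW.
have h2 : k%:R * normc z ^+ k.-1 * normc w ^+ 2 * s ^+ 2 <= k%:R * s ^+ k.+1 * normc w ^+ 2.
  case: k {IH h1} => [|k]; first by rewrite !mul0r.
  rewrite /= (_ : k.+1%:R * s ^+ k.+2 * normc w ^+ 2 = k.+1%:R * s ^+ k * normc w ^+ 2 * s ^+ 2).
    by rewrite !ler_wpM2r ?exprn_ge0 ?normc_ge0 ?(ltW s0)// ler_wpM2l// lerXn2r ?nnegrE ?normc_ge0 ?(ltW s0).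
  by rewrite !exprS; ring.
apply: le_trans (lerD h1 h2) _.
have -> : s * (k%:R ^+ 2 * s ^+ k * normc w ^+ 2) + k%:R * s ^+ k.+1 * normc w ^+ 2 =
   (k%:R ^+ 2 + k%:R) * (s ^+ k.+1 * normc w ^+ 2) by rewrite [s ^+ k.+1]exprS; ring.
rewrite -[leRHS]mulrA ler_wpM2r ?mulr_ge0 ?exprn_ge0 ?normc_ge0 ?ltW//.
have : 0 <= k%:R :> R by [].
rewrite -natr1; nra.
Qed.

(** The quadratic remainders of the monomials sum to at most B |w|^2, their factor k^2 being
    absorbed by [poly_geo]; this replaces a uniform convergence argument. *)
Lemma pseries_deriv c f rad : pseries c f rad -> forall z, normc z < rad ->
  exists2 d, hassum (fun k => k.+1%:R * c k.+1 * z ^+ k) d & cdiff f z d.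
Proof.
move=> h z zr; pose s := (normc z + rad) / 2.
have z0 := normc_ge0 z.
have zs : normc z < s by rewrite /s; lra.
have s0 : 0 < s by apply: le_lt_trans zs.
have sr : 0 < s < rad by rewrite s0 /s/=; lra.
have [C0 [q0 [q01 hC0]]] := pseries_geo h sr.
have C00 : 0 <= C0.
  have := hC0 0%N; rewrite !expr0 !mulr1; apply: le_trans; exact: normc_ge0.
have [q [C2 [q1 hC2]]] := poly_geo q01.
have C20 : 0 <= C2.
  by have := hC2 0%N; rewrite !expr0 !mulr1; apply: le_trans.
pose C := C0 * C2.
have hC k : k.+1%:R ^+ 2 * (normc (c k) * s ^+ k) <= C * q ^+ k.
  rewrite /C -mulrA; apply: le_trans (ler_wpM2l C00 (hC2 k)).
  by rewrite [leRHS]mulrCA ler_wpM2l// exprn_ge0//.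
have b1 k : normc (k.+1%:R * c k.+1 * z ^+ k) <= (C * q / s) * q ^+ k.
  rewrite -(ler_pM2r s0) (_ : C * q / s * q ^+ k * s = C * q ^+ k.+1); last first.
    by rewrite exprS; field; rewrite gt_eqF.
  apply: le_trans (hC k.+1); rewrite !normcM ncX nc_nat -!mulrA; apply: ler_pM => //.
  - by rewrite mulr_ge0 ?normc_ge0// mulr_ge0 ?exprn_ge0 ?normc_ge0// ltW.
  - rewrite -subr_ge0; have : 1 <= k.+2%:R :> R by rewrite ler1n.
    by rewrite -[k.+2%:R]natr1; have : 0 <= k.+1%:R :> R by []; nra.
  - apply: (@le_trans _ _ (normc (c k.+1) * s ^+ k.+1)); last first.
      by rewrite ler_peMl ?ler1n// mulr_ge0 ?normc_ge0 ?exprn_ge0// ltW.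
    rewrite ler_wpM2l ?normc_ge0// exprSr.
    by rewrite (ler_wpM2r (ltW s0))// lerXn2r ?nnegrE ?normc_ge0 ?(ltW s0) ?(ltW zs).
have [d hd _] := geo_hassum q1 b1.
exists d => //; pose B := C / (1 - q) / s ^+ 2.
have B0 : 0 <= B.
  case/andP: q1 => _ q1'.
  apply: divr_ge0; last by rewrite exprn_ge0// ltW.
  by apply: divr_ge0; [exact: mulr_ge0|rewrite subr_ge0 ltW].
have key w : normc w < s - normc z ->
    normc (f (z + w) - f z - d * w) <= B * normc w ^+ 2.
  move=> ws; have zws : normc (z + w) < s.
    by apply: le_lt_trans (ncD _ _) _; lra.
  have srr : s < rad by case/andP: sr.
  have hz := h z zr; have hzw := h (z + w) (lt_trans zws srr).
  (* The same series with a zero term k = 0 in front, ready for termwise subtraction; [0.-1 = 0] is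
     harmless because of the factor 0. *)
  have hd' : hassum (fun k => k%:R * c k * z ^+ k.-1) d.
    move=> e e0; have [N hN] := hd e e0; exists N.+1 => -[//|n] Nn.
    by rewrite big_nat_recl//= !mul0r add0r hN.
  have H := hassumB (hassumB hzw hz) (hassumZ w hd').
  have -> : f (z + w) - f z - d * w = f (z + w) - f z - w * d by rewrite [d * w]mulrC.
  apply: hassum_bounded H _ => n.
  have -> : \sum_(0 <= k < n) (c k * (z + w) ^+ k - c k * z ^+ k - w * (k%:R * c k * z ^+ k.-1))
    = \sum_(0 <= k < n) c k * ((z + w) ^+ k - z ^+ k - k%:R * z ^+ k.-1 * w).
    by apply: eq_bigr => k _; ring.
  apply: le_trans (nc_sum _ _ _) _.
  apply: le_trans (_ : \sum_(0 <= k < n) (C / s ^+ 2 * normc w ^+ 2) * q ^+ k <= _).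
    apply: ler_sum => k _; rewrite normcM.
    have := expr_taylor2 k s0 (ltW zs) (ltW zws) => hk.
    rewrite -(ler_pM2r (exprn_gt0 2 s0)).
    rewrite (_ : C / s ^+ 2 * normc w ^+ 2 * q ^+ k * s ^+ 2 = C * q ^+ k * normc w ^+ 2); last first.
      by field; rewrite gt_eqF.
    rewrite -[leLHS]mulrA; apply: le_trans (ler_wpM2l (normc_ge0 _) hk) _.
    rewrite mulrA ler_wpM2r ?exprn_ge0 ?normc_ge0//.
    apply: le_trans (hC k); rewrite mulrCA ler_wpM2r//.
      by rewrite mulr_ge0 ?exprn_ge0 ?normc_ge0// ltW.
    by rewrite lerXn2r ?nnegrE ?ler0n// ler_nat.
  rewrite -mulr_sumr; have q1' : 0 < 1 - q by rewrite subr_gt0; case/andP: q1.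
  apply: le_trans (_ : C / s ^+ 2 * normc w ^+ 2 * (1 - q)^-1 <= _).
    have CC : 0 <= C / s ^+ 2 * normc w ^+ 2.
      apply: mulr_ge0; last by rewrite exprn_ge0// normc_ge0.
      by apply: divr_ge0; [exact: mulr_ge0|rewrite exprn_ge0// ltW].
    apply: (ler_wpM2l CC).
    rewrite -[leRHS]div1r ler_pdivlMr// mulrC.
    have := subrX1 q n; rewrite big_mkord => hh.
    have : (1 - q) * \sum_(i < n) q ^+ i = 1 - q ^+ n.
      by rewrite -opprB mulNr -hh opprB.
    have : 0 <= q ^+ n by rewrite exprn_ge0//; case/andP: q1.
    by lra.
  by rewrite /B le_eqVlt; apply/orP; left; apply/eqP; field; rewrite !gt_eqF.
move=> e e0; exists (Num.min (s - normc z) (e / (B + 1))).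
  by rewrite lt_min subr_gt0 zs divr_gt0// ltr_wpDl.
move=> w; rewrite lt_min => /andP[w1 w2]; apply: le_trans (key w w1) _.
rewrite expr2 mulrA ler_wpM2r ?normc_ge0//.
move: w2; rewrite ltr_pdivlMr ?ltr_wpDl// => w2.
by apply: le_trans (ltW w2); have := normc_ge0 w; nra.
Qed.

Definition dcoef c : nat -> R[i] := fun k => k.+1%:R * c k.+1.

Lemma pseries_derive1 c f rad : pseries c f rad ->
  pseries (dcoef c) (derive1 (f : Cplx R -> Cplx R)) rad.
Proof.
move=> h z zr; have [d hd /cdiff_derive1 fd] := pseries_deriv h zr.
by rewrite fd.
Qed.

Lemma pseries_at0 c f rad : 0 < rad -> pseries c f rad -> f 0 = c 0%N.
Proof.
move=> r0 h.
apply: (hassum_unique (h 0 _)); first by rewrite normc0.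
move=> e e0; exists 1%N => -[//|n] _.
rewrite big_nat_recl//= expr0 mulr1 big1 ?addr0 ?subrr ?normc0// => k _.
by rewrite expr0n/= mulr0.
Qed.

Lemma pseries_derive1n n : forall c f rad, 0 < rad -> pseries c f rad ->
  derive1n n (f : Cplx R -> Cplx R) 0 = n`!%:R * c n.
Proof.
elim: n => [|n IH] c f rad r0 h.
  by rewrite fact0 mul1r; exact: pseries_at0 h.
have := IH _ _ _ r0 (pseries_derive1 h).
rewrite /derive1n -iterSr => ->.
by rewrite /dcoef factS natrM mulrCA mulrA.
Qed.

(** Uniqueness of coefficients for any radius: it identifies the Cauchy coefficients taken at
    different radii, and later the coefficients of linear combinations and of limits. *)
Lemma taylor_coef_pseries c f rad n : 0 < rad -> pseries c f rad ->
  taylor_coef f n = c n.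
Proof.
move=> r0 h; rewrite /taylor_coef (pseries_derive1n n r0 h) mulrAC divff ?mul1r//.
Qed.

End PowerSeries.

(** * The bisection principle behind Goursat's theorem *)

Section Quartering.
Context {R : realType}.
Variables (N : R -> R -> R -> R -> R) (a0 b0 c0 d0 : R).
Hypotheses (ab0 : a0 <= b0) (cd0 : c0 <= d0).
Hypothesis sub : forall a m b c n d, a0 <= a -> a <= m -> m <= b -> b <= b0 ->
  c0 <= c -> c <= n -> n <= d -> d <= d0 ->
  N a b c d <= N a m c n + N m b c n + N a m n d + N m b n d.
Hypothesis loc : forall p q, a0 <= p <= b0 -> c0 <= q <= d0 ->
  forall e, 0 < e -> exists2 del, 0 < del & forall a b c d,
  a0 <= a -> a <= p -> p <= b -> b <= b0 -> c0 <= c -> c <= q -> q <= d -> d <= d0 ->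
  b - a < del -> d - c < del -> N a b c d <= e * (b - a + (d - c)) ^+ 2.

Let N4 (x : R * R * (R * R)) := N x.1.1 x.1.2 x.2.1 x.2.2.

(** Selects a quarter that keeps at least one fourth of N; when three tests fail, subadditivity
    forces the last quarter. *)
Let step (x : R * R * (R * R)) : R * R * (R * R) :=
  let: (a, b, (c, d)) := x in
  let m := (a + b) / 2 in let n := (c + d) / 2 in
  if N a b c d / 4 <= N a m c n then (a, m, (c, n)) else
  if N a b c d / 4 <= N m b c n then (m, b, (c, n)) else
  if N a b c d / 4 <= N a m n d then (a, m, (n, d)) else (m, b, (n, d)).

Let good (x : R * R * (R * R)) := let: (a, b, (c, d)) := x in
  [/\ a0 <= a, a <= b, b <= b0 & [/\ c0 <= c, c <= d & d <= d0]].

Let stepP x : good x -> [/\ good (step x),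
  N4 x / 4 <= N4 (step x),
  (step x).1.2 - (step x).1.1 = (x.1.2 - x.1.1) / 2,
  (step x).2.2 - (step x).2.1 = (x.2.2 - x.2.1) / 2 &
  [/\ x.1.1 <= (step x).1.1, (step x).1.2 <= x.1.2,
      x.2.1 <= (step x).2.1 & (step x).2.2 <= x.2.2]].
Proof.
case: x => [[a b] [c d]] /= [h1 h2 h3 [h4 h5 h6]]; rewrite /N4/=.
have am : a <= (a + b) / 2 by lra.
have mb : (a + b) / 2 <= b by lra.
have cn : c <= (c + d) / 2 by lra.
have nd : (c + d) / 2 <= d by lra.
have := sub h1 am mb h3 h4 cn nd h6.
case: ifPn => [?|/negP]; last case: ifPn => [? ?|/negP]; last case: ifPn => [? ? ?|/negP];
  rewrite /good /=; move=> *; do ?split=> //; lra.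
Qed.

(** Starting from a positive value N_0, nested quarters keep N >= N_0 / 4^n while they shrink to a
    point, where the local bound is e (S / 2^n)^2 with S the sum of the two sides: the powers of 4
    cancel. *)
Lemma quartering_le0 : N a0 b0 c0 d0 <= 0.
Proof.
rewrite leNgt; apply/negP => N0.
pose x n := iter n step (a0, b0, (c0, d0)).
have xg n : good (x n).
  by elim: n => [|n IH]; [split=> //; split|rewrite /x iterS; have [] := stepP IH].
have xN n : N a0 b0 c0 d0 / 4 ^+ n <= N4 (x n).
  elim: n => [|n IH]; first by rewrite expr0 divr1.
  rewrite /x iterS; have [_ h _ _ _] := stepP (xg n).
  apply: le_trans h; rewrite exprSr invfM mulrA ler_wpM2r//.
have xab n : (x n).1.2 - (x n).1.1 = (b0 - a0) / 2 ^+ n.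
  elim: n => [|n IH]; first by rewrite expr0 divr1.
  rewrite /x iterS; have [_ _ -> _ _] := stepP (xg n).
  by rewrite IH exprSr invfM mulrA.
have xcd n : (x n).2.2 - (x n).2.1 = (d0 - c0) / 2 ^+ n.
  elim: n => [|n IH]; first by rewrite expr0 divr1.
  rewrite /x iterS; have [_ _ _ -> _] := stepP (xg n).
  by rewrite IH exprSr invfM mulrA.
have nested (l u : nat -> R) : (forall n, l n <= l n.+1) -> (forall n, u n.+1 <= u n) ->
    (forall n, l n <= u n) -> exists p, forall n, l n <= p <= u n.
  move=> lS uS lu.
  have lm m n : (m <= n)%N -> l m <= l n.
    by apply: (homo_leq (r := fun x y : R => x <= y)) => //; exact: le_trans.
  have um m n : (m <= n)%N -> u n <= u m.
    apply: (homo_leq (r := fun x y : R => y <= x)) => // y z t h1 h2.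
    exact: le_trans h2 h1.
  have lumn m n : l m <= u n.
    apply: le_trans (lm _ _ (leq_maxl m n)) _.
    by apply: le_trans (lu _) _; apply: um; exact: leq_maxr.
  exists (sup (range l)) => n; apply/andP; split.
    by apply: ub_le_sup; [exists (u 0%N) => _ [m _ <-]|exists n].
  by apply: ge_sup; [exists (l 0%N), 0%N|move=> _ [m _ <-]].
have [p hp] : exists p, forall n, (x n).1.1 <= p <= (x n).1.2.
  apply: nested => n.
  - by rewrite /x iterS; have [_ _ _ _ []] := stepP (xg n).
  - by rewrite /x iterS; have [_ _ _ _ []] := stepP (xg n).
  - by have := xg n; rewrite /good; case: (x n) => [[? ?] [? ?]] [].
have [q hq] : exists q, forall n, (x n).2.1 <= q <= (x n).2.2.
  apply: nested => n.
  - by rewrite /x iterS; have [_ _ _ _ []] := stepP (xg n).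
  - by rewrite /x iterS; have [_ _ _ _ []] := stepP (xg n).
  - by have := xg n; rewrite /good; case: (x n) => [[? ?] [? ?]] [_ _ _ []].
pose S := b0 - a0 + (d0 - c0).
have S0 : 0 <= S by rewrite /S; move: ab0 cd0; lra.
have S1 : 0 < S ^+ 2 + 1 by rewrite ltr_wpDl// sqr_ge0.
(* For this e the cancellation leaves N_0 <= e S^2 < N_0. *)
have e0 : 0 < N a0 b0 c0 d0 / (S ^+ 2 + 1) by rewrite divr_gt0.
have [del del0 hdel] := loc (hp 0%N) (hq 0%N) e0.
have h2 : 0 <= (2^-1 : R) < 1 by lra.
have [n /(_ n (leqnn n)) hn] := geo_small (S + 1) h2 del0.
have t0 : 0 < (2 ^+ n : R) by rewrite exprn_gt0.
have := xg n; have := hp n; have := hq n; have := xN n; have := xab n; have := xcd n.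
rewrite /good /N4; case: (x n) => [[a b] [c d]] /= ecd eab hN /andP[q1 q2] /andP[p1 p2].
move=> [g1 g2 g3 [g4 g5 g6]].
have hh : (S + 1) / 2 ^+ n < del by move: hn; rewrite exprVn.
have := hdel a b c d g1 p1 p2 g3 g4 q1 q2 g6.
rewrite eab ecd.
have dl X : X <= S -> X / 2 ^+ n < del.
  move=> XS; apply: le_lt_trans hh; rewrite ler_wpM2r// ?invr_ge0 ?(ltW t0)//; lra.
move=> /(_ _ _)/(le_trans hN).
have bS : b0 - a0 <= S by rewrite /S; move: cd0; lra.
have dS : d0 - c0 <= S by rewrite /S; move: ab0; lra.
move=> /(_ (dl _ bS) (dl _ dS)).
rewrite -mulrDl -/S expr_div_n -exprM mulnC exprM (_ : 2 ^+ 2 = 4 :> R); last by ring.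
rewrite mulrA ler_pM2r ?invr_gt0 ?exprn_gt0// mulrAC ler_pdivlMr//.
by nra.
Qed.

End Quartering.

(** * Integrals of complex functions of a real variable *)

Section ComplexIntegral.
Context {R : realType}.
Notation mu := (@lebesgue_measure R).
Implicit Types (a b : R) (f g : R -> R[i]).

Definition cint a b f : R[i] :=
  (\int[mu]_(x in `[a, b]) complex.Re (f x)) +i* (\int[mu]_(x in `[a, b]) complex.Im (f x)).

Definition ccontR f x := forall e : R, 0 < e -> exists2 d : R, 0 < d &
  forall y, `|y - x| < d -> normc (f y - f x) < e.

Definition ccont_on a b f := forall x, a <= x <= b -> ccontR f x.

Lemma ccontR_Re f x : ccontR f x -> {for x, continuous (fun y => complex.Re (f y))}.
Proof.
move=> h; apply/cvgrPdist_lt => e e0; have [d d0 hd] := h e e0.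
near=> y; rewrite -ReB; apply: le_lt_trans (nc_Re _) _.
rewrite nc_distC; apply: hd; rewrite distrC; near: y.
by apply/nbhs_ballP; exists d => //= y.
Unshelve. all: by end_near. Qed.

Lemma ccontR_Im f x : ccontR f x -> {for x, continuous (fun y => complex.Im (f y))}.
Proof.
move=> h; apply/cvgrPdist_lt => e e0; have [d d0 hd] := h e e0.
near=> y; rewrite -ImB; apply: le_lt_trans (nc_Im _) _.
rewrite nc_distC; apply: hd; rewrite distrC; near: y.
by apply/nbhs_ballP; exists d => //= y.
Unshelve. all: by end_near. Qed.

Lemma itv_integrable (f : R -> R) a b :
  (forall x, a <= x <= b -> {for x, continuous f}) ->
  mu.-integrable `[a, b] (EFin \o f).
Proof.
move=> h; apply: continuous_compact_integrable; first exact: segment_compact.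
apply: continuous_in_subspaceT => x; rewrite inE/= in_itv/=; exact: h.
Qed.

Lemma ccont_integrable_Re a b f : ccont_on a b f ->
  mu.-integrable `[a, b] (EFin \o (fun x => complex.Re (f x))).
Proof. by move=> h; apply: itv_integrable => x xab; apply: ccontR_Re; exact: h. Qed.

Lemma ccont_integrable_Im a b f : ccont_on a b f ->
  mu.-integrable `[a, b] (EFin \o (fun x => complex.Im (f x))).
Proof. by move=> h; apply: itv_integrable => x xab; apply: ccontR_Im; exact: h. Qed.

Lemma eq_cint a b f g : (forall x, a <= x <= b -> f x = g x) -> cint a b f = cint a b g.
Proof.
by move=> fg; rewrite /cint; congr (_ +i* _); apply: eq_Rintegral => x;
  rewrite inE/= in_itv/= => /fg ->.
Qed.

Lemma cintB a b f g : ccont_on a b f -> ccont_on a b g ->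
  cint a b (fun x => f x - g x) = cint a b f - cint a b g.
Proof.
move=> hf hg; rewrite /cint.
rewrite (_ : (fun x => complex.Re (f x - g x)) = (fun x => complex.Re (f x) - complex.Re (g x))); last first.
  by apply/funext => x; rewrite ReB.
rewrite (_ : (fun x => complex.Im (f x - g x)) = (fun x => complex.Im (f x) - complex.Im (g x))); last first.
  by apply/funext => x; rewrite ImB.
rewrite !RintegralB//; first exact: ccont_integrable_Im.
- exact: ccont_integrable_Im.
- exact: ccont_integrable_Re.
- exact: ccont_integrable_Re.
Qed.

Lemma cintD a b f g : ccont_on a b f -> ccont_on a b g ->
  cint a b (fun x => f x + g x) = cint a b f + cint a b g.
Proof.
move=> hf hg; rewrite /cint.
rewrite (_ : (fun x => complex.Re (f x + g x)) = (fun x => complex.Re (f x) + complex.Re (g x))); last first.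
  by apply/funext => x; case: (f x) (g x) => ? ? [? ?].
rewrite (_ : (fun x => complex.Im (f x + g x)) = (fun x => complex.Im (f x) + complex.Im (g x))); last first.
  by apply/funext => x; case: (f x) (g x) => ? ? [? ?].
rewrite !RintegralD//; first exact: ccont_integrable_Im.
- exact: ccont_integrable_Im.
- exact: ccont_integrable_Re.
- exact: ccont_integrable_Re.
Qed.

Lemma cintZ a b (c : R[i]) f : ccont_on a b f ->
  cint a b (fun x => c * f x) = c * cint a b f.
Proof.
case: c => c d hf; rewrite /cint.
have iR := ccont_integrable_Re hf; have iI := ccont_integrable_Im hf.
have h1 k : mu.-integrable `[a, b] (EFin \o (fun x => k * complex.Re (f x))).
  by have := integrableZl (mu := mu) _ k iR; apply.
have h2 k : mu.-integrable `[a, b] (EFin \o (fun x => k * complex.Im (f x))).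
  by have := integrableZl (mu := mu) _ k iI; apply.
rewrite (_ : (fun x => complex.Re ((c +i* d) * f x)) = (fun x => c * complex.Re (f x) - d * complex.Im (f x))); last first.
  by apply/funext => x; case: (f x).
rewrite (_ : (fun x => complex.Im ((c +i* d) * f x)) = (fun x => c * complex.Im (f x) + d * complex.Re (f x))); last first.
  by apply/funext => x; case: (f x).
by rewrite RintegralB// RintegralD// !RintegralZl.
Qed.

Lemma cint_cst a b (c : R[i]) : a <= b -> cint a b (fun=> c) = (b - a)%:C * c.
Proof.
move=> ab; rewrite /cint !Rintegral_cst//= lebesgue_measure_itv/=.
have -> : fine (if (a%:E < b%:E)%E then (b%:E - a%:E)%E else 0%E) = b - a.
  rewrite lte_fin; case: ltP => //= ba.
  by apply/esym/eqP; rewrite subr_eq0 eq_le ab ba.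
by case: c => c d; apply/eqP; rewrite eq_complex/=; apply/andP; split; apply/eqP; ring.
Qed.

Lemma cint_split a m b f : a <= m -> m <= b -> ccont_on a b f ->
  cint a b f = cint a m f + cint m b f.
Proof.
move=> am mb hf; rewrite /cint.
have iR := ccont_integrable_Re hf; have iI := ccont_integrable_Im hf.
have h (g : R -> R) : mu.-integrable `[a, b] (EFin \o g) ->
   \int[mu]_(x in `[a, b]) g x = \int[mu]_(x in `[a, m]) g x + \int[mu]_(x in `[m, b]) g x.
  move=> ig; rewrite -(Rintegral_itv_obnd_cbnd (r := m)); last first.
    by apply: integrableS ig => //; apply: subset_itvr; rewrite bnd_simp.
  by rewrite -(@Rintegral_itvB _ _ (BLeft a) (BRight b) m)// ?bnd_simp// addrC subrK.
by rewrite (h _ iR) (h _ iI).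
Qed.

(** Real and imaginary parts are bounded separately; the resulting factor 2 enters only estimates
    that tend to 0. *)
Lemma cint_bound a b f (M : R) : a <= b -> ccont_on a b f ->
  (forall x, a <= x <= b -> normc (f x) <= M) -> normc (cint a b f) <= 2 * M * (b - a).
Proof.
move=> ab hf hM.
have h (g : R -> R) : mu.-integrable `[a, b] (EFin \o g) ->
   (forall x, a <= x <= b -> `|g x| <= M) -> `|\int[mu]_(x in `[a, b]) g x| <= M * (b - a).
  move=> ig gM; apply: (le_trans (le_normr_Rintegral _ ig)) => //.
  have -> : M * (b - a) = \int[mu]_(x in `[a, b]) M.
    rewrite Rintegral_cst//= lebesgue_measure_itv/= lte_fin; case: ltP => //= ba.
    by congr (_ * _); apply/eqP; rewrite subr_eq0 eq_le ab ba.
  apply: le_Rintegral => //.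
  - by have := integrable_abse ig; apply.
  - by apply: itv_integrable => x _; exact: cvg_cst.
apply: le_trans (ncRI _) _; rewrite /cint/=.
rewrite (_ : 2 * M * (b - a) = M * (b - a) + M * (b - a)); last by ring.
apply: lerD.
  apply: h; first exact: ccont_integrable_Re.
  by move=> x /hM; exact: le_trans (nc_Re _).
apply: h; first exact: ccont_integrable_Im.
by move=> x /hM; exact: le_trans (nc_Im _).
Qed.

Lemma cint_conj a b f : ccont_on a b f -> cint a b (fun x => (f x)^*%C) = (cint a b f)^*%C.
Proof.
move=> hf; rewrite /cint/=.
rewrite (_ : (fun x => complex.Re (f x)^*%C) = (fun x => complex.Re (f x))); last first.
  by apply/funext => x; case: (f x).
rewrite (_ : (fun x => complex.Im (f x)^*%C) = (fun x => (-1) * complex.Im (f x))); last first.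
  by apply/funext => x; case: (f x) => ? ?; rewrite mulN1r.
by rewrite RintegralZl ?mulN1r//; exact: ccont_integrable_Im.
Qed.

Lemma ccontR_cst (c : R[i]) x : ccontR (fun=> c) x.
Proof. by move=> e e0; exists 1 => // y _; rewrite subrr normc0. Qed.

Lemma ccontRP f x : ccontR f x <-> {for x, continuous (f : R -> Cplx R)}.
Proof.
split=> [h|/cvgrPdist_lt h e e0].
  apply/cvgrPdist_lt => e /posC_real [e' /h [d d0 hd] ->].
  apply/nbhs_ballP; exists d => // y; rewrite /ball/= distrC => /hd.
  by rewrite nc_distC -ncE ltcR.
have := h e%:C; rewrite ltcR => /(_ e0)/nbhs_ballP [d d0 hd].
exists d => // y yx; have := hd y; rewrite /ball/= distrC => /(_ yx).
by rewrite -ncE ltcR nc_distC.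
Qed.

Lemma ccontRD f g x : ccontR f x -> ccontR g x -> ccontR (fun x => f x + g x) x.
Proof. by move=> /ccontRP hf /ccontRP hg; apply/ccontRP; exact: cvgD hf hg. Qed.

Lemma ccontRB f g x : ccontR f x -> ccontR g x -> ccontR (fun x => f x - g x) x.
Proof. by move=> /ccontRP hf /ccontRP hg; apply/ccontRP; exact: cvgB hf hg. Qed.

Lemma ccontRM f g x : ccontR f x -> ccontR g x -> ccontR (fun x => f x * g x) x.
Proof.
by move=> /ccontRP hf /ccontRP hg; apply/ccontRP; exact: (@cvgM _ R _ _ f g _ _ hf hg).
Qed.

Lemma ccontR_sum n (F : nat -> R -> R[i]) x : (forall k, ccontR (F k) x) ->
  ccontR (fun y => \sum_(0 <= k < n) F k y) x.
Proof.
move=> h; elim: n => [|n IH].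
  rewrite (_ : (fun _ => _) = fun=> 0); first exact: ccontR_cst.
  by apply/funext => y; rewrite big_nil.
rewrite (_ : (fun _ => _) = fun y => \sum_(0 <= k < n) F k y + F n y).
  exact: ccontRD.
by apply/funext => y; rewrite big_nat_recr.
Qed.

Lemma cint_sum a b n (F : nat -> R -> R[i]) : a <= b -> (forall k, ccont_on a b (F k)) ->
  cint a b (fun x => \sum_(0 <= k < n) F k x) = \sum_(0 <= k < n) cint a b (F k).
Proof.
move=> ab h; elim: n => [|n IH].
  rewrite big_nil; rewrite (eq_cint (g := fun=> 0)) => [|x _]; last by rewrite big_nil.
  by rewrite cint_cst// mulr0.
rewrite big_nat_recr//= -IH -cintD.
- by apply: eq_cint => x _; rewrite big_nat_recr.
- by move=> x xab; apply: ccontR_sum => k; exact: h.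
- exact: h.
Qed.

End ComplexIntegral.

(** * Goursat's theorem in logarithmic coordinates *)

Section Cauchy.
Context {R : realType}.
Implicit Types (s t r e : R) (z w c : R[i]) (F : R[i] -> R[i]).

Definition cis t : R[i] := cos t +i* sin t.
(** This is exp(s + i t). *)
Definition polarE s t : R[i] := (expR s)%:C * cis t.

Lemma nc_cis t : normc (cis t) = 1.
Proof. by rewrite /= cos2Dsin2 sqrtr1. Qed.

Lemma nc_rcis r t : 0 <= r -> normc (r%:C * cis t) = r.
Proof. by move=> r0; rewrite normcM nc_cis mulr1 ncR ger0_norm. Qed.

Lemma nc_polarE s t : normc (polarE s t) = expR s.
Proof. by rewrite nc_rcis// expR_ge0. Qed.

Lemma cisD t k : cis (t + k) = cis t * cis k.
Proof.
rewrite /cis sinD cosD; apply/eqP; rewrite eq_complex/=.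
by apply/andP; split; apply/eqP; ring.
Qed.

Lemma polarED s t s' t' : polarE (s + s') (t + t') = polarE s t * polarE s' t'.
Proof. by rewrite /polarE cisD expRD rmorphM/=; ring. Qed.

Lemma polarE_pi s : polarE s (- pi) = polarE s pi.
Proof. by rewrite /polarE /cis cosN sinN sinpi oppr0. Qed.

Lemma is_derive_littleo (f : R -> R) (x df : R) : is_derive x 1 f df ->
  forall e, 0 < e -> exists2 d : R, 0 < d & forall k, `|k| < d ->
    `|f (x + k) - f x - df * k| <= e * `|k|.
Proof.
move=> [/cvg_ex[l H] fdf] e e0.
have ldf : l = df by rewrite -fdf; apply/esym/cvg_lim.
move/cvgrPdist_le : H => /(_ e e0) /nbhs_ballP [d d0 hd].
exists d => // k kd; have [->|k0] := eqVneq k 0.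
  by rewrite addr0 !subrr mulr0 subrr normr0 mulr0.
have := hd k; rewrite /ball/= sub0r normrN => /(_ kd k0).
have nk : 0 < `|k| by rewrite normr_gt0.
rewrite -(ler_pM2r nk) -normrM ldf; apply: le_trans.
rewrite -normrN le_eqVlt; apply/orP; left; apply/eqP; congr `|_|.
rewrite (_ : k *: 1 + x = x + k) ?[_ *: 1]mulr1 1?addrC//.
by rewrite /GRing.scale/=; field.
Qed.

Lemma polarE_littleo e : 0 < e -> exists2 d : R, 0 < d & forall s t,
  `|s| < d -> `|t| < d ->
  normc (polarE s t - 1 - (s +i* t)) <= e * (`|s| + `|t|).
Proof.
move=> e0; pose e' := Num.min (e / 8) 1.
have e'0 : 0 < e' by rewrite lt_min divr_gt0//=.
have e'e : e' <= e / 8 by rewrite ge_min lexx.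
have e'1 : e' <= 1 by rewrite ge_min lexx orbT.
clearbody e'.
have [d1 d10 h1] := is_derive_littleo (is_derive_expR 0) e'0.
have [d2 d20 h2] := is_derive_littleo (is_derive_cos 0) e'0.
have [d3 d30 h3] := is_derive_littleo (is_derive_sin 0) e'0.
exists (Num.min (Num.min d1 (Num.min d2 d3)) e').
  by rewrite !lt_min d10 d20 d30.
move=> s t; rewrite !lt_min => /andP[/andP[/h1 s1 _] s2] /andP[/and3P[_ /h2 t1 /h3 t2] t3].
move: s1 t1 t2; rewrite !add0r expR0 sin0 cos0 oppr0 !mul0r !mul1r !subr0 !addr0 => s1 t1 t2.
have es : `|expR s - 1| <= 2 * `|s|.
  have -> : expR s - 1 = (expR s - 1 - s) + s by ring.
  apply: le_trans (ler_normD _ _) _; have := normr_ge0 s.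
  by move: s1; nra.
have es2 : expR s <= 3.
  by have := ler_norm (expR s - 1); move: es s2 e'1; lra.
have -> : polarE s t - 1 - (s +i* t) =
    (expR s - 1 - s + expR s * (cos t - 1)) +i* ((expR s - 1) * t + expR s * (sin t - t)).
  by rewrite /polarE /cis; apply/eqP; rewrite eq_complex/=; apply/andP; split; apply/eqP; ring.
apply: le_trans (ncRI _) _ => /=.
have E0 := expR_ge0 s.
have a1 : `|expR s - 1 - s + expR s * (cos t - 1)| <= e' * `|s| + 3 * (e' * `|t|).
  apply: le_trans (ler_normD _ _) _; rewrite lerD// normrM ger0_norm//.
  by apply: ler_pM.
have a2 : `|(expR s - 1) * t + expR s * (sin t - t)| <= 2 * `|s| * `|t| + 3 * (e' * `|t|).
  apply: le_trans (ler_normD _ _) _; apply: lerD; first by rewrite normrM ler_wpM2r.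
  by rewrite normrM ger0_norm//; apply: ler_pM.
apply: le_trans (lerD a1 a2) _.
have := normr_ge0 s; have := normr_ge0 t => t0 s0.
have : 2 * `|s| * `|t| <= 2 * `|s| * e' by rewrite ler_wpM2l ?mulr_ge0 ?(ltW t3).
by nra.
Qed.

(* Complex differentiability of f at s + i t, read in the real coordinates. *)
Definition pdiff (f : R -> R -> R[i]) s t (b : R[i]) := forall e, 0 < e ->
  exists2 d : R, 0 < d & forall h k : R, `|h| < d -> `|k| < d ->
  normc (f (s + h) (t + k) - f s t - b * (h +i* k)) <= e * (`|h| + `|k|).

Lemma nc_le_sum s t : normc (s +i* t) <= `|s| + `|t|.
Proof. exact: ncRI. Qed.

(** The exponential is multiplicative, so the increment of the argument is w = z (exp(h + i k) - 1)
    and the chain rule needs its differentiability at 0 only. *)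
Lemma pdiff_polarE F s t c : cdiff F (polarE s t) c ->
  pdiff (fun s t => F (polarE s t)) s t (c * polarE s t).
Proof.
move=> hF e e0; set z := polarE s t.
pose A := normc z; have A0 : 0 < A by rewrite /A nc_polarE expR_gt0.
pose B := normc c; have B0 : 0 <= B by exact: normc_ge0.
have e1 : 0 < e / (4 * A) by rewrite divr_gt0// mulr_gt0.
have e2 : 0 < Num.min 1 (e / (2 * (B + 1) * A)).
  by rewrite lt_min ltr01 divr_gt0// !mulr_gt0// ltr_wpDl.
have [d1 d10 h1] := hF _ e1.
have [d2 d20 h2] := polarE_littleo e2.
exists (Num.min d2 (d1 / (4 * A))); first by rewrite lt_min d20 divr_gt0// mulr_gt0.
move=> h k; rewrite !lt_min => /andP[hd2 hd1] /andP[kd2 kd1].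
rewrite polarED -/z.
set w := z * (polarE h k - 1).
have -> : z * polarE h k = z + w by rewrite /w; ring.
have := h2 h k hd2 kd2; set L := `|h| + `|k|; set em := Num.min _ _ => hE.
have L0 : 0 <= L by rewrite addr_ge0.
have em1 : em <= 1 by rewrite /em ge_min lexx.
have em2 : em <= e / (2 * (B + 1) * A) by rewrite /em ge_min lexx orbT.
have wL : normc w <= 2 * A * L.
  rewrite /w normcM -/A mulrAC [2 * _ * _]mulrC ler_wpM2l ?(ltW A0)//.
  apply: le_trans (nc_triB _ (h +i* k)) _.
  by have := nc_le_sum h k; rewrite -/L; move: hE; nra.
have wd : normc w < d1.
  apply: le_lt_trans wL _; move: hd1 kd1; rewrite !ltr_pdivlMr ?mulr_gt0//.
  by rewrite /L; nra.
have -> : F (z + w) - F z - c * z * (h +i* k) =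
    (F (z + w) - F z - c * w) + c * z * (polarE h k - 1 - (h +i* k)).
  by rewrite /w; ring.
apply: le_trans (ncD _ _) _.
have a1 : normc (F (z + w) - F z - c * w) <= e / 2 * L.
  apply: le_trans (h1 w wd) _.
  apply: le_trans (ler_wpM2l (ltW e1) wL) _.
  by rewrite le_eqVlt; apply/orP; left; apply/eqP; field; rewrite gt_eqF.
have a2 : normc (c * z * (polarE h k - 1 - (h +i* k))) <= e / 2 * L.
  rewrite normcM [normc (c * z)]normcM -/A -/B; apply: le_trans (ler_wpM2l _ hE) _.
    by rewrite mulr_ge0 ?(ltW A0).
  rewrite mulrA ler_wpM2r//.
  apply: le_trans (ler_wpM2l _ em2) _; first by rewrite mulr_ge0 ?(ltW A0).
  rewrite mulrA ler_pdivrMr; last by rewrite !mulr_gt0// ltr_wpDl.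
  have := mulr_gt0 A0 e0; nra.
by apply: le_trans (lerD a1 a2) _; lra.
Qed.

Lemma pdiff_cont1 (f : R -> R -> R[i]) s t b : pdiff f s t b -> ccontR (fun s => f s t) s.
Proof.
move=> h e e0; have [d d0 hd] := h 1 ltr01.
have B0 : 0 < normc b + 1 by rewrite ltr_wpDl// normc_ge0.
exists (Num.min d (e / (normc b + 1))); first by rewrite lt_min d0 divr_gt0.
move=> y; rewrite lt_min ltr_pdivlMr// => /andP[yd ye].
have := hd (y - s) 0 yd; rewrite normr0 => /(_ d0).
rewrite !addr0 subrKC mul1r => hh.
apply: le_lt_trans (nc_triB _ (b * ((y - s) +i* 0))) _.
rewrite normcM (ncR (y - s)); move: hh ye; lra.
Qed.

Lemma pdiff_cont2 (f : R -> R -> R[i]) s t b : pdiff f s t b -> ccontR (f s) t.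
Proof.
move=> h e e0; have [d d0 hd] := h 1 ltr01.
have B0 : 0 < normc b + 1 by rewrite ltr_wpDl// normc_ge0.
exists (Num.min d (e / (normc b + 1))); first by rewrite lt_min d0 divr_gt0.
move=> y; rewrite lt_min ltr_pdivlMr// => /andP[yd ye].
have := hd 0 (y - t); rewrite normr0 => /(_ d0 yd).
rewrite addr0 add0r subrKC mul1r => hh.
apply: le_lt_trans (nc_triB _ (b * (0 +i* (y - t)))) _.
have n0 : normc (0 +i* (y - t)) = `|y - t| by rewrite /= expr0n/= add0r sqrtr_sqr.
rewrite normcM n0; move: hh ye; lra.
Qed.

(** The integral of f around the rectangle, counterclockwise in s + i t, with opposite sides paired;
    the factor i is that of i dt on the vertical sides. *)
Definition bdint (f : R -> R -> R[i]) (a b c d : R) : R[i] :=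
  cint a b (fun s => f s c - f s d) + 'i * cint c d (fun t => f b t - f a t).

(* Goursat's theorem on a rectangle in the coordinate log z: the exponential maps
   it to an annulus, so that no other contours are needed. *)
Lemma goursat (f : R -> R -> R[i]) (a0 b0 c0 d0 : R) : a0 <= b0 -> c0 <= d0 ->
  (forall s t, a0 <= s <= b0 -> c0 <= t <= d0 -> exists b, pdiff f s t b) ->
  bdint f a0 b0 c0 d0 = 0.
Proof.
move=> ab cd hf.
have c1 t s : a0 <= s <= b0 -> c0 <= t <= d0 -> ccontR (fun s => f s t) s.
  by move=> hs ht; have [b] := hf s t hs ht; exact: pdiff_cont1.
have c2 s t : a0 <= s <= b0 -> c0 <= t <= d0 -> ccontR (f s) t.
  by move=> hs ht; have [b] := hf s t hs ht; exact: pdiff_cont2.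
apply: nc_small_eq0 => e e0; apply: (le_trans _ (ltW e0)).
have inl (x y a b : R) : x <= a -> a <= b -> b <= y -> forall t, a <= t <= b -> x <= t <= y.
  by move=> *; lra.
apply: (@quartering_le0 _ (fun a b c d : R => normc (bdint f a b c d))) => //.
- move=> a m b c n d a0a am mb bb0 c0c cn nd dd0.
  have J1 x y : c0 <= x -> x <= y -> y <= d0 ->
      bdint f a b x y = bdint f a m x y + bdint f m b x y.
    move=> h1 h2 h3; rewrite /bdint (cint_split am mb); last first.
      move=> s hs; apply: ccontRB; apply: c1; clear -h1 h2 h3 hs a0a am mb bb0; lra.
    rewrite (eq_cint (f := fun t => f b t - f a t)
      (g := fun t => (f b t - f m t) + (f m t - f a t))) => [|t _]; last by ring.
    rewrite (@cintD _ x y); first by ring.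
      by move=> t ht; apply: ccontRB; apply: c2; clear -h1 h2 h3 ht a0a am mb bb0; lra.
    by move=> t ht; apply: ccontRB; apply: c2; clear -h1 h2 h3 ht a0a am mb bb0; lra.
  have J2 x y : a0 <= x -> x <= y -> y <= b0 ->
      bdint f x y c d = bdint f x y c n + bdint f x y n d.
    move=> h1 h2 h3; rewrite /bdint (@cint_split _ c n d)//; last first.
      move=> t ht; apply: ccontRB; apply: c2; clear -h1 h2 h3 ht c0c cn nd dd0; lra.
    rewrite (eq_cint (f := fun s => f s c - f s d)
      (g := fun s => (f s c - f s n) + (f s n - f s d))) => [|t _]; last by ring.
    rewrite (@cintD _ x y); first by ring.
      by move=> s hs; apply: ccontRB; apply: c1; clear -h1 h2 h3 hs c0c cn nd dd0; lra.
    by move=> s hs; apply: ccontRB; apply: c1; clear -h1 h2 h3 hs c0c cn nd dd0; lra.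
  rewrite J1; [|lra..]. rewrite J2; [|lra..]. rewrite (J2 m b); [|lra..].
  apply: le_trans (ncD _ _) _.
  apply: le_trans (lerD (ncD _ _) (ncD _ _)) _.
  by clear; lra.
move=> p q hp hq eps eps0; have [b hb] := hf p q hp hq.
(* The denominator 4 compensates the factor 2 of [cint_bound] and the factor 2 from the difference
   of opposite sides. *)
have [del del0 hdel] := hb _ (divr_gt0 eps0 (@ltr0Sn R 3)).
exists del => // a b' c d a0a ap pb bb0 c0c cq qd dd0 bad dcd.
set L := b' - a + (d - c).
(* Horizontal and vertical contributions of the affine part are b (b' - a) i (c - d) and its
   negative, so the boundary integral only sees psi. *)
pose psi s t := f s t - f p q - b * ((s - p) +i* (t - q)).
have hpsi s t : a <= s <= b' -> c <= t <= d -> normc (psi s t) <= eps / 4 * L.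
  move=> /andP[s1 s2] /andP[t1 t2].
  have sp : `|s - p| <= b' - a by rewrite ler_norml; lra.
  have tq : `|t - q| <= d - c by rewrite ler_norml; lra.
  have := hdel (s - p) (t - q) (le_lt_trans sp bad) (le_lt_trans tq dcd).
  rewrite !subrKC; move/le_trans; apply.
  rewrite ler_wpM2l ?divr_ge0 ?(ltW eps0)// /L lerD//.
have e1 s : f s c - f s d = (psi s c - psi s d) + b * (0 +i* (c - d)).
  rewrite /psi (_ : (0 +i* (c - d)) = ((s - p) +i* (c - q)) - ((s - p) +i* (d - q))); first by ring.
  by apply/eqP; rewrite eq_complex/=; apply/andP; split; apply/eqP; ring.
have e2 t : f b' t - f a t = (psi b' t - psi a t) + b * (b' - a)%:C.
  rewrite /psi (_ : (b' - a)%:C = ((b' - p) +i* (t - q)) - ((a - p) +i* (t - q))); first by ring.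
  by apply/eqP; rewrite eq_complex/=; apply/andP; split; apply/eqP; ring.
have k1 : ccont_on a b' (fun s => psi s c - psi s d).
  move=> s hs; rewrite (_ : (fun s => _) = fun s => (f s c - f s d) - b * (0 +i* (c - d))).
    by apply: ccontRB; [apply: ccontRB; apply: c1; clear -hs a0a ap pb bb0 c0c cq qd dd0; lra|exact: ccontR_cst].
  by apply/funext => x; rewrite e1 addrK.
have k2 : ccont_on c d (fun t => psi b' t - psi a t).
  move=> t ht; rewrite (_ : (fun t => _) = fun t => (f b' t - f a t) - b * (b' - a)%:C).
    by apply: ccontRB; [apply: ccontRB; apply: c2; clear -ht a0a ap pb bb0 c0c cq qd dd0; lra|exact: ccontR_cst].
  by apply/funext => x; rewrite e2 addrK.
have ab' : a <= b' by lra.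
have cd' : c <= d by lra.
have -> : bdint f a b' c d = cint a b' (fun s => psi s c - psi s d) +
    'i * cint c d (fun t => psi b' t - psi a t).
  rewrite /bdint (eq_cint (g := fun s => (psi s c - psi s d) + b * (0 +i* (c - d)))) => [|s _]; last exact: e1.
  rewrite cintD//; last by move=> s _; exact: ccontR_cst.
  rewrite (eq_cint (f := fun t => f b' t - f a t) (g := fun t => (psi b' t - psi a t) + b * (b' - a)%:C)) => [|t _]; last exact: e2.
  rewrite (@cintD _ c d)//; last by move=> t _; exact: ccontR_cst.
  rewrite !cint_cst//.
  suff -> : (0 +i* (c - d)) = - ('i * (d - c)%:C) by ring.
  by apply/eqP; rewrite eq_complex/=; apply/andP; split; apply/eqP; ring.
apply: le_trans (ncD _ _) _; rewrite normcM.
have -> : normc 'i = 1 :> R by rewrite /= expr0n/= add0r expr1n sqrtr1.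
rewrite mul1r.
have b1 := cint_bound (M := 2 * (eps / 4 * L)) ab' k1.
have b2 := cint_bound (M := 2 * (eps / 4 * L)) cd' k2.
have {}b1 : normc (cint a b' (fun s => psi s c - psi s d)) <= 2 * (2 * (eps / 4 * L)) * (b' - a).
  apply: b1 => s hs; apply: le_trans (ncB _ _) _.
  by rewrite mulr_natl mulr2n lerD// hpsi// cd' lexx.
have {}b2 : normc (cint c d (fun t => psi b' t - psi a t)) <= 2 * (2 * (eps / 4 * L)) * (d - c).
  apply: b2 => t ht; apply: le_trans (ncB _ _) _.
  by rewrite mulr_natl mulr2n lerD// hpsi// ab' lexx.
apply: le_trans (lerD b1 b2) _.
by rewrite -/L le_eqVlt; apply/orP; left; apply/eqP; rewrite /L; field.
Qed.

End Cauchy.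

Arguments normc : simpl never.
Arguments cint : simpl never.

(** * Circle means of holomorphic functions *)

Section MeanValue.
Context {R : realType}.
Implicit Types (s t r e : R) (z w : R[i]) (F : R[i] -> R[i]).

Definition ccont F z := forall e : R, 0 < e -> exists2 d : R, 0 < d &
  forall w, normc (w - z) < d -> normc (F w - F z) < e.

Lemma cdiff_ccont F z c : cdiff F z c -> ccont F z.
Proof.
move=> h e e0; have [d d0 hd] := h 1 ltr01.
have B0 : 0 < normc c + 1 by rewrite ltr_wpDl// normc_ge0.
exists (Num.min d (e / (normc c + 1))); first by rewrite lt_min d0 divr_gt0.
move=> w; rewrite lt_min ltr_pdivlMr// => /andP[wd we].
have := hd (w - z) wd; rewrite subrKC mul1r => hh.
apply: le_lt_trans (nc_triB _ (c * (w - z))) _.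
by rewrite normcM; move: hh we; lra.
Qed.

(** Not normalized: a constant has mean 2 pi times its value. *)
Definition cmean F r : R[i] := cint (- pi) pi (fun t => F (r%:C * cis t)).

Lemma pi_itv : - pi <= (pi : R).
Proof. by have := @pi_gt0 R; lra. Qed.

Lemma cis_cont t : ccontR (@cis R) t.
Proof.
move=> e e0; have e20 : 0 < e / 2 by rewrite divr_gt0.
have /cvgrPdist_lt /(_ _ e20) /nbhs_ballP [d1 /= d10 h1] := @continuous_cos R t.
have /cvgrPdist_lt /(_ _ e20) /nbhs_ballP [d2 /= d20 h2] := @continuous_sin R t.
exists (Num.min d1 d2); first by rewrite lt_min d10.
move=> y; rewrite lt_min distrC => /andP[y1 y2].
apply: (le_lt_trans (ncRI (cis y - cis t))); rewrite /=.
have := h1 y y1; have := h2 y y2; rewrite distrC [`|cos _ - _|]distrC; lra.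
Qed.

Lemma circle_cont r t : ccontR (fun t => r%:C * cis t) t.
Proof. by apply: ccontRM; [exact: ccontR_cst|exact: cis_cont]. Qed.

Lemma ccontR_comp F (g : R -> R[i]) t : ccontR g t -> ccont F (g t) ->
  ccontR (fun t => F (g t)) t.
Proof.
move=> hg hF e e0; have [d d0 hd] := hF e e0; have [d' d'0 hd'] := hg d d0.
by exists d' => // y /hd'; exact: hd.
Qed.

Lemma ccont_circle F r t : ccont F (r%:C * cis t) -> ccontR (fun t => F (r%:C * cis t)) t.
Proof. by move=> h; apply: ccontR_comp h; exact: circle_cont. Qed.

(** In the coordinate log z the annulus is a rectangle; periodicity in the angle cancels its sides t
    = - pi and t = pi, and Goursat's theorem equates the other two. *)
Lemma cmean_annulus F (r0 r1 : R) : 0 < r0 -> r0 <= r1 ->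
  (forall z, r0 <= normc z <= r1 -> exists c, cdiff F z c) -> cmean F r0 = cmean F r1.
Proof.
move=> r00 r01 hF.
have r10 : 0 < r1 by apply: lt_le_trans r01.
have l01 : ln r0 <= ln r1 by rewrite ler_ln.
have hp s t : ln r0 <= s <= ln r1 -> - pi <= t <= pi ->
    exists b, pdiff (fun s t => F (polarE s t)) s t b.
  move=> /andP[s0 s1] _; have [|c hc] := hF (polarE s t).
    rewrite nc_polarE; apply/andP; split.
      by rewrite -(lnK r00) ler_expR.
    by rewrite -(lnK r10) ler_expR.
  by exists (c * polarE s t); exact: pdiff_polarE.
have := goursat l01 pi_itv hp; rewrite /bdint.
have -> : cint (ln r0) (ln r1) (fun s => F (polarE s (- pi)) - F (polarE s pi)) = 0.
  rewrite (@eq_cint _ _ _ _ (fun=> 0)) ?cint_cst ?mulr0// => s _.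
  by rewrite polarE_pi subrr.
rewrite add0r => /eqP.
have i0 : 'i != 0 :> R[i] by rewrite eq_complex/= oner_eq0 andbF.
rewrite mulf_eq0 (negbTE i0)/= cintB.
- rewrite subr_eq0 /cmean => /eqP; rewrite /polarE !lnK//.
- by move=> t ht; have [||b /pdiff_cont2] := hp (ln r1) t; rewrite ?l01 ?lexx.
- by move=> t ht; have [||b /pdiff_cont2] := hp (ln r0) t; rewrite ?l01 ?lexx.
Qed.

(** Compactness of [- pi, pi] makes continuity uniform in the angle. The case r0 = 0 is included
    because logarithmic coordinates never reach the origin. *)
Lemma cmean_cont F r0 : 0 <= r0 < 1 -> (forall z, normc z < 1 -> ccont F z) ->
  forall e, 0 < e -> exists2 d : R, 0 < d & forall r, 0 <= r -> `|r - r0| < d ->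
  normc (cmean F r - cmean F r0) <= e.
Proof.
move=> /andP[r00 r01] hF e e0.
pose e1 := e / (4 * pi).
have p0 := @pi_gt0 R.
have e10 : 0 < e1 by rewrite divr_gt0// mulr_gt0.
have /compact_near_coveringP/(_ R (nbhs r0)
  (fun r t => normc (F (r%:C * cis t) - F (r0%:C * cis t)) < e1) _) :=
  @segment_compact R (- pi) pi.
have H t : `[(- pi)%R, pi]%classic t -> \forall t' \near t & r \near nbhs r0,
    normc (F (r%:C * cis t') - F (r0%:C * cis t')) < e1.
  move=> _; have nz : normc (r0%:C * cis t) < 1 by rewrite nc_rcis.
  have [d d0 hd] := hF _ nz (e1 / 2) (divr_gt0 e10 (@ltr0Sn R 1)).
  have [d' d'0 hd'] := @cis_cont t (d / 2) (divr_gt0 d0 (@ltr0Sn R 1)).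
  have hw r t' : `|r - r0| < d / 2 -> `|t' - t| < d' ->
      normc (F (r%:C * cis t') - F (r0%:C * cis t)) < e1 / 2.
    move=> rd td; apply: hd.
    have -> : r%:C * cis t' - r0%:C * cis t = (r - r0)%:C * cis t' + r0%:C * (cis t' - cis t).
      by rewrite rmorphB/=; ring.
    apply: le_lt_trans (ncD _ _) _; rewrite !normcM nc_cis mulr1 !ncR (ger0_norm r00).
    have := hd' t' td; have := normc_ge0 (cis t' - cis t); nra.
  exists ([set t' | `|t' - t| < d'], [set r | `|r - r0| < d / 2]).
    split; apply/nbhs_ballP; [exists d' => //|exists (d / 2); first exact: divr_gt0].
      by move=> y; rewrite /ball/= distrC.
    by move=> y; rewrite /ball/= distrC.
  move=> [t' r] [/= h1 h2].
  have a1 := hw r t' h2 h1.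
  have a2 : normc (F (r0%:C * cis t') - F (r0%:C * cis t)) < e1 / 2.
    by apply: hw; rewrite ?subrr ?normr0 ?divr_gt0.
  have -> : F (r%:C * cis t') - F (r0%:C * cis t') =
    (F (r%:C * cis t') - F (r0%:C * cis t)) - (F (r0%:C * cis t') - F (r0%:C * cis t)) by ring.
  apply: le_lt_trans (ncB _ _) _.
  by rewrite (splitr e1) ltrD.
move=> /(_ H) /nbhs_ballP [d0 /= d00 hd0].
exists (Num.min d0 (1 - r0)); first by rewrite lt_min d00 subr_gt0.
move=> r r0' ; rewrite lt_min => /andP[rd rd1].
have r1 : r < 1 by have := ler_norm (r - r0); lra.
have h := hd0 r; rewrite /ball/= distrC in h; have {}h := h rd.
have kk (x : R) : 0 <= x -> x < 1 -> ccont_on (- pi) pi (fun t => F (x%:C * cis t)).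
  by move=> x0 x1 t _; apply: ccont_circle; apply: hF; rewrite nc_rcis.
rewrite /cmean -(cintB (kk r r0' r1) (kk r0 r00 r01)).
apply: le_trans (cint_bound (M := e1) pi_itv _ _) _.
- by move=> t ht; apply: ccontRB; apply: kk.
- by move=> t ht; apply/ltW; apply: h; rewrite /= in_itv.
rewrite /e1; move: (pi : R) p0 => p p0.
by rewrite le_eqVlt; apply/orP; left; apply/eqP; field; rewrite gt_eqF.
Qed.

Lemma cmean0 F : cmean F 0 = (2 * pi)%:C * F 0.
Proof.
rewrite /cmean (@eq_cint _ _ _ _ (fun=> F 0)) => [|t _]; last by rewrite mul0r.
rewrite cint_cst ?pi_itv//; congr (_%:C * _); ring.
Qed.

(** An exceptional circle is allowed because a difference quotient has a removable singularity on
    one. Means are constant on both sides of it, and continuity in the radius joins these pieces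
    with each other and with the value at 0. *)
Lemma cmean_value F rho : (forall z, normc z < 1 -> ccont F z) -> 0 <= rho ->
  (forall z, normc z < 1 -> normc z != rho -> z != 0 -> exists c, cdiff F z c) ->
  forall r, rho < r < 1 -> cmean F r = (2 * pi)%:C * F 0.
Proof.
move=> hF rho0 hD r /andP[rr r1]; rewrite -cmean0.
have cst (x y : R) : 0 < x -> x <= y -> y < 1 -> (y < rho) || (rho < x) -> cmean F x = cmean F y.
  move=> x0 xy y1 h; apply: cmean_annulus => // z /andP[z1 z2].
  apply: hD.
  - exact: le_lt_trans y1.
  - apply/eqP => zr; move: z1 z2; rewrite zr => z1 z2; case/orP: h => h; lra.
  - by rewrite -nc_gt0; apply: lt_le_trans z1.
have r0 : 0 < r by apply: le_lt_trans rr.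
have hr : cmean F r = cmean F rho.
  apply/eqP; rewrite -subr_eq0; apply/eqP/nc_small_eq0 => e e0.
  have rhoI : 0 <= rho < 1 by rewrite rho0 (lt_trans rr).
  have [d d0 hd] := cmean_cont rhoI hF e0.
  pose x := Num.min r (rho + d / 2).
  have rx : rho < x by rewrite lt_min rr ltrDl divr_gt0.
  have xr : x <= r by rewrite ge_min lexx.
  have xd : x <= rho + d / 2 by rewrite ge_min lexx orbT.
  clearbody x.
  rewrite -(@cst x r)//; last by rewrite rx orbT.
    apply: hd; first by rewrite ltW// (le_lt_trans rho0).
    by rewrite ger0_norm ?subr_ge0 ?(ltW rx)//; lra.
  exact: le_lt_trans rx.
rewrite hr; move: rho0; rewrite le_eqVlt => /predU1P[<-//|rho0].
have rhoI : 0 <= rho < 1 by rewrite ltW//= (lt_trans rr).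
have I0 : 0 <= (0 : R) < 1 by rewrite lexx ltr01.
have h0 x : 0 < x -> x < rho -> cmean F x = cmean F 0.
  move=> x0 xrho; apply/eqP; rewrite -subr_eq0; apply/eqP/nc_small_eq0 => e e0.
  have [d d0 hd] := cmean_cont I0 hF e0.
  pose y := Num.min x (d / 2).
  have y0 : 0 < y by rewrite lt_min x0 divr_gt0.
  have yx : y <= x by rewrite ge_min lexx.
  have yd : y <= d / 2 by rewrite ge_min lexx orbT.
  clearbody y.
  rewrite -(@cst y x)//; last by rewrite xrho.
    apply: hd; first exact: ltW.
    by rewrite subr0 gtr0_norm//; lra.
  by case/andP: rhoI => _; exact: lt_trans.
apply/eqP; rewrite -subr_eq0; apply/eqP/nc_small_eq0 => e e0.
have [d d0 hd] := cmean_cont rhoI hF e0.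
pose x := Num.max (rho / 2) (rho - d / 2).
have x0 : 0 < x by rewrite lt_max divr_gt0.
have xr : x < rho by rewrite gt_max; apply/andP; split; lra.
have xd : rho - d / 2 <= x by rewrite le_max lexx orbT.
clearbody x.
rewrite -(h0 x)// nc_distC; apply: hd; first exact: ltW.
by rewrite distrC gtr0_norm ?subr_gt0//; lra.
Qed.

End MeanValue.

(** * Taylor expansion of holomorphic functions on the disc *)

Section Taylor.
Context {R : realType}.
Implicit Types (s t r e : R) (z w : R[i]) (F h : R[i] -> R[i]).

Lemma derivable_expr k z : derivable (fun z : Cplx R => z ^+ k : Cplx R) z 1.
Proof.
elim: k => [|k IH]; first exact: (derivable_cst (1 : Cplx R)).
under eq_fun do rewrite exprS.
exact: derivableM (@derivable_id _ (Cplx R) z 1) IH.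
Qed.

Lemma cdiff_expr k z : exists c, cdiff (fun z => z ^+ k) z c.
Proof. exact/derivable_cdiff/derivable_expr. Qed.

Lemma cdiff_exprV k z : z != 0 -> exists c, cdiff (fun z => z ^- k) z c.
Proof.
move=> z0; apply/derivable_cdiff/(@derivableV _ (Cplx R) (fun z => z ^+ k)).
  by rewrite expf_neq0.
exact: derivable_expr.
Qed.

Lemma cdiff_near F G z c (d : R) : 0 < d -> (forall w, normc w < d -> F (z + w) = G (z + w)) ->
  cdiff F z c -> cdiff G z c.
Proof.
move=> d0 FG hF e e0; have [d1 d10 h1] := hF e e0.
have Fz : F z = G z by have := FG 0; rewrite normc0 addr0 => ->.
exists (Num.min d d1); first by rewrite lt_min d0.
by move=> w; rewrite lt_min => /andP[/FG <- /h1]; rewrite Fz.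
Qed.

Lemma circle_bounded F r : 0 <= r -> (forall z, normc z = r -> ccont F z) ->
  exists2 M : R, 0 <= M & forall t, - pi <= t <= pi -> normc (F (r%:C * cis t)) <= M.
Proof.
move=> r0 hF.
have c1 : {within `[- pi, pi], continuous (fun t => normc (F (r%:C * cis t)))}.
  apply: continuous_in_subspaceT => t _; apply/cvgrPdist_lt => e e0.
  have nz : normc (r%:C * cis t) = r by exact: nc_rcis.
  have [d d0 hd] := ccont_circle (hF _ nz) e0.
  apply/nbhs_ballP; exists d => // y; rewrite /ball/= distrC => yt.
  rewrite distrC; apply: le_lt_trans (hd y yt).
  have := nc_triB (F (r%:C * cis y)) (F (r%:C * cis t)).
  have := nc_triB (F (r%:C * cis t)) (F (r%:C * cis y)).
  rewrite [normc (F (r%:C * cis t) - _)]nc_distC => h1 h2.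
  by rewrite ler_norml; apply/andP; split; lra.
have [c _ hc] := EVT_max (@pi_itv R) c1.
exists (normc (F (r%:C * cis c))); first exact: normc_ge0.
by move=> t ht; apply: hc; rewrite in_itv.
Qed.

Lemma cmean_expr k r : (0 < k)%N -> 0 < r < 1 -> cmean (fun z => z ^+ k) r = 0.
Proof.
move=> k0 r01; rewrite (@cmean_value _ (fun z => z ^+ k) 0)//.
- by rewrite expr0n eqn0Ngt k0/= mulr0.
- by move=> z _; have [c] := cdiff_expr k z; exact: cdiff_ccont.
- by move=> z _ _ _; exact: cdiff_expr.
Qed.

Lemma conj_inv_circle r t : 0 < r -> (r%:C * cis t)^-1 = (r ^- 2)%:C * (r%:C * cis t)^*%C.
Proof.
move=> r0; have n0 : r%:C * cis t != 0.
  by rewrite -nc_gt0 nc_rcis// ltW.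
apply: (mulfI n0); rewrite mulfV//.
have := sin2cos2 t; have := cos2Dsin2 t => h _.
rewrite /cis; apply/esym/eqP; rewrite eq_complex/=; apply/andP; split; apply/eqP.
  transitivity (cos t ^+ 2 + sin t ^+ 2); last by [].
  by field; rewrite gt_eqF.
by field; rewrite gt_eqF.
Qed.

(** On the circle z^-1 is r^-2 times the conjugate of z, which reduces the claim to positive
    powers. *)
Lemma cmean_exprV k r : (0 < k)%N -> 0 < r < 1 -> cmean (fun z => z ^- k) r = 0.
Proof.
move=> k0 r01; have /andP[r0 _] := r01.
have hc : ccont_on (- pi) pi (fun t => (r%:C * cis t) ^+ k).
  move=> t _; apply: (@ccont_circle _ (fun z => z ^+ k)).
  by have [c] := cdiff_expr k (r%:C * cis t); exact: cdiff_ccont.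
rewrite /cmean (@eq_cint _ _ _ _ (fun t => (r ^- 2)%:C ^+ k * ((r%:C * cis t) ^+ k)^*%C)).
  rewrite cintZ; last first.
    move=> t ht e e0; have [d d0 hd] := hc t ht e e0.
    by exists d => // y /hd; rewrite -(nc_conj (_ - _)) rmorphB.
  rewrite cint_conj//.
  have := cmean_expr k0 r01; rewrite /cmean => ->.
  by rewrite conjc0 mulr0.
by move=> t _; rewrite -exprVn (conj_inv_circle _ r0) exprMn rmorphXn.
Qed.

(** Cauchy's integral of h(z) z^(-k-1) dz / (2 pi i) over the circle of radius r, parametrized by
    the angle. *)
Definition laurent h r (k : nat) : R[i] :=
  ((2 * pi)^-1)%:C * cmean (fun z => h z * z ^- k) r.

(* The circle means of F vanish because F 0 = 0; this is Cauchy's formula. *)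
Lemma ccont_quot h z0 c0 : (forall z, normc z < 1 -> exists c, cdiff h z c) ->
  normc z0 < 1 -> cdiff h z0 c0 ->
  forall z, normc z < 1 ->
  let F z := if z == z0 then z0 * c0 else z * ((h z - h z0) * (z - z0)^-1) in
  (z != z0 -> exists c, cdiff F z c) /\ ccont F z.
Proof.
move=> hh z01 hc0 z z1 F.
have A : z != z0 -> exists c, cdiff F z c.
  move=> zz; have [c hc] := hh z z1.
  have X0 : 0 < normc (z - z0) by rewrite nc_gt0 subr_eq0.
  have [c' hc'] : exists c', cdiff (fun z => z * ((h z - h z0) * (z - z0)^-1)) z c'.
    have did : derivable (id : Cplx R -> Cplx R) z 1 by exact: derivable_id.
    have dcst (b : Cplx R) : derivable (cst b : Cplx R -> Cplx R) z 1 by exact: derivable_cst.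
    apply: derivable_cdiff; apply: (derivableM did); apply: derivableM.
      exact: (derivableB (cdiff_derivable hc) (dcst _)).
    apply: (@derivableV _ (Cplx R) (fun z => z - z0)); first by rewrite subr_eq0.
    exact: (derivableB did (dcst _)).
  exists c'; apply: cdiff_near X0 _ hc' => w wd /=.
  rewrite /F ifF//; apply/negbTE/eqP => zw; move: wd.
  rewrite (_ : z - z0 = - w) ?ncN ?ltxx//.
  by rewrite -zw; ring.
split=> //; have [zz|/A [c]] := eqVneq z z0; last exact: cdiff_ccont.
rewrite {A}zz => e e0.
pose B := normc c0 + 2.
have B0 : 0 < B by rewrite ltr_wpDl// normc_ge0.
have e20 : 0 < Num.min 1 (e / 4) by rewrite lt_min ltr01 divr_gt0.
have [d d0 hd] := hc0 _ e20.
exists (Num.min (Num.min d 1) (e / (4 * B))).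
  by rewrite !lt_min d0 ltr01 divr_gt0// mulr_gt0.
move=> w; rewrite !lt_min => /andP[/andP[wd wd1] we].
rewrite /F eqxx; case: eqVneq => [_|wz]; first by rewrite subrr normc0.
have X0 : 0 < normc (w - z0) by rewrite nc_gt0 subr_eq0.
have wz0 : w - z0 != 0 by rewrite subr_eq0.
have := hd _ wd; rewrite subrKC.
have -> : h w - h z0 - c0 * (w - z0) = ((h w - h z0) * (w - z0)^-1 - c0) * (w - z0).
  by field.
rewrite normcM ler_pM2r// => hq.
have -> : w * ((h w - h z0) * (w - z0)^-1) - z0 * c0 =
  w * ((h w - h z0) * (w - z0)^-1 - c0) + (w - z0) * c0 by ring.
apply: le_lt_trans (ncD _ _) _; rewrite !normcM.
have nw : normc w <= 2.
  by apply: le_trans (nc_triB _ z0) _; lra.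
have hq2 : normc ((h w - h z0) * (w - z0)^-1 - c0) <= e / 4.
  by apply: le_trans hq _; rewrite ge_min lexx orbT.
have t1 := ler_pM (normc_ge0 _) (normc_ge0 _) nw hq2.
have t2 : normc (w - z0) * normc c0 <= e / 4.
  move: we; rewrite ltr_pdivlMr ?mulr_gt0// => we.
  have := normc_ge0 c0; have := ltW X0; rewrite /B in we; nra.
by apply: le_lt_trans (lerD t1 t2) _; lra.
Qed.

(** A finite geometric expansion of z / (z - z0) leaves the exact remainder (z0 / z)^m F(z), whose
    mean is O((|z0| / r)^m) because F is bounded on the circle. No infinite sum is exchanged with an
    integral. *)
Lemma holo_pseries_at h r : 0 < r < 1 ->
  (forall z, normc z < 1 -> exists c, cdiff h z c) -> pseries (laurent h r) h r.
Proof.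
move=> r01 hh z0 z0r; have /andP[r0 r1] := r01.
have z01 : normc z0 < 1 by apply: lt_trans r1.
have [c0 hc0] := hh z0 z01.
pose F z := if z == z0 then z0 * c0 else z * ((h z - h z0) * (z - z0)^-1).
have FC z : normc z < 1 -> ccont F z.
  by move=> z1; have [] := ccont_quot hh z01 hc0 z1.
have mF : cmean F r = 0.
  rewrite (@cmean_value _ F (normc z0))//.
  - rewrite /F; case: eqVneq => [<-|_]; rewrite !mul0r ?mulr0//.
  - exact: normc_ge0.
  - move=> z z1 zz _; have [+ _] := ccont_quot hh z01 hc0 z1; apply.
    by apply: contra_neq zz => ->.
  - by rewrite z0r.
have [M M0 hM] : exists2 M : R, 0 <= M & forall t, - pi <= t <= pi -> normc (F (r%:C * cis t)) <= M.
  by apply: circle_bounded; [exact: ltW|move=> z zr; apply: FC; rewrite zr].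
have p0 := @pi_gt0 R.
have nz t : normc (r%:C * cis t) = r by rewrite nc_rcis// ltW.
have zn0 t : r%:C * cis t != 0 by rewrite -nc_gt0 nz.
have zz0 t : r%:C * cis t != z0.
  by apply/eqP => zE; move: z0r; rewrite -zE nz ltxx.
have Vc k t : ccontR (fun t => (r%:C * cis t) ^- k) t.
  apply: (@ccont_circle _ (fun z => z ^- k)).
  by have [c] := cdiff_exprV k (zn0 t); exact: cdiff_ccont.
have hc t : ccontR (fun t => h (r%:C * cis t)) t.
  by apply: ccont_circle; have [|c] := hh (r%:C * cis t); rewrite ?nz//; exact: cdiff_ccont.
have Gc k t : ccontR (fun t => h (r%:C * cis t) * (r%:C * cis t) ^- k) t.
  exact: ccontRM.
have Fc t : ccontR (fun t => F (r%:C * cis t)) t.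
  by apply: ccont_circle; apply: FC; rewrite nz.
have key n : normc (h z0 - \sum_(0 <= k < n.+1) laurent h r k * z0 ^+ k) <=
    2 * M * (normc z0 / r) ^+ n.+1.
  set m := n.+1.
  have Fsplit t : F (r%:C * cis t) =
    (\sum_(0 <= k < m) z0 ^+ k * (h (r%:C * cis t) * (r%:C * cis t) ^- k)
    - h z0 * \sum_(0 <= k < m) z0 ^+ k * (r%:C * cis t) ^- k)
    + z0 ^+ m * ((r%:C * cis t) ^- m * F (r%:C * cis t)).
    move: (zn0 t) (zz0 t); set z := r%:C * cis t => z0' zz.
    have -> : F z = z * ((h z - h z0) * (z - z0)^-1) by rewrite /F (negbTE zz).
    have zz' : z - z0 != 0 by rewrite subr_eq0.
    elim: m => [|m IH].
      by rewrite !big_nil expr0 invr1 !mul1r mulr0 subrr add0r.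
    rewrite [LHS]IH !big_nat_recr//= !exprS.
    by field; rewrite expf_neq0// z0' zz'.
  have Qc t : ccontR (fun t => (r%:C * cis t) ^- m * F (r%:C * cis t)) t by exact: ccontRM.
  have S1 t : ccontR (fun t => \sum_(0 <= k < m) z0 ^+ k * (h (r%:C * cis t) * (r%:C * cis t) ^- k)) t.
    by apply: ccontR_sum => k; apply: ccontRM => //; exact: ccontR_cst.
  have S2 t : ccontR (fun t => \sum_(0 <= k < m) z0 ^+ k * (r%:C * cis t) ^- k) t.
    by apply: ccontR_sum => k; apply: ccontRM => //; exact: ccontR_cst.
  have S3 t : ccontR (fun t => h z0 * \sum_(0 <= k < m) z0 ^+ k * (r%:C * cis t) ^- k) t.
    by apply: ccontRM => //; exact: ccontR_cst.
  have S4 t : ccontR (fun t => z0 ^+ m * ((r%:C * cis t) ^- m * F (r%:C * cis t))) t.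
    by apply: ccontRM => //; exact: ccontR_cst.
  move: mF; rewrite /cmean (eq_cint (fun t _ => Fsplit t)).
  rewrite (@cintD _ (- pi) pi _ _ _ (fun t _ => S4 t)); last first.
    by move=> t _; exact: ccontRB.
  rewrite (cintB (fun t _ => S1 t) (fun t _ => S3 t)) (cintZ _ (fun t _ => S2 t)).
  rewrite (cintZ _ (fun t _ => Qc t)).
  rewrite cint_sum ?pi_itv//; last first.
    by move=> k t _; apply: ccontRM => //; exact: ccontR_cst.
  rewrite cint_sum ?pi_itv//; last first.
    by move=> k t _; apply: ccontRM => //; exact: ccontR_cst.
  under eq_bigr => k _ do rewrite (cintZ _ (fun t _ => Gc k t)).
  under [X in _ * X]eq_bigr => k _ do rewrite (cintZ _ (fun t _ => Vc k t)).
  (* Only k = 0 survives, since the means of the negative powers vanish. *)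
  have -> : \sum_(0 <= k < m) z0 ^+ k * cint (- pi) pi (fun t => (r%:C * cis t) ^- k) = (2 * pi)%:C.
    rewrite big_nat_recl// big1 => [|k _]; last first.
      have := @cmean_exprV k.+1 r isT r01; rewrite /cmean => ->.
      by rewrite mulr0.
    rewrite expr0 mul1r addr0 (@eq_cint _ _ _ _ (fun=> 1)) => [|t _]; last by rewrite expr0 invr1.
    rewrite cint_cst ?pi_itv// mulr1; congr (_%:C); ring.
  set Q := cint _ _ (fun t => _ * F _) => hsum.
  have p20 : (2 * pi)%:C != 0 :> R[i].
    by rewrite -nc_gt0 ncR normr_gt0 mulf_neq0 ?gt_eqF.
  have hE : h z0 - \sum_(0 <= k < m) laurent h r k * z0 ^+ k = ((2 * pi)^-1)%:C * (z0 ^+ m * Q).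
    apply: (mulfI p20); rewrite mulrA -rmorphM/= divff; last by rewrite mulf_neq0 ?gt_eqF.
    rewrite mul1r mulrBr mulr_sumr.
    have -> : \sum_(0 <= k < m) (2 * pi)%:C * (laurent h r k * z0 ^+ k) =
        \sum_(0 <= i < m) z0 ^+ i * cint (- pi) pi (fun t => h (r%:C * cis t) * (r%:C * cis t) ^- i).
      apply: eq_bigr => k _; rewrite /laurent /cmean !mulrA -rmorphM/= divff; last by rewrite mulf_neq0 ?gt_eqF.
      by rewrite mul1r mulrC.
    apply/eqP; rewrite -subr_eq0 -oppr_eq0; apply/eqP; rewrite -[RHS]hsum; ring.
  rewrite hE normcM ncR normcM ncX.
  have hQ : normc Q <= 2 * (r ^- m * M) * (pi - - pi).
    apply: cint_bound => [|t _|t ht]; [exact: pi_itv|exact: Qc|].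
    rewrite normcM normcV ncX nz ler_wpM2l ?invr_ge0 ?exprn_ge0 ?(ltW r0)//.
    exact: hM.
  have p2 : 0 < 2 * (pi : R) by rewrite mulr_gt0.
  rewrite ger0_norm ?invr_ge0 ?(ltW p2)//.
  rewrite mulrC ler_pdivrMr//.
  apply: le_trans (ler_wpM2l (exprn_ge0 _ (normc_ge0 _)) hQ) _.
  rewrite expr_div_n; move: (pi : R) => p.
  by rewrite le_eqVlt; apply/orP; left; apply/eqP; field; rewrite expf_neq0// gt_eqF.
move=> e e0.
have q01 : 0 <= normc z0 / r < 1.
  by rewrite divr_ge0 ?normc_ge0 ?ltW//= ltr_pdivrMr ?mul1r.
have [N hN] := geo_small (2 * M) q01 e0.
by exists N.+1 => -[//|n] Nn; apply: le_lt_trans (key n) _; apply: hN; exact: ltnW.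
Qed.

Lemma holo_pseries h : (forall z, normc z < 1 -> exists c, cdiff h z c) ->
  pseries (taylor_coef h) h 1.
Proof.
move=> hh z z1; pose r := (normc z + 1) / 2.
have z0 := normc_ge0 z.
have r01 : 0 < r < 1 by rewrite /r; lra.
have H := holo_pseries_at r01 hh.
have zr : normc z < r by rewrite /r; lra.
apply: hassum_ext (H z zr) => k.
by rewrite -(taylor_coef_pseries _ _ H)//; case/andP: r01.
Qed.

End Taylor.

(** * Averages over roots of unity *)

Section RootsOfUnity.
Context {R : realType}.
Implicit Types (x z w : R[i]).

Definition rootU N : R[i] := cis (2 * pi / N%:R).

Lemma cisX (t : R) n : cis t ^+ n = cis (n%:R * t).
Proof.
elim: n => [|n IH]; first by rewrite expr0 mul0r /cis sin0 cos0.
by rewrite exprS IH -cisD -natr1; congr cis; ring.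
Qed.

(** The half angle pi k / N lies in ]0, pi[, where the sine is positive, so the real part 1 - 2
    sin^2 is below 1. *)
Lemma rootU_neq1 N k : (0 < k < N)%N -> rootU N ^+ k != 1.
Proof.
move=> /andP[k0 kN]; rewrite /rootU cisX.
have N0 : 0 < N%:R :> R by rewrite ltr0n (leq_ltn_trans _ kN).
set t := k%:R * _; have k0' : 0 < k%:R :> R by rewrite ltr0n.
have p0 := @pi_gt0 R.
have t2 : t / 2 = pi * (k%:R / N%:R).
  by rewrite /t; move: (pi : R) => p; field; rewrite gt_eqF.
have s0 : 0 < sin (t / 2).
  apply: sin_gt0_pi; rewrite t2 mulr_gt0 ?divr_gt0//=.
  by rewrite gtr_pMr// ltr_pdivrMr// mul1r ltr_nat.
rewrite eq_complex/= negb_and; apply/orP; left.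
have -> : cos t = 1 - 2 * sin (t / 2) ^+ 2.
  have -> : t = t / 2 + t / 2 by field.
  rewrite cosD -[X in _ = X - _](cos2Dsin2 (t / 2)).
  have -> : (t / 2 + t / 2) / 2 = t / 2 by field.
  ring.
rewrite -subr_eq0 addrC addKr oppr_eq0 mulf_neq0// expf_neq0// gt_eqF//.
Qed.

Lemma rootUN N : (0 < N)%N -> rootU N ^+ N = 1.
Proof.
move=> N0; have N0' : N%:R != 0 :> R by rewrite pnatr_eq0 -lt0n.
rewrite /rootU cisX (_ : N%:R * _ = 2 * pi); last first.
  by move: (pi : R) => p; field.
rewrite (_ : 2 * pi = pi + pi :> R); last by rewrite mulr_natl mulr2n.
by rewrite /cis cosD sinD sinpi cospi !mulr0 mul0r subr0 addr0 mulrNN mulr1.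
Qed.

Lemma nc_rootU N j : normc (rootU N ^+ j) = 1.
Proof. by rewrite ncX nc_cis expr1n. Qed.

Lemma rootU_neq0 N j : rootU N ^+ j != 0.
Proof. by rewrite -nc_gt0 nc_rootU. Qed.

(** A discrete circle mean, exact on trigonometric polynomials of degree below N by [avg_orth]. *)
Definition avg N (g : R[i] -> R[i]) : R[i] := N%:R^-1 * \sum_(j < N) g (rootU N ^+ j).

Lemma avg_orth N a b : (a < N)%N -> (b < N)%N ->
  avg N (fun x => x ^+ a * x ^- b) = (a == b)%:R.
Proof.
move=> aN bN; have N0 : (0 < N)%N by apply: leq_ltn_trans aN.
have N0' : N%:R != 0 :> R[i] by rewrite pnatr_eq0 -lt0n.
rewrite /avg; case: eqVneq => [->|ab].
  rewrite (eq_bigr (fun=> 1)) => [|j _]; last by rewrite mulfV// expf_neq0// rootU_neq0.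
  by rewrite sumr_const card_ord mulVf.
pose y := rootU N ^+ a / rootU N ^+ b.
have yN : y ^+ N = 1.
  by rewrite expr_div_n -!exprM ![(_ * N)%N]mulnC !exprM rootUN// !expr1n divr1.
have y1 : y != 1.
  apply/negP => /eqP; rewrite /y => /(canRL (mulfVK (rootU_neq0 N b))).
  rewrite mul1r => E; move: ab; rewrite neq_ltn => /orP[h|h].
    have := @rootU_neq1 N (b - a); rewrite subn_gt0 h (leq_ltn_trans (leq_subr _ _) bN).
    move=> /(_ isT)/eqP; apply; apply: (mulfI (rootU_neq0 N a)).
    by rewrite -exprD subnKC ?(ltnW h)// mulr1.
  have := @rootU_neq1 N (a - b); rewrite subn_gt0 h (leq_ltn_trans (leq_subr _ _) aN).
  move=> /(_ isT)/eqP; apply; apply: (mulfI (rootU_neq0 N b)).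
  by rewrite -exprD subnKC ?(ltnW h)// mulr1.
have E : \sum_(j < N) (rootU N ^+ j) ^+ a * (rootU N ^+ j) ^- b = \sum_(j < N) y ^+ j.
  by apply: eq_bigr => j _; rewrite /y expr_div_n -!exprM [(j * a)%N]mulnC [(j * b)%N]mulnC.
rewrite E; have := subrX1 y N; rewrite yN subrr => /esym/eqP.
by rewrite mulf_eq0 subr_eq0 (negbTE y1)/= => /eqP ->; rewrite mulr0.
Qed.

Lemma avg_sum N n (G : nat -> R[i] -> R[i]) :
  avg N (fun x => \sum_(k < n) G k x) = \sum_(k < n) avg N (G k).
Proof. by rewrite /avg exchange_big/= mulr_sumr. Qed.

Lemma avgZ N c g : avg N (fun x => c * g x) = c * avg N g.
Proof. by rewrite /avg -mulr_sumr mulrCA. Qed.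

Lemma avgB N g g' : avg N (fun x => g x - g' x) = avg N g - avg N g'.
Proof. by rewrite /avg sumrB mulrBr. Qed.

Lemma eq_avg N g g' : (forall x, normc x = 1 -> g x = g' x) -> avg N g = avg N g'.
Proof. by move=> h; rewrite /avg; congr (_ * _); apply: eq_bigr => j _; rewrite h ?nc_rootU. Qed.

Lemma avg_le N g (G : R[i] -> R) : (forall x, normc x = 1 -> normc (g x) <= G x) ->
  normc (avg N g) <= N%:R^-1 * \sum_(j < N) G (rootU N ^+ j).
Proof.
move=> h; rewrite /avg normcM normcV nc_nat ler_wpM2l ?invr_ge0//.
by apply: le_trans (nc_sum _ _ _) _; apply: ler_sum => j _; apply: h; rewrite nc_rootU.
Qed.

Lemma avg_le_cst N g (M : R) : (0 < N)%N -> (forall x, normc x = 1 -> normc (g x) <= M) ->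
  normc (avg N g) <= M.
Proof.
move=> N0 h; apply: le_trans (avg_le N h) _.
rewrite sumr_const card_ord -[M *+ N]mulr_natl mulKf//.
by rewrite pnatr_eq0 -lt0n.
Qed.

End RootsOfUnity.

(** * The maximum principle for polynomials *)

Section MaxModulus.
Context {R : realType}.
Implicit Types (z w : R[i]) (d : nat -> R[i]) (rho M r : R).

Lemma poly_cauchy d n rho M : 0 < rho ->
  (forall w, normc w = rho -> normc (\sum_(k < n) d k * w ^+ k) <= M) ->
  forall k, (k < n)%N -> normc (d k) * rho ^+ k <= M.
Proof.
move=> r0 h k kn; have n0 : (0 < n)%N by apply: leq_ltn_trans kn.
have -> : normc (d k) * rho ^+ k = normc (d k * rho%:C ^+ k).
  by rewrite normcM ncX ncR gtr0_norm.
have -> : d k * rho%:C ^+ k =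
    avg n (fun x => (\sum_(i < n) d i * (rho%:C * x) ^+ i) * x ^- k).
  have -> : (fun x => (\sum_(i < n) d i * (rho%:C * x) ^+ i) * x ^- k) =
      (fun x => \sum_(i < n) (d i * rho%:C ^+ i) * (x ^+ i * x ^- k)).
    apply/funext => x; rewrite mulr_suml; apply: eq_bigr => i _.
    by rewrite exprMn !mulrA.
  rewrite (avg_sum n n (fun i x => (d i * rho%:C ^+ i) * (x ^+ i * x ^- k))).
  under eq_bigr => i _ do rewrite avgZ avg_orth//.
  rewrite (bigD1 (Ordinal kn))//= eqxx mulr1 big1 ?addr0// => i ik.
  by rewrite (_ : (i == k :> nat) = false) ?mulr0//; apply: negbTE.
apply: avg_le_cst => // x x1.
rewrite normcM normcV ncX x1 expr1n invr1 mulr1; apply: h.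
by rewrite normcM x1 mulr1 ncR gtr0_norm.
Qed.

Lemma poly_bound_weak d n rho M z : 0 < rho -> normc z <= rho ->
  (forall w, normc w = rho -> normc (\sum_(k < n) d k * w ^+ k) <= M) ->
  normc (\sum_(k < n) d k * z ^+ k) <= n%:R * M.
Proof.
move=> r0 zr h; apply: le_trans (nc_sum _ _ _) _.
rewrite -[n in leRHS]card_ord mulr_natl -sumr_const; apply: ler_sum => k _.
rewrite normcM ncX; apply: le_trans (poly_cauchy r0 h (ltn_ord k)).
by rewrite ler_wpM2l ?normc_ge0// lerXn2r ?nnegrE ?normc_ge0// ltW.
Qed.

(* The power trick: the weak bound applied to p ^+ m costs a factor linear in m,
   which disappears after taking m-th roots. *)
Lemma poly_max_modulus d n rho M z : 0 < rho -> normc z <= rho ->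
  (forall w, normc w = rho -> normc (\sum_(k < n) d k * w ^+ k) <= M) ->
  normc (\sum_(k < n) d k * z ^+ k) <= M.
Proof.
move=> r0 zr h; pose p := \poly_(k < n) d k.
have pE w : p.[w] = \sum_(k < n) d k * w ^+ k by rewrite horner_poly.
have M0 : 0 <= M.
  by apply: le_trans (h rho%:C _); rewrite ?normc_ge0// ncR gtr0_norm.
rewrite -pE; rewrite leNgt; apply/negP => Mp.
have P0 : 0 < normc p.[z] by apply: le_lt_trans Mp.
have key m : normc p.[z] ^+ m <= (n.+1 * m.+1)%:R * M ^+ m.
  have sz : (size (p ^+ m) <= n.+1 * m.+1)%N.
    have sp : (size p <= n)%N by exact: size_poly.
    apply: leq_trans (size_poly_exp_leq _ _) _.
    by nia.
  have E w : p.[w] ^+ m = \sum_(k < n.+1 * m.+1) (p ^+ m)`_k * w ^+ k.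
    by rewrite -horner_exp -horner_coef_wide.
  rewrite -ncX E; apply: poly_bound_weak r0 zr _ => w wr.
  by rewrite -E ncX lerXn2r ?nnegrE ?normc_ge0// pE h.
have q01 : 0 <= M / normc p.[z] < 1.
  by rewrite divr_ge0 ?normc_ge0//= ltr_pdivrMr// mul1r.
have [q2 [C2 [/andP[q20 q21] hq]]] := poly_geo q01.
have C20 : 0 <= C2 by have := hq 0%N; rewrite !expr0 !mulr1; exact: le_trans.
(* With q = M / |p(z)| < 1, [key] reads 1 <= (n + 1)(m + 1) q^m. Multiplying by (m + 1)^2 and using
   (m + 1)^2 q^m <= C2 bounds every m, which is absurd. *)
have kb m : m.+1%:R <= C2 * n.+1%:R :> R.
  have h1 : 1 <= (n.+1 * m.+1)%:R * (M / normc p.[z]) ^+ m.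
    by rewrite expr_div_n mulrA ler_pdivlMr ?exprn_gt0// mul1r.
  have h2 := hq m.
  have h3 : C2 * q2 ^+ m <= C2.
    by rewrite -[leRHS]mulr1 ler_wpM2l// exprn_ile1// ltW.
  have m0 : 0 < m.+1%:R :> R by rewrite ltr0n.
  rewrite -(ler_pM2r m0) -expr2; apply: le_trans (_ : m.+1%:R ^+ 2 * ((n.+1 * m.+1)%:R * (M / normc p.[z]) ^+ m) <= _).
    by rewrite ler_peMr// exprn_ge0.
  have -> : C2 * n.+1%:R * m.+1%:R = (n.+1 * m.+1)%:R * C2 by rewrite natrM; ring.
  by rewrite mulrCA ler_wpM2l//; exact: le_trans h2 h3.
have := kb (Num.truncn (C2 * n.+1%:R)); apply/negP; rewrite -ltNge.
by apply: truncnS_gt.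
Qed.

(** As in Schwarz's lemma: after division by w^p a polynomial remains, and the maximum principle
    applies to it. *)
Lemma poly_low_decay d p q rho M z : (p <= q)%N -> 0 < rho -> normc z <= rho ->
  (forall w, normc w = rho -> normc (\sum_(p <= k < q) d k * w ^+ k) <= M) ->
  normc (\sum_(p <= k < q) d k * z ^+ k) <= (normc z / rho) ^+ p * M.
Proof.
move=> pq r0 zr h.
have E w : \sum_(p <= k < q) d k * w ^+ k = w ^+ p * \sum_(k < q - p) d (k + p)%N * w ^+ k.
  rewrite -{1}[p]add0n big_addn big_mkord mulr_sumr; apply: eq_bigr => k _.
  by rewrite exprD; ring.
rewrite E normcM ncX expr_div_n -mulrA ler_wpM2l ?exprn_ge0 ?normc_ge0//.
apply: (@poly_max_modulus (fun k => d (k + p)%N) _ _ _ _ r0 zr) => w wr.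
have := h w wr; rewrite E normcM ncX wr -ler_pdivlMl ?exprn_gt0//.
Qed.

(** Divided by w^q, the block is a polynomial in 1 / w, and the outside of the circle becomes the
    inside. *)
Lemma poly_high_growth d p q rho M z : 0 < rho -> rho <= normc z ->
  (forall w, normc w = rho -> normc (\sum_(p <= k < q) d k * w ^+ k) <= M) ->
  normc (\sum_(p <= k < q) d k * z ^+ k) <= (normc z / rho) ^+ q * M.
Proof.
move=> r0 zr h; pose d' k := if (p <= k)%N then d k else 0.
have z0 : 0 < normc z by apply: lt_le_trans zr.
have z0' : z != 0 by rewrite -nc_gt0.
(* The index k = 0 would bring in [d q], which lies outside the block, and is removed by the factor
   [(0 < k)]; [d'] cuts off below p. *)
have E w : w != 0 -> \sum_(p <= k < q) d k * w ^+ k = w ^+ q * \sum_(k < q.+1) d' (q - k)%N * (0 < k)%N%:R * w^-1 ^+ k.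
  move=> w0; rewrite big_ord_recl/= mulr0 mul0r add0r mulr_sumr.
  rewrite (reindex_inj rev_ord_inj)/=.
  have -> : \sum_(p <= k < q) d k * w ^+ k = \sum_(0 <= k < q) d' k * w ^+ k.
    have [pq|qp] := leqP p q.
      rewrite [RHS](@big_cat_nat _ _ _ p)//=.
      have -> : \sum_(0 <= k < p) d' k * w ^+ k = 0.
        by rewrite big_nat big1// => k /andP[_ kp]; rewrite /d' leqNgt kp mul0r.
      by rewrite add0r; apply: eq_big_nat => k /andP[pk _]; rewrite /d' pk.
    rewrite big_geq ?(ltnW qp)// big_nat big1// => k /andP[_ kq].
    by rewrite /d' leqNgt (ltn_trans kq qp) mul0r.
  rewrite big_mkord; apply: eq_bigr => k _.
  have kq := ltn_ord k.
  have -> : (q - bump 0 (q - k.+1))%N = k by rewrite /bump; lia.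
  rewrite mulr1 exprVn mulrCA; congr (_ * _).
  have -> : w ^+ q = w ^+ k * w ^+ bump 0 (q - k.+1).
    by rewrite -exprD; congr (_ ^+ _); rewrite /bump; lia.
  by rewrite mulfK// expf_neq0.
rewrite E// normcM ncX expr_div_n -mulrA ler_wpM2l ?exprn_ge0 ?normc_ge0//.
have r0' : 0 < rho^-1 by rewrite invr_gt0.
have zr' : normc z^-1 <= rho^-1 by rewrite normcV lef_pV2.
apply: (@poly_max_modulus (fun k => d' (q - k)%N * (0 < k)%N%:R) _ _ _ _ r0' zr') => w wr.
have w0 : w != 0 by rewrite -nc_gt0 wr.
have wV : normc w^-1 = rho by rewrite normcV wr invrK.
have := h w^-1 wV; rewrite E ?invr_eq0// invrK normcM ncX wV -ler_pdivlMl ?exprn_gt0//.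
Qed.

End MaxModulus.

(** * Landau's bound for partial sums, and Abel summation *)

Section Landau.
Context {R : realType}.
Implicit Types (z w : R[i]) (c : nat -> R[i]) (f : R[i] -> R[i]) (M r : R).

(* binomial (2k, k) / 4^k *)
Fixpoint lan (k : nat) : R :=
  if k is k'.+1 then lan k' * (k'.*2.+1%:R / k'.*2.+2%:R) else 1.

Lemma lanS k : lan k.+1 * k.+1%:R * 2 = lan k * (2 * k%:R + 1).
Proof.
rewrite /= -mul2n.
have -> : (2 * k).+1%:R = 2 * k%:R + 1 :> R by rewrite -natr1 natrM.
have -> : (2 * k).+2%:R = 2 * k.+1%:R :> R.
  by rewrite -[in RHS]natr1 -!natr1 natrM; ring.
have : k.+1%:R != 0 :> R by rewrite pnatr_eq0.
by move: (k.+1%:R : R) => x x0; field.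
Qed.

(** The ratio of consecutive squares, ((2k + 1) / (2k + 2))^2, is at most (k + 1) / (k + 2). *)
Lemma lan_sqr_le k : lan k ^+ 2 <= k.+1%:R^-1.
Proof.
elim: k => [|k IH]; first by rewrite expr1n invr1.
have K0 : 0 <= k%:R :> R by [].
have e1 : k.+1%:R = k%:R + 1 :> R by rewrite -natr1.
have e2 : k.+2%:R = k%:R + 1 + 1 :> R by rewrite -!natr1.
have h := lanS k.
have -> : lan k.+1 ^+ 2 = lan k ^+ 2 * ((2 * k%:R + 1) ^+ 2 / (2 * k.+1%:R) ^+ 2).
  have K1 : k.+1%:R != 0 :> R by rewrite pnatr_eq0.
  rewrite mulrA -exprMn -h; move: (lan k.+1) (k.+1%:R : R) K1 => x y y0.
  by field.
apply: le_trans (ler_wpM2r _ IH) _; first by rewrite divr_ge0// sqr_ge0.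
rewrite e1 e2; move: (k%:R : R) K0 => K K0.
have K1 : 0 < K + 1 by lra.
rewrite (_ : (K + 1)^-1 * _ = (2 * K + 1) ^+ 2 / (4 * (K + 1) ^+ 3)); last first.
  by field; rewrite gt_eqF.
rewrite ler_pdivrMr; last by rewrite mulr_gt0// exprn_gt0.
rewrite [leRHS]mulrC ler_pdivlMr; last by lra.
by rewrite -subr_ge0; have : 0 <= K by []; nra.
Qed.

(** Reversing the sum turns the weight i into p - i, and the two add up to p. *)
Lemma lan_conv_weight p :
  2 * \sum_(i < p.+1) i%:R * (lan i * lan (p - i)) = p%:R * \sum_(i < p.+1) lan i * lan (p - i).
Proof.
rewrite mulr_natl mulr2n {2}(reindex_inj rev_ord_inj)/= -big_split/= mulr_sumr.
apply: eq_bigr => i _; have ip := ltn_ord i; rewrite subSS.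
have -> : (p - (p - i))%N = i by lia.
by rewrite [lan (p - i) * _]mulrC -mulrDl -natrD; congr (_%:R * _); lia.
Qed.

(* Comparing coefficients in Q' (1 - x) 2 = Q, where Q = sum lan k x^k is the
   square root of 1 / (1 - x). *)
Lemma lan_conv p : \sum_(i < p.+1) lan i * lan (p - i) = 1.
Proof.
elim: p => [|p IH]; first by rewrite big_ord_recl big_ord0 addr0 mulr1.
have p0 : p.+1%:R != 0 :> R by rewrite pnatr_eq0.
apply: (mulfI p0); rewrite -lan_conv_weight big_ord_recl mul0r add0r mulr1.
rewrite mulr_sumr.
have -> : \sum_(i < p.+1) 2 * ((lift ord0 i)%:R * (lan (lift ord0 i) * lan (p.+1 - lift ord0 i)))
   = \sum_(i < p.+1) (2 * (i%:R * (lan i * lan (p - i))) + lan i * lan (p - i)).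
  apply: eq_bigr => i _; rewrite lift0 subSS.
  have -> : 2 * (i.+1%:R * (lan i.+1 * lan (p - i))) = (lan i.+1 * i.+1%:R * 2) * lan (p - i) by ring.
  by rewrite lanS; ring.
by rewrite big_split/= -mulr_sumr lan_conv_weight IH mulr1 natr1.
Qed.

(** The shift by 2 keeps [lg n >= ln 2 > 0] down to n = 0. *)
Definition lg (n : nat) : R := ln n.+2%:R.

Lemma lg_gt0 n : 0 < lg n.
Proof. by rewrite ln_gt0// ltr1n. Qed.

Lemma ler_lg m n : (m <= n)%N -> lg m <= lg n.
Proof. by move=> mn; rewrite ler_ln ?posrE ?ltr0n// ler_nat !ltnS. Qed.

Lemma lg_step n : n.+3%:R^-1 <= lg n.+1 - lg n.
Proof.
rewrite /lg -ln_div ?posrE//.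
have h : n.+2%:R / n.+3%:R = 1 + (- n.+3%:R^-1) :> R.
  rewrite -[n.+3%:R]natr1; have : 0 < n.+2%:R :> R by rewrite ltr0n.
  by move: (n.+2%:R : R) => x x0; field; rewrite gt_eqF// ltr_wpDl// ltW.
have := @le_ln1Dx R (- n.+3%:R^-1).
rewrite -h -[n.+2%:R / _]invf_div lnV ?posrE ?divr_gt0// => hh.
rewrite -lerN2; apply: hh.
by rewrite ltrN2 invf_lt1// ltr1n.
Qed.

(** Termwise lan n^2 <= 1 / (n + 1) <= 3 / (n + 3), and 1 / (n + 3) is at most the increment of
    [lg]. *)
Lemma lan_sum n : \sum_(k < n) lan k ^+ 2 <= 3 * lg n.
Proof.
elim: n => [|n IH]; first by rewrite big_ord0 mulr_ge0// ltW// lg_gt0.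
rewrite big_ord_recr/=; have h := lg_step n.
have : lan n ^+ 2 <= 3 * n.+3%:R^-1.
  apply: le_trans (lan_sqr_le n) _.
  have n1 : 0 < n.+1%:R :> R by rewrite ltr0n.
  have n3 : 0 < n.+3%:R :> R by rewrite ltr0n.
  by rewrite ler_pdivlMr// ler_pdivrMl// -natrM ler_nat; lia.
move: IH h; move: (n.+3%:R^-1 : R) (lg n) (lg n.+1) (lan n ^+ 2) => a b c d. lra.
Qed.

Definition lanQ n (x : R[i]) : R[i] := \sum_(k < n) (lan k)%:C * x ^+ k.

Lemma lanQ_parseval N n : (n <= N)%N -> (0 < N)%N ->
  N%:R^-1 * \sum_(j < N) normc (lanQ n (rootU N ^+ j)) ^+ 2 = \sum_(k < n) lan k ^+ 2.
Proof.
move=> nN N0.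
apply: (@complexI R).
have -> : (N%:R^-1 * \sum_(j < N) normc (lanQ n (rootU N ^+ j)) ^+ 2)%:C =
    avg N (fun x => (normc (lanQ n x) ^+ 2)%:C).
  by rewrite /avg rmorphM/= fmorphV/= rmorph_nat rmorph_sum.
rewrite (@eq_avg _ _ _ (fun x => \sum_(k < n) (lan k)%:C * \sum_(l < n) (lan l)%:C * (x ^+ k * x ^- l))); last first.
  move=> x x1.
  have xV : x^*%C = x^-1.
    have x0 : x != 0 by rewrite -nc_gt0 x1.
    apply: (mulfI x0); rewrite mulfV// -sqr_normc.
    by rewrite -ncE x1 expr1n.
  have -> : (normc (lanQ n x) ^+ 2)%:C = lanQ n x * (lanQ n x)^*%C.
    by rewrite -sqr_normc rmorphXn/=.
  rewrite {2}/lanQ rmorph_sum/= mulr_suml; apply: eq_bigr => k _.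
  rewrite !mulr_sumr; apply: eq_bigr => l _.
  rewrite rmorphM/= rmorphXn/= xV exprVn.
  have -> : (lan l +i* - 0) = (lan l)%:C by rewrite oppr0.
  by ring.
rewrite (avg_sum N n (fun k x => (lan k)%:C * \sum_(l < n) (lan l)%:C * (x ^+ k * x ^- l))).
rewrite rmorph_sum/=; apply: eq_bigr => k _.
rewrite avgZ (avg_sum N n (fun l x => (lan l)%:C * (x ^+ k * x ^- l))).
rewrite (bigD1 k)//= avgZ avg_orth ?(leq_trans (ltn_ord _) nN)// eqxx mulr1.
rewrite big1 ?addr0 -?rmorphM -?expr2// => l lk.
rewrite avgZ avg_orth ?(leq_trans (ltn_ord _) nN)//.
by rewrite [_ == _ :> nat](_ : _ = false) ?mulr0//; apply/negbTE; rewrite eq_sym.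
Qed.

Lemma lanQ_sqr n x : lanQ n x ^+ 2 =
  \sum_(i < n) \sum_(l < n) (lan i * lan l)%:C * x ^+ (i + l).
Proof.
rewrite expr2 /lanQ mulr_suml; apply: eq_bigr => i _.
rewrite mulr_sumr; apply: eq_bigr => l _.
by rewrite rmorphM/= exprD; ring.
Qed.

Lemma lan_conv2 n p : (p < n)%N ->
  \sum_(i < n) \sum_(l < n) (lan i * lan l) * ((i + l)%N == p)%:R = 1.
Proof.
move=> pn; rewrite -[RHS](lan_conv p).
rewrite (big_ord_widen_cond n (fun _ => true) (fun i => lan i * lan (p - i)))//.
rewrite [RHS]big_mkcond/=; apply: eq_bigr => i _; case: ifPn => ip.
  have h : (p - i < n)%N by apply: leq_ltn_trans pn; exact: leq_subr.
  rewrite (bigD1 (Ordinal h))//= subnKC ?eqxx ?mulr1//.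
  rewrite big1 ?addr0// => l lh.
  rewrite [_ == p](_ : _ = false) ?mulr0//; apply/negbTE/eqP => E.
  by move/eqP: lh; apply; apply: val_inj => /=; lia.
rewrite big1// => l _; rewrite [_ == p](_ : _ = false) ?mulr0//.
by apply/negbTE/eqP => E; move: ip; lia.
Qed.

(* Landau's kernel: x^-(n-1) Q(x)^2 has the negative coefficients of the
   Dirichlet kernel, and its mean modulus is computed by Parseval. *)
Lemma pseries_trunc c f r M : pseries c f 1 -> 0 < r < 1 ->
  (forall z, normc z = r -> normc (f z) <= M) ->
  forall n z, normc z = r -> normc (\sum_(k < n) c k * z ^+ k) <= 3 * lg n * M.
Proof.
move=> hf /andP[r0 r1] hM n z zr.
have M0 : 0 <= M by apply: le_trans (hM z zr); exact: normc_ge0.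
case: n => [|n].
  by rewrite big_ord0 normc0 !mulr_ge0// ltW// lg_gt0.
pose Q := lanQ n.+1.
pose B := \sum_(k < n.+1) lan k ^+ 2.
have B0 : 0 <= B by apply: sumr_ge0 => k _; exact: sqr_ge0.
suff H : normc (\sum_(k < n.+1) c k * z ^+ k) <= M * B.
  by apply: le_trans H _; rewrite mulrC ler_wpM2r// lan_sum.
apply/ler_addgt0Pr => e e0.
have e'0 : 0 < e / (B + 1) by rewrite divr_gt0// ltr_wpDl.
(* Discrete averages are exact only on polynomials, so f is replaced by a Taylor polynomial, at a
   cost below e / (B + 1) on the circle |z| = r. *)
have [C [q [q01 hq]]] : exists C q : R, 0 <= q < 1 /\ forall k, normc (c k) * r ^+ k <= C * q ^+ k.
  by apply: (pseries_geo hf); rewrite r0 r1.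
have tail K x : normc x = 1 -> normc (f (z * x) - \sum_(k < K) c k * (z * x) ^+ k)
    <= 2 * (C / (1 - q)) * q ^+ K.
  move=> x1; have nzx : normc (z * x) = r by rewrite normcM x1 mulr1.
  have b k : normc (c k * (z * x) ^+ k) <= C * q ^+ k by rewrite normcM ncX nzx.
  have [l hl hl2] := geo_hassum q01 b.
  have -> : f (z * x) = l by apply: hassum_unique hl; apply: hf; rewrite nzx.
  by rewrite -(big_mkord xpredT (fun k => c k * (z * x) ^+ k)).
have [K0 hK0] := geo_small (2 * (C / (1 - q))) q01 e'0.
(* N exceeds all exponents k + i + l <= K - 1 + 2 n that occur, as [avg_orth] requires. *)
pose K := maxn K0 n.+1; pose N := (K + n.*2 + 1)%N.
have N0 : (0 < N)%N by rewrite /N addn1.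
pose g x := (\sum_(k < K) c k * (z * x) ^+ k) * (x ^- n * Q x ^+ 2).
pose G x := f (z * x) * (x ^- n * Q x ^+ 2).
have nQ x : normc x = 1 -> normc (x ^- n * Q x ^+ 2) = normc (Q x) ^+ 2.
  by move=> x1; rewrite normcM normcV !ncX x1 expr1n invr1 mul1r.
have pars : N%:R^-1 * \sum_(j < N) normc (Q (rootU N ^+ j)) ^+ 2 = B.
  by apply: lanQ_parseval => //; rewrite /N /K; lia.
have GB : normc (avg N G) <= M * B.
  apply: le_trans (avg_le (G := fun x => M * normc (Q x) ^+ 2) _ _) _.
    move=> x x1; rewrite /G normcM nQ// ler_wpM2r ?sqr_ge0//; apply: hM.
    by rewrite normcM x1 mulr1.
  by rewrite -mulr_sumr mulrCA pars.
have GgB : normc (avg N G - avg N g) <= e.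
  rewrite -avgB; apply: le_trans (avg_le (G := fun x => e / (B + 1) * normc (Q x) ^+ 2) _ _) _.
    move=> x x1; rewrite /G /g -mulrBl normcM nQ// ler_wpM2r ?sqr_ge0//.
    by apply: le_trans (tail K x x1) _; apply/ltW/hK0; exact: leq_maxl.
  rewrite -mulr_sumr mulrCA pars mulrAC ler_pdivrMr ?ltr_wpDl//.
  by rewrite ler_wpM2l ?(ltW e0)// lerDl.
suff E : avg N g = \sum_(k < n.+1) c k * z ^+ k.
  rewrite -E; apply: le_trans (nc_triB _ (avg N G)) _.
  by rewrite nc_distC lerD.
rewrite (@eq_avg _ _ _ (fun x => \sum_(k < K) (c k * z ^+ k) *
   \sum_(i < n.+1) \sum_(l < n.+1) (lan i * lan l)%:C * (x ^+ (k + (i + l)) * x ^- n))); last first.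
  move=> x x1; rewrite /g lanQ_sqr mulr_suml; apply: eq_bigr => k _.
  rewrite exprMn -!mulrA; congr (_ * (_ * _)).
  rewrite !mulr_sumr; apply: eq_bigr => i _.
  rewrite !mulr_sumr; apply: eq_bigr => l _.
  by rewrite !exprD; ring.
rewrite (avg_sum N K (fun k x => (c k * z ^+ k) *
   \sum_(i < n.+1) \sum_(l < n.+1) (lan i * lan l)%:C * (x ^+ (k + (i + l)) * x ^- n))).
have nK : (n.+1 <= K)%N by exact: leq_maxr.
rewrite (big_ord_widen_cond K (fun _ => true) (fun k => c k * z ^+ k))//.
rewrite [RHS]big_mkcond/=; apply: eq_bigr => k _.
have kK := ltn_ord k.
rewrite avgZ (avg_sum N n.+1 (fun i x => \sum_(l < n.+1) (lan i * lan l)%:C * (x ^+ (k + (i + l)) * x ^- n))).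
under eq_bigr => i _ do rewrite (avg_sum N n.+1 (fun l x => (lan i * lan l)%:C * (x ^+ (k + (i + l)) * x ^- n))).
(* The factor of c_k z^k is the sum of lan i * lan l over i + l = n - k: it is 1 for k <= n by
   [lan_conv2], and empty for k > n. *)
have -> : \sum_(i < n.+1) \sum_(l < n.+1) avg N (fun x => (lan i * lan l)%:C * (x ^+ (k + (i + l)) * x ^- n))
   = (\sum_(i < n.+1) \sum_(l < n.+1) (lan i * lan l) * ((k + (i + l))%N == n)%:R)%:C.
  rewrite rmorph_sum/=; apply: eq_bigr => i _; rewrite rmorph_sum/=; apply: eq_bigr => l _.
  have il := ltn_ord i; have ll := ltn_ord l.
  rewrite avgZ avg_orth; [|by rewrite /N; clear -nK kK il ll; lia..].
  by case: eqP => _; rewrite ?mulr1 ?mulr0.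
case: ifPn => kn.
  have h : (n - k < n.+1)%N by rewrite ltnS leq_subr.
  rewrite -[RHS]mulr1 -[in RHS](_ : (\sum_(i < n.+1) \sum_(l < n.+1) (lan i * lan l) * ((i + l)%N == (n - k)%N)%:R)%:C = 1).
    congr (_ * _%:C); apply: eq_bigr => i _; apply: eq_bigr => l _.
    by congr (_ * _%:R); congr (nat_of_bool _); apply/eqP/eqP; clear -kn; lia.
  by rewrite lan_conv2.
rewrite big1 ?mulr0// => i _; rewrite big1// => l _.
rewrite [_ == n](_ : _ = false) ?mulr0//; apply/negbTE/eqP => E.
by clear -kn E; lia.
Qed.

(** The decrements of b telescope, so the induction carries the bound B (2 b_p - b_(p+m)). The
    partial sums start at 0 and not at p, which costs the second b_p. *)
Lemma abel_block c (b : nat -> R) (B : R) z p q : (p < q)%N ->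
  (forall k, (p <= k)%N -> (k.+1 < q)%N -> b k.+1 <= b k) ->
  (forall k, (p <= k)%N -> (k < q)%N -> 0 <= b k) ->
  (forall n, (n <= q)%N -> normc (\sum_(k < n) c k * z ^+ k) <= B) ->
  normc (\sum_(p <= k < q) (b k)%:C * c k * z ^+ k) <= 2 * b p * B.
Proof.
move=> pq bm b0 hS; pose S n := \sum_(k < n) c k * z ^+ k.
have SS n : S n.+1 = S n + c n * z ^+ n by rewrite /S big_ord_recr.
have key m : (p + m < q)%N ->
    normc (\sum_(p <= k < (p + m).+1) (b k)%:C * c k * z ^+ k - (b (p + m)%N)%:C * S (p + m).+1)
    <= B * (2 * b p - b (p + m)%N).
  elim: m => [|m IH] pm.
    rewrite addn0 big_nat1 SS.
    have -> : (b p)%:C * c p * z ^+ p - (b p)%:C * (S p + c p * z ^+ p) = - ((b p)%:C * S p) by ring.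
    rewrite ncN normcM ncR ger0_norm ?b0//.
    have -> : B * (2 * b p - b p) = b p * B by ring.
    by rewrite ler_wpM2l ?b0// hS// ltnW.
  have pm' : (p + m < q)%N by move: pm; rewrite addnS; exact: ltnW.
  rewrite addnS big_nat_recr/=; last by lia.
  rewrite SS.
  set T := \sum_(p <= k < (p + m).+1) _.
  have -> : T + (b (p + m).+1)%:C * c (p + m).+1 * z ^+ (p + m).+1 -
     (b (p + m).+1)%:C * (S (p + m).+1 + c (p + m).+1 * z ^+ (p + m).+1) =
     (T - (b (p + m)%N)%:C * S (p + m).+1) + (b (p + m)%N - b (p + m).+1)%:C * S (p + m).+1.
    by rewrite rmorphB/=; ring.
  apply: le_trans (ncD _ _) _.
  have bd : 0 <= b (p + m)%N - b (p + m).+1.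
    by rewrite subr_ge0 bm// ?leq_addr// -addnS.
  have h2 : normc ((b (p + m)%N - b (p + m).+1)%:C * S (p + m).+1) <= (b (p + m)%N - b (p + m).+1) * B.
    by rewrite normcM ncR ger0_norm// ler_wpM2l// hS.
  by apply: le_trans (lerD (IH pm') h2) _; lra.
have := key (q - p.+1)%N; rewrite (_ : (p + (q - p.+1)).+1 = q); last by lia.
have -> : (p + (q - p.+1))%N = q.-1 by lia.
move=> /(_ _) h; have {}h := h (ltac:(lia)).
apply: le_trans (nc_triB _ ((b q.-1)%:C * S q)) _.
have b1 : 0 <= b q.-1 by apply: b0; lia.
have h2 : normc ((b q.-1)%:C * S q) <= b q.-1 * B.
  by rewrite normcM ncR ger0_norm// ler_wpM2l// hS.
by apply: le_trans (lerD h2 h) _; lra.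
Qed.

End Landau.

(** * Construction of the exponents m_j *)

Section BlockSequence.
Context {R : realType}.
Variables (x u : nat -> R).

(* The Bregman divergence of the convex function m |-> max_t (m t + u(t)). *)
Let D (m n : nat) : R := m%:R * (x m - x n) + u m - u n.

Hypothesis D_ge0 : forall m n, (0 < m)%N -> (0 < n)%N -> 0 <= D m n.
Hypothesis x_lt0 : forall n, (0 < n)%N -> x n < 0.
Hypothesis D_unbounded : forall n B, (0 < n)%N -> exists2 m, (n < m)%N & B < D m n.
Hypothesis D_swap_far : forall b1 : R, exists b2 c : R, forall m n,
  (0 < m)%N -> (0 < n)%N -> c <= m%:R -> c <= n%:R -> c <= `|m%:R - n%:R| ->
  D m n <= b1 -> D n m <= b2.

Let DD m n : D m n + D n m = (m%:R - n%:R) * (x m - x n).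
Proof. by rewrite /D; ring. Qed.

Let D3 a b c : D a c = D a b + D b c + (a%:R - b%:R) * (x b - x c).
Proof. by rewrite /D; ring. Qed.

Let x_mono m n : (0 < m)%N -> (m <= n)%N -> x m <= x n.
Proof.
move=> m0; rewrite leq_eqVlt => /predU1P[->//|mn].
have n0 : (0 < n)%N by apply: ltn_trans mn.
have := addr_ge0 (D_ge0 n0 m0) (D_ge0 m0 n0).
by rewrite DD pmulr_rge0 ?subr_gt0 ?ltr_nat// subr_ge0.
Qed.

Let D_swap (b1 : R) : exists (b2 : R) (c : nat), forall m n,
  (0 < m)%N -> (0 < n)%N -> (c <= m)%N -> (c <= n)%N -> D m n <= b1 -> D n m <= b2.
Proof.
have [b2 [c hb]] := D_swap_far b1.
pose Y := - x 1%N; have Y0 : 0 < Y by rewrite oppr_gt0 x_lt0.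
pose c' := Num.truncn `|c|.
have cc' : c <= c'.+1%:R by apply: le_trans (ler_norm _) _; apply/ltW/truncnS_gt.
exists (Num.max b2 (`|c| * Y)), c'.+1 => m n m0 n0 cm cn Dmn.
have [h|h] := leP c `|m%:R - n%:R|.
  rewrite le_max; apply/orP; left; apply: hb => //.
    by apply: le_trans cc' _; rewrite ler_nat.
  by apply: le_trans cc' _; rewrite ler_nat.
rewrite le_max; apply/orP; right.
apply: (@le_trans _ _ (D m n + D n m)); first by rewrite lerDr D_ge0.
rewrite DD; apply: le_trans (ler_norm _) _; rewrite normrM; apply: ler_pM => //.
  by apply: le_trans (ltW h) _; exact: ler_norm.
have := x_lt0 m0; have := x_lt0 n0.
have := @x_mono 1 m isT m0; have := @x_mono 1 n isT n0.
by rewrite /Y ler_norml => *; apply/andP; split; lra.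
Qed.

(** Greedy choice: the successor of n is the least m > n with D m n > B. As B is at least the swap
    bound of b, D n m cannot be below b either. Minimality bounds D at m - 1, and from this the
    ratio m / n is bounded. *)
Lemma block_sequence (b : R) : 0 < b -> exists (ms : nat -> nat) (K : nat),
  [/\ (1 < ms 0)%N, forall j, (ms j < ms j.+1)%N,
      forall j, (ms j.+1 <= K * ms j)%N,
      forall j, b <= D (ms j.+1) (ms j) &
      forall j, b <= D (ms j) (ms j.+1)].
Proof.
move=> b0.
have [b2 [c2 hb2]] := D_swap b.
pose B := Num.max b2 b.
have B2 : b2 <= B by rewrite le_max lexx.
have Bb : b <= B by rewrite le_max lexx orbT.
clearbody B.
have B0 : 0 < B by apply: lt_le_trans Bb.
(* At n = 0 any m > 0 is accepted, which makes [next] total; the sequence never visits 0. *)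
have ex n : exists m, (n < m)%N && ((n == 0)%N || (B < D m n)).
  case: n => [|n]; first by exists 1%N.
  by have [m nm Bm] := @D_unbounded n.+1 B isT; exists m; rewrite nm Bm.
pose next n := ex_minn (ex n).
have next_gt n : (n < next n)%N by rewrite /next; case: ex_minnP => m /andP[].
have next_D n : (0 < n)%N -> B < D (next n) n.
  by rewrite /next; case: ex_minnP => m /andP[_ /orP[/eqP->|]].
have next_min n p : (0 < n)%N -> (n < p)%N -> (p < next n)%N -> D p n <= B.
  move=> n0 np; rewrite /next; case: ex_minnP => m _ hm pm.
  rewrite leNgt; apply/negP => BD.
  by have := hm p; rewrite np BD orbT => /(_ isT); rewrite leqNgt pm.
pose Y := - x 1%N.
have Y0 : 0 < Y by rewrite oppr_gt0 x_lt0.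
(* Passing from m to m + 1 raises D m n by x (m + 1) - x n - D m (m + 1), which is at most - x n <=
   Y. *)
have next_ub n : (0 < n)%N -> D (next n) n <= B + Y.
  move=> n0; have nn := next_gt n.
  have [m mE] : exists m, next n = m.+1 by case: (next n) nn => [//|m] _; exists m.
  have nm : (n <= m)%N by rewrite -ltnS -mE.
  have m0 : (0 < m)%N by apply: leq_trans nm.
  have Dm : D m n <= B.
    move: nm; rewrite leq_eqVlt => /predU1P[<-|nm].
      by rewrite /D subrr mulr0 add0r subrr ltW.
    by apply: next_min => //; rewrite mE.
  have -> : D (next n) n = D m n + (x m.+1 - x n) - D m m.+1.
    by rewrite mE /D -natr1; ring.
  have := @D_ge0 m m.+1 m0 isT; have := @x_lt0 m.+1 isT.
  have := @x_mono 1 n isT n0; rewrite /Y; lra.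
have [b3 [c3 hb3]] := D_swap (B + Y).
have [b4 [c4 hb4]] := D_swap B.
pose S := B + b4.
have [b6 [c6 hb6]] := D_swap (b3 + b4 + S).
pose m0 := (c2 + c3 + c4 + c6 + 2)%N.
pose ms j := iter j next m0.
have msS j : ms j.+1 = next (ms j) by [].
have ms_ge j : (m0 <= ms j)%N.
  by elim: j => // j IH; rewrite msS; apply: leq_trans IH _; apply/ltnW/next_gt.
have ge c j : (c <= m0)%N -> (c <= ms j)%N by move=> h; exact: leq_trans (ms_ge j).
have ms0 j : (0 < ms j)%N by apply: ge; rewrite /m0; lia.
have hc2 : (c2 <= m0)%N by rewrite /m0; lia.
have hc3 : (c3 <= m0)%N by rewrite /m0; lia.
have hc4 : (c4 <= m0)%N by rewrite /m0; lia.
have hc6 : (c6 <= m0)%N by rewrite /m0; lia.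
have up j : b <= D (ms j.+1) (ms j) by apply: le_trans Bb _; apply/ltW/next_D.
have dn j : b <= D (ms j) (ms j.+1).
  rewrite leNgt; apply/negP => h.
  have := hb2 (ms j) (ms j.+1) (ms0 _) (ms0 _) (ge _ _ hc2) (ge _ _ hc2) (ltW h).
  by rewrite leNgt (le_lt_trans B2)// next_D.
pose K0 := Num.truncn (2 + `|b6| / b).
pose K := (K0.+1 + 2 + ms 1)%N.
exists ms, K; split => //.
  by rewrite /ms/= /m0; lia.
(* The ratio bound uses the predecessor of n; the first ratio, which has none, is covered by the
   summand [ms 1] of K. *)
move=> [|j].
  have : (ms 1 * 1 <= ms 1 * ms 0)%N by rewrite leq_mul2l ms0 orbT.
  by rewrite /K mulnDl muln1; lia.
set n' := ms j; set n := ms j.+1; set m := ms j.+2.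
have n'0 : (0 < n')%N by exact: ms0.
have n0 : (0 < n)%N by exact: ms0.
have n'n : (n' < n)%N by exact: next_gt.
have nm : (n < m)%N by exact: next_gt.
have [m2|m2] := leqP m (2 * n).
  by apply: leq_trans m2 _; rewrite leq_mul2r /K; apply/orP; right; lia.
(* At p = m - 1 both D p n and D n p are bounded. The three-point identity [D3] transports the bound
   to D n' p, a swap to D p n', and [D3] again to (p - n)(x n - x n'). Since n (x n - x n') >= b,
   this gives p - n = O(n). *)
have [p mE] : exists p, m = p.+1 by case: (m) nm => [//|p] _; exists p.
have pn : (2 * n <= p)%N by rewrite -ltnS -mE.
have np : (n < p)%N by lia.
have p0 : (0 < p)%N by lia.
have gep c : (c <= m0)%N -> (c <= p)%N.
  by move=> h; apply: leq_trans (ltnW np); exact: ge.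
have Dpn : D p n <= B by apply: next_min => //; rewrite -msS -/m mE.
have Dnp : D n p <= b4 := hb4 p n p0 n0 (gep _ hc4) (ge _ _ hc4) Dpn.
have DS : (p%:R - n%:R) * (x p - x n) <= S by rewrite -DD /S lerD.
have xnp : x n <= x p by apply: x_mono => //; exact: ltnW.
have N0 : 0 < n%:R :> R by rewrite ltr0n.
have N'0 : 0 < n'%:R :> R by rewrite ltr0n.
have P2 : 2 * n%:R <= p%:R :> R by rewrite -natrM ler_nat.
have nS : n%:R * (x p - x n) <= S.
  by apply: le_trans DS; rewrite ler_wpM2r ?subr_ge0//; lra.
have NN' : n'%:R < n%:R :> R by rewrite ltr_nat.
have Dn'n : D n' n <= b3.
  by apply: hb3 => //; [exact: ge|exact: ge|exact: next_ub].
have Dn'p : D n' p <= b3 + b4 + S.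
  rewrite (D3 n' n p) lerD ?lerD//.
  apply: le_trans nS.
  have -> : (n'%:R - n%:R) * (x n - x p) = (n%:R - n'%:R) * (x p - x n) by ring.
  by rewrite ler_wpM2r ?subr_ge0//; lra.
have Dpn' : D p n' <= b6 by apply: hb6 => //; [exact: ge|exact: gep].
have xnn' : x n' <= x n by apply: x_mono => //; exact: ltnW.
have h1 : (p%:R - n%:R) * (x n - x n') <= b6.
  apply: le_trans Dpn'; rewrite (D3 p n n') lerDr addr_ge0// D_ge0//.
have h2 : b <= n%:R * (x n - x n').
  apply: le_trans (dn j) _; apply: le_trans (_ : D (ms j) (ms j.+1) + D (ms j.+1) (ms j) <= _).
    by rewrite lerDl D_ge0.
  rewrite DD -/n -/n'.
  have -> : (n'%:R - n%:R) * (x n' - x n) = (n%:R - n'%:R) * (x n - x n') by ring.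
  by rewrite ler_wpM2r ?subr_ge0//; lra.
have h3 : (p%:R - n%:R) * b <= n%:R * `|b6|.
  apply: le_trans (_ : (p%:R - n%:R) * (n%:R * (x n - x n')) <= _).
    by rewrite ler_wpM2l//; lra.
  rewrite mulrCA ler_wpM2l ?(ltW N0)//.
  by apply: le_trans h1 _; exact: ler_norm.
have h4 : p%:R - n%:R <= n%:R * (`|b6| / b) by rewrite mulrA ler_pdivlMr.
have h5 : m%:R <= n%:R * (2 + `|b6| / b).
  rewrite mE -natr1 mulrDr; have : 1 <= n%:R :> R by rewrite ler1n.
  by move: h4; lra.
have h6 : m%:R <= n%:R * K0.+1%:R :> R.
  by apply: le_trans h5 _; rewrite ler_wpM2l ?(ltW N0)//; apply/ltW/truncnS_gt.
move: h6; rewrite -natrM ler_nat mulnC => /leq_trans; apply.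
by rewrite leq_mul2r /K -addnA leq_addr orbT.
Qed.

End BlockSequence.

(** * Blocks for a weight with condition (B) *)

Section WeightSequence.
Context {R : realType}.
Variable v : weight R.

Lemma weight_ext_gt0 (s : R) : 0 <= s < 1 -> 0 < weight_ext v s.
Proof.
move=> /andP[s0 s1]; rewrite /weight_ext s1; apply: weight_gt0.
by rewrite /disc/= ncR ger0_norm.
Qed.

(** The function r^m v(r) vanishes at 0 and 1 but not at 1/2; an interior maximum point is what
    allows taking logarithms. *)
Lemma argmax_itv (m r : R) : 0 < m -> is_argmax v m r -> 0 < r < 1.
Proof.
move=> m0 [/andP[r0 r1] h].
have h2 : 0 < (2^-1 : R) `^ m * weight_ext v 2^-1.
  by rewrite mulr_gt0 ?powR_gt0// weight_ext_gt0//; lra.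
have h3 : 0 < r `^ m * weight_ext v r.
  by apply: lt_le_trans h2 _; apply: h; lra.
rewrite !lt_neqAle r0 r1 !andbT; apply/andP; split.
  apply/eqP => r00; move: h3; rewrite -r00 powR0 ?mul0r ?ltxx//.
  by rewrite gt_eqF.
by apply/eqP => r11; move: h3; rewrite /weight_ext r11 ltxx mulr0 ltxx.
Qed.

Lemma argmax_ln (m r s : R) : 0 < m -> is_argmax v m r -> 0 < s < 1 ->
  m * ln s + ln (weight_ext v s) <= m * ln r + ln (weight_ext v r).
Proof.
move=> m0 hr /andP[s0 s1]; have /andP[r0 r1] := argmax_itv m0 hr.
have ws : 0 < weight_ext v s by rewrite weight_ext_gt0// ltW.
have wr : 0 < weight_ext v r by rewrite weight_ext_gt0// ltW.
rewrite -!ln_powR -!lnM ?posrE ?powR_gt0// ler_ln ?posrE ?mulr_gt0 ?powR_gt0//.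
by case: hr => _; apply; rewrite !ltW.
Qed.

(** The threshold ln 2 says that r^(m_j) v(r), divided by its maximum, is at most 1/2 at the
    neighbouring maximum points; this is the source of the ratio 1/2 in the block sums. *)
Lemma weight_blocks : condB v -> exists (rho : nat -> R) (ms : nat -> nat) (K : nat),
  [/\ (1 < ms 0)%N, forall j, (ms j < ms j.+1)%N,
      forall j, (ms j.+1 <= K * ms j)%N,
      forall j, is_argmax v (ms j)%:R (rho j) &
      let x j := ln (rho j) in let u j := ln (weight_ext v (rho j)) in
      forall j, ln 2 <= (ms j.+1)%:R * (x j.+1 - x j) + u j.+1 - u j /\
        ln 2 <= (ms j)%:R * (x j - x j.+1) + u j - u j.+1].
Proof.
move=> [rho hrho hB].
pose x (n : nat) := ln (rho n%:R); pose u (n : nat) := ln (weight_ext v (rho n%:R)).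
have r01 n : (0 < n)%N -> 0 < rho n%:R < 1.
  by move=> n0; apply: argmax_itv (hrho _ _); rewrite ltr0n.
have w0 n : (0 < n)%N -> 0 < weight_ext v (rho n%:R).
  by move=> /r01 /andP[h1 h2]; rewrite weight_ext_gt0// ltW.
have Dge m n : (0 < m)%N -> (0 < n)%N -> 0 <= m%:R * (x m - x n) + u m - u n.
  move=> m0 n0; have mR : 0 < m%:R :> R by rewrite ltr0n.
  have := argmax_ln mR (hrho _ mR) (r01 n n0).
  rewrite -/(x m) -/(x n) -/(u m) -/(u n); lra.
have xlt n : (0 < n)%N -> x n < 0.
  by move=> /r01 /andP[h1 h2]; rewrite ln_lt0// h1.
have unb n B : (0 < n)%N -> exists2 m, (n < m)%N & B < m%:R * (x m - x n) + u m - u n.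
  move=> n0; have /andP[h1 h2] := r01 n n0.
  (* Testing the maximum for the exponent m at a point s > r_n gives D m n >= m (ln s - x n) +
     const, unbounded in m. *)
  pose s := (1 + rho n%:R) / 2.
  have s01 : 0 < s < 1 by rewrite /s; lra.
  have xs : 0 < ln s - x n.
    rewrite subr_gt0 ltr_ln ?posrE//; last by case/andP: s01.
    by rewrite /s; lra.
  pose A := (`|B| + `|u n| + `|ln (weight_ext v s)|) / (ln s - x n).
  have A0 : 0 <= A by apply: divr_ge0; [rewrite !addr_ge0|exact: ltW].
  pose m := (n + (Num.truncn A).+1)%N.
  have m0 : (0 < m)%N by rewrite /m addnS.
  exists m; first by rewrite /m addnS ltnS leq_addr.
  have mR : 0 < m%:R :> R by rewrite ltr0n.
  have := argmax_ln mR (hrho _ mR) s01; rewrite -/(x m) -/(u m).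
  have : A < m%:R by apply: lt_le_trans (truncnS_gt A) _; rewrite ler_nat /m leq_addl.
  rewrite /A ltr_pdivrMr//.
  have := ler_norm B; have := ler_norm (u n).
  have := ler_norm (- ln (weight_ext v s)); rewrite normrN.
  nra.
have sw (b1 : R) : exists b2 c : R, forall m n,
    (0 < m)%N -> (0 < n)%N -> c <= m%:R -> c <= n%:R -> c <= `|m%:R - n%:R| ->
    m%:R * (x m - x n) + u m - u n <= b1 -> n%:R * (x n - x m) + u n - u m <= b2.
  have [|b2 b21 [c c0 hc]] := hB (expR (Num.max b1 1)).
    by rewrite expR_gt1 lt_max ltr01 orbT.
  exists (ln b2), c => m n m0 n0 cm cn cmn h.
  have mR : 0 < m%:R :> R by rewrite ltr0n.
  have nR : 0 < n%:R :> R by rewrite ltr0n.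
  have E a b : (0 < a)%N -> (0 < b)%N ->
      (rho a%:R / rho b%:R) `^ a%:R * (weight_ext v (rho a%:R) / weight_ext v (rho b%:R)) =
      expR (a%:R * (x a - x b) + u a - u b).
    move=> a0 b0; have /andP[ra _] := r01 a a0; have /andP[rb _] := r01 b b0.
    have wa := w0 a a0; have wb := w0 b b0.
    have p1 : 0 < (rho a%:R / rho b%:R) `^ a%:R by rewrite powR_gt0// divr_gt0.
    have p2 : 0 < weight_ext v (rho a%:R) / weight_ext v (rho b%:R) by rewrite divr_gt0.
    have p12 := mulr_gt0 p1 p2.
    rewrite -(lnK p12); apply/(congr1 expR).
    rewrite lnM ?posrE// ln_powR !ln_div ?posrE// addrA//.
  have := hc _ _ mR nR; rewrite !E// => /(_ _ cm cn cmn) h'.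
  rewrite -ler_expR lnK ?posrE ?(lt_trans ltr01)//; apply: h'.
  by rewrite ler_expR; apply: le_trans h _; rewrite le_max lexx.
have l2 : 0 < ln 2 :> R by rewrite ln_gt0// ltr1n.
have [ms [K [h1 h2 h3 h4 h5]]] := block_sequence Dge xlt unb sw l2.
exists (fun j => rho (ms j)%:R), ms, K; split => //.
move=> j; apply: hrho; rewrite ltr0n.
by elim: j => [|j IH]; [exact: ltnW|exact: ltn_trans (h2 j)].
Qed.

End WeightSequence.

(** * The multiplier estimate *)

Section Multiplier.
Context {R : realType}.
Variable v : weight R.
Implicit Types (c : nat -> R[i]) (h : R[i] -> R[i]) (z l : R[i]) (H : R).

Let w := weight_ext v.

Definition wbounded h H := forall z, normc z < 1 -> normc (h z) * w (normc z) <= H.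

(** Cut off without shifting, so that one estimate covers whole multipliers (N = 0) and their
    tails. *)
Definition tail_from (N : nat) (b : nat -> R) k : R := if (N <= k)%N then b k else 0.

(** With truncated subtraction [(J - i) + (i - J)] is |J - i|; the indices J >= i contribute at most
    2, those below i at most 1 - 2^-i. *)
Lemma sum_two_sided (i n : nat) :
  \sum_(J < n) (2^-1 : R) ^+ ((J - i) + (i - J)) <= 3 - 2^-1 ^+ i.
Proof.
elim: i n => [|i IH] n.
  have : \sum_(J < n) (2^-1 : R) ^+ ((J - 0) + (0 - J)) <= 2 - 2 * 2^-1 ^+ n.
    elim: n => [|n IH]; first by rewrite big_ord0 expr0; lra.
    rewrite big_ord_recr/= subn0 sub0n addn0 exprS; lra.
  have : 0 <= (2^-1 : R) ^+ n by rewrite exprn_ge0.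
  by rewrite expr0; lra.
case: n => [|n].
  rewrite big_ord0 subr_ge0; apply: (@le_trans _ _ 1); last by lra.
  by rewrite exprn_ile1//; lra.
rewrite big_ord_recl/= sub0n subn0 add0n.
have -> : \sum_(i0 < n) (2^-1 : R) ^+ (bump 0 i0 - i.+1 + (i.+1 - bump 0 i0)) =
  \sum_(J < n) 2^-1 ^+ ((J - i) + (i - J)).
  by apply: eq_bigr => J _; rewrite /bump add1n !subSS.
by have := IH n; rewrite exprS; lra.
Qed.

(** The constant is 2 from Abel summation times 3 from Landau. The loss lg q is at most A lg p',
    where p' = max(p, N) is the index at which the tail enters the block, and b p' * lg p' <= Kb. *)
Lemma block_bound c h H (b : nat -> R) (N p q : nat) (A Kb : R) :
  pseries c h 1 -> wbounded h H -> (p < q)%N -> lg q <= A * (lg p : R) -> 0 <= A ->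
  (forall k, (N <= k)%N -> b k.+1 <= b k) ->
  (forall k, (N <= k)%N -> 0 <= b k) ->
  (forall k, (N <= k)%N -> b k * lg k <= Kb) -> 0 <= Kb ->
  forall z, 0 < normc z < 1 ->
  normc (\sum_(p <= k < q) (tail_from N b k)%:C * c k * z ^+ k) <= 6 * A * Kb * (H / w (normc z)).
Proof.
move=> hc hH pq lpq A0 bm b0 bl Kb0 z z01.
have /andP[z0 z1] := z01.
have w0 : 0 < w (normc z) by apply: weight_ext_gt0; rewrite ltW.
have hM y : normc y = normc z -> normc (h y) <= H / w (normc z).
  by move=> yz; rewrite ler_pdivlMr// -yz hH// yz.
have M0 : 0 <= H / w (normc z) by apply: le_trans (hM z erefl); exact: normc_ge0.
pose p' := maxn p N.
have [qp|pq'] := leqP q p'.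
  rewrite big_nat big1 ?normc0; first by rewrite (mulr_ge0 _ M0)// !mulr_ge0.
  move=> k /andP[pk kq].
  rewrite /tail_from ifF ?mul0r//; apply/negbTE; rewrite -ltnNge.
  by move: qp; rewrite /p'; lia.
have -> : \sum_(p <= k < q) (tail_from N b k)%:C * c k * z ^+ k =
    \sum_(p' <= k < q) (b k)%:C * c k * z ^+ k.
  rewrite (@big_cat_nat _ _ _ p')/=; [|exact: leq_maxl|exact: ltnW].
  rewrite [X in X + _]big_nat big1 ?add0r => [|k /andP[pk kp]].
    apply: eq_big_nat => k /andP[pk _]; rewrite /tail_from ifT//.
    by apply: leq_trans pk; exact: leq_maxr.
  rewrite /tail_from ifF ?mul0r//; apply/negbTE; rewrite -ltnNge.
  by move: kp; rewrite /p'; lia.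
have Np : (N <= p')%N by exact: leq_maxr.
have := @abel_block _ c b (3 * lg q * (H / w (normc z))) z p' q pq'.
move=> /(_ _ _ _)/le_trans; apply.
- by move=> k pk _; apply: bm; exact: leq_trans pk.
- by move=> k pk _; apply: b0; exact: leq_trans pk.
- move=> n nq; apply: le_trans (pseries_trunc hc z01 hM n (erefl _)) _.
  by rewrite ler_wpM2r// ler_wpM2l// ler_lg.
have -> : 2 * b p' * (3 * lg q * (H / w (normc z))) = 6 * (b p' * lg q) * (H / w (normc z)) by ring.
rewrite ler_wpM2r// -mulrA ler_wpM2l//.
apply: le_trans (_ : b p' * (A * lg p') <= _).
  rewrite ler_wpM2l ?b0//; apply: le_trans lpq _; rewrite ler_wpM2l//.
  by apply: ler_lg; exact: leq_maxl.
by rewrite mulrCA ler_wpM2l// bl.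
Qed.

Lemma w_noninc (r s : R) : 0 < r -> r <= s -> s < 1 -> w s <= w r.
Proof.
move=> r0; rewrite le_eqVlt => /predU1P[->//|rs] s1.
by rewrite /w /weight_ext s1 (lt_trans rs s1); exact: weight_noninc.
Qed.

(** At |z| = r with rho_(i-1) <= r < rho_i, a block J >= i is compared with the circle of radius
    rho_J outside it (Schwarz decay), and a block J < i - 1 with the circle of radius rho_(J+1)
    inside it (growth). Both factors are values of normalized weights and decay like 2^-|J - i|. *)
Lemma multiplier_bound : condB v -> exists2 C : R, 0 <= C &
  forall c h H (b : nat -> R) N Kb,
  pseries c h 1 -> wbounded h H ->
  (forall k, (N <= k)%N -> b k.+1 <= b k) ->
  (forall k, (N <= k)%N -> 0 <= b k) ->
  (forall k, (N <= k)%N -> b k * lg k <= Kb) ->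
  forall z l, normc z < 1 ->
  hassum (fun k => (tail_from N b k)%:C * c k * z ^+ k) l ->
  normc l * w (normc z) <= C * Kb * H.
Proof.
move=> /weight_blocks [rho [ms [K [ms0 msS msK hrho]]]].
set x := fun j => ln (rho j); set u := fun j => ln (weight_ext v (rho j)) => /= hD.
have l2 : 0 < ln 2 :> R by rewrite ln_gt0// ltr1n.
have lg0 : lg 0 = ln 2 :> R by [].
have msmono i j : (i <= j)%N -> (ms i <= ms j)%N.
  by apply: (homo_leq (r := leq)) => // [? ? ?|k]; [exact: leq_trans|exact: ltnW].
have msj j : (j <= ms j)%N.
  by elim: j => // j IH; apply: leq_ltn_trans IH (msS j).
have ms1 j : (1 < ms j)%N by apply: leq_trans ms0 (msmono _ _ (leq0n j)).
have mR j : 0 < (ms j)%:R :> R by rewrite ltr0n; exact: ltnW.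
have r01 j : 0 < rho j < 1 by exact: argmax_itv (mR j) (hrho j).
have K0 : (0 < K)%N.
  by case: (K) (msK 0%N) => // hh; have := msS 0%N; rewrite ltnNge (leq_trans hh).
(* The last summand serves the initial block, which starts at lg 0 = ln 2; the others come from
   m_(j+1) <= K m_j. *)
pose A : R := ln K%:R / ln 2 + 1 + lg (ms 0) / ln 2.
have lK0 : 0 <= ln K%:R :> R by rewrite ln_ge0// ler1n.
have A1 : 1 <= A.
  have q1 : 0 <= ln K%:R / ln 2 :> R by rewrite divr_ge0// ltW.
  have q2 : 0 <= lg (ms 0) / ln 2 :> R by rewrite divr_ge0// ltW// lg_gt0.
  by rewrite /A; lra.
have A0 : 0 <= A by apply: le_trans A1.
have lgA j : lg (ms j.+1) <= A * lg (ms j) :> R.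
  have h1 : lg (ms j.+1) <= ln K%:R + lg (ms j) :> R.
    rewrite /lg -lnM ?posrE ?ltr0n// ler_ln ?posrE ?mulr_gt0 ?ltr0n// -natrM ler_nat.
    by have := msK j; nia.
  have h2 : ln 2 <= lg (ms j) :> R by rewrite -lg0 ler_lg.
  have h3 : ln K%:R <= ln K%:R / ln 2 * lg (ms j) :> R.
    by rewrite mulrAC ler_pdivlMr// ler_wpM2l.
  have h4 : 0 <= lg (ms 0) / ln 2 * lg (ms j) :> R.
    by rewrite mulr_ge0 ?divr_ge0 ?(ltW l2)// ltW// lg_gt0.
  by rewrite /A !mulrDl mul1r; lra.
have lgA0 : lg (ms 0) <= A * lg 0 :> R.
  have l2' : ln 2 != 0 :> R by rewrite gt_eqF.
  by rewrite lg0 /A !mulrDl !divfK// mul1r; move: lK0 l2; lra.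
clearbody A.
exists (78 * A); first by rewrite mulr_ge0.
move=> c h H b N Kb hc hH bm b0 bl z l z1 hl.
have Kb0 : 0 <= Kb.
  by apply: le_trans (bl N (leqnn N)); rewrite mulr_ge0 ?b0// ltW// lg_gt0.
have w0 s : 0 <= s < 1 -> 0 < w s by exact: weight_ext_gt0.
have H0 : 0 <= H.
  apply: le_trans (hH 0 _); rewrite normc0// mulr_ge0 ?normc_ge0// ltW// w0//.
  by rewrite lexx ltr01.
pose T := 6 * A * Kb * H.
have T0 : 0 <= T by rewrite !mulr_ge0.
have -> : 78 * A * Kb * H = 13 * T by rewrite /T; ring.
pose g k := (tail_from N b k)%:C * c k.
(* Landau's theorem needs a circle of positive radius; at the origin only the constant term
   remains. *)
have [zz|z0] := eqVneq z 0.
  have -> : l = g 0%N.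
    apply: hassum_unique hl _ => e e0; exists 1%N => -[//|n] _.
    rewrite big_nat_recl//= expr0 mulr1 big1 ?addr0 ?subrr ?normc0// => k _.
    by rewrite zz expr0n/= mulr0.
  have h0 : h 0 = c 0%N by apply: pseries_at0 hc.
  have := hH 0; rewrite normc0 => /(_ ltr01); rewrite h0 => hh.
  rewrite zz normc0 /g normcM ncR -mulrA.
  have t0 : `|tail_from N b 0| <= 2 * Kb.
    rewrite /tail_from; case: ifPn => N0; last by rewrite normr0 mulr_ge0.
    rewrite ger0_norm ?b0//; have := bl 0%N N0; rewrite lg0.
    have l12 : 2^-1 <= ln 2 :> R.
      have := @le_ln1Dx R (- 2^-1); rewrite (_ : 1 + - 2^-1 = 2^-1); last by field.
      by rewrite lnV ?posrE// => h12; rewrite -lerN2; apply: h12; lra.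
    have := b0 0%N N0; nra.
  apply: le_trans (ler_pM _ _ t0 hh) _ => //; first by rewrite mulr_ge0 ?normc_ge0// ltW// w0// lexx ltr01.
  rewrite /T; have : 0 <= Kb * H by rewrite mulr_ge0.
  by nra.
have {z0}z0 : 0 < normc z by rewrite nc_gt0.
set r := normc z in z0 z1 *.
have wr0 : 0 < w r by rewrite w0// ltW.
have u0 j : 0 < w (rho j) by have /andP[h1 h2] := r01 j; rewrite w0// ltW.
(* The logarithm of r^(m_j) v(r) divided by its maximum. *)
pose e j := (ms j)%:R * (ln r - x j) + ln (w r) - u j.
have e_le0 j : e j <= 0.
  have := argmax_ln (mR j) (hrho j) (_ : 0 < r < 1); rewrite z0 z1 => /(_ isT).
  by rewrite /e /x /u /w; lra.
have ms_lt j : (ms j)%:R < (ms j.+1)%:R :> R by rewrite ltr_nat.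
have xmono j : x j <= x j.+1.
  have [h1 h2] := hD j; have := ms_lt j; have := l2.
  by rewrite leNgt => *; apply/negP => ?; nra.
have eR j : expR (e j) = (r / rho j) ^+ ms j * (w r / w (rho j)).
  have /andP[ra _] := r01 j.
  have p1 : 0 < r / rho j by rewrite divr_gt0.
  rewrite -[RHS]lnK ?posrE ?mulr_gt0 ?exprn_gt0 ?invr_gt0//; congr expR.
  rewrite lnM ?posrE ?exprn_gt0 ?divr_gt0// lnXn// !ln_div ?posrE//.
  by rewrite /e /x /u mulr_natl addrA.
(* Otherwise every rho_j is at most r, and comparison with a point s > r bounds all m_j. *)
have [i0 hi0] : exists i, r < rho i.
  apply: contrapT => /forallNP hn.
  have hge j : rho j <= r by rewrite leNgt; apply/negP/hn.
  pose s := (1 + r) / 2.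
  have s01 : 0 < s < 1 by rewrite /s; lra.
  have rs : 0 < ln s - ln r by rewrite subr_gt0 ltr_ln ?posrE//; [rewrite /s; lra|case/andP: s01].
  have rho0 j : rho 0 <= rho j.
    have /andP[ra _] := r01 0%N; have /andP[rb _] := r01 j.
    rewrite -ler_ln ?posrE// -/(x 0%N) -/(x j).
    by elim: j {rb} => // j IH; apply: le_trans IH (xmono j).
  pose X := (ln (w (rho 0%N)) - ln (w s)) / (ln s - ln r).
  have := truncnS_gt X; set j := (Num.truncn X).+1; apply/negP; rewrite -leNgt.
  apply: (@le_trans _ _ (ms j)%:R); first by rewrite ler_nat.
  rewrite /X ler_pdivlMr//.
  have := argmax_ln (mR j) (hrho j) s01.
  have h1 : ln (weight_ext v (rho j)) <= ln (w (rho 0%N)).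
    have /andP[ra _] := r01 0%N; have /andP[rb rc] := r01 j.
    by rewrite ler_ln ?posrE ?u0//; apply: w_noninc.
  have h2 : (ms j)%:R * ln (rho j) <= (ms j)%:R * ln r.
    by rewrite ler_wpM2l// ler_ln ?posrE//; case/andP: (r01 j).
  by rewrite /w; rewrite /w in h1; lra.
have [i hi imin] : exists2 i, r < rho i & forall j, (j < i)%N -> rho j <= r.
  have ex : exists i, r < rho i by exists i0.
  case: (ex_minnP ex) => i ri hmin; exists i => // j ji.
  by rewrite leNgt; apply/negP => /hmin; rewrite leqNgt ji.
(* Here e_(j+1) - e_j = (m_(j+1) - m_j)(ln r - x_j) - D(m_(j+1), m_j), and ln r <= x_j for j >= i;
   [e_dn] is the mirror image. *)
have e_up k : e (i + k)%N <= - (k%:R * ln 2).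
  elim: k => [|k IH]; first by rewrite addn0 mul0r oppr0.
  have [h1 _] := hD (i + k)%N.
  have xr : ln r <= x (i + k)%N.
    have : x i <= x (i + k)%N by elim: (k) => [|k' IH']; rewrite ?addn0// addnS; exact: le_trans (xmono _).
    apply: le_trans; have /andP[ra _] := r01 i.
    by rewrite ler_ln ?posrE// ltW.
  have := ms_lt (i + k)%N; rewrite addnS /e -natr1 => h2.
  by move: IH; rewrite /e; nra.
have e_dn k j : (j + k).+1 = i -> e j <= - (k%:R * ln 2).
  elim: k j => [|k IH] j ji; first by rewrite mul0r oppr0.
  have := IH j.+1; rewrite addSnnS => /(_ ji).
  have [_ h1] := hD j.
  have xr : x j.+1 <= ln r.
    have /andP[ra _] := r01 j.+1.
    by rewrite ler_ln ?posrE//; apply: imin; rewrite -ji; clear; lia.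
  have := ms_lt j; rewrite /e -(natr1 k) => h2 h3.
  nra.
pose Q J (y : R[i]) := \sum_(ms J <= k < ms J.+1) g k * y ^+ k.
have E1 J : normc (Q J z) * w r <= T.
  rewrite -ler_pdivlMr// (_ : T / w r = 6 * A * Kb * (H / w r)); last by rewrite /T !mulrA.
  by apply: (block_bound hc hH) => //; rewrite -/r z0 z1.
have blk J j : forall y, normc y = rho j -> normc (Q J y) <= T / w (rho j).
  move=> y yr; have -> : T / w (rho j) = 6 * A * Kb * (H / w (normc y)) by rewrite yr /T !mulrA.
  by apply: (block_bound hc hH) => //; rewrite yr r01.
have E2 J : r <= rho J -> normc (Q J z) * w r <= T * expR (e J).
  move=> rJ; have /andP[ra _] := r01 J.
  have := poly_low_decay (ltnW (msS J)) ra rJ (blk J J); rewrite -/r => hh.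
  apply: le_trans (ler_wpM2r (ltW wr0) hh) _.
  by rewrite eR le_eqVlt; apply/orP; left; apply/eqP; ring.
have E3 J : rho J.+1 <= r -> normc (Q J z) * w r <= T * expR (e J.+1).
  move=> rJ; have /andP[ra _] := r01 J.+1.
  have := poly_high_growth ra rJ (blk J J.+1); rewrite -/r => hh.
  apply: le_trans (ler_wpM2r (ltW wr0) hh) _.
  by rewrite eR le_eqVlt; apply/orP; left; apply/eqP; ring.
have pow2 k (t : R) : t <= - (k%:R * ln 2) -> expR t <= 2^-1 ^+ k.
  move=> tk; have -> : 2^-1 ^+ k = expR (- (k%:R * ln 2)) :> R.
    by rewrite expRN expRM_natl lnK ?posrE// exprVn.
  by rewrite ler_expR.
(* The factor 4 pays for two lost indices: growth from rho_(J+1) only yields 2^-(i - J - 2). For J =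
   i - 1 the bound [E1] without decay suffices. *)
have QJ J : normc (Q J z) * w r <= T * (4 * 2^-1 ^+ ((J - i) + (i - J))).
  have [iJ|Ji] := leqP i J.
    rewrite (_ : (i - J = 0)%N) ?addn0; last by clear -iJ; lia.
    have rJ : r <= rho J.
      have /andP[ra _] := r01 J; have /andP[rb _] := r01 i.
      apply: le_trans (ltW hi) _; rewrite -ler_ln ?posrE// -/(x i) -/(x J) -(subnKC iJ).
      by elim: (J - i)%N => [|k' IH']; rewrite ?addn0// addnS; exact: le_trans (xmono _).
    apply: le_trans (E2 J rJ) _; rewrite ler_wpM2l//.
    have := e_up (J - i)%N; rewrite subnKC// => /pow2 => hh.
    apply: le_trans hh _; have : 0 <= (2^-1 : R) ^+ (J - i) by rewrite exprn_ge0.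
    lra.
  rewrite (_ : (J - i = 0)%N) ?add0n; last by clear -Ji; lia.
  have [Ji'|Ji'] := eqVneq J.+1 i.
    apply: le_trans (E1 J) _; rewrite ler_peMr// -Ji' subSn// subnn expr1; lra.
  have hJ : (J.+1 + (i - J.+2)).+1 = i by clear -Ji Ji'; lia.
  apply: le_trans (E3 J _) _; first by apply: imin; clear -Ji Ji'; lia.
  rewrite ler_wpM2l//; apply: le_trans (pow2 _ _ (e_dn _ _ hJ)) _.
  rewrite (_ : (i - J = (i - J.+2).+2)%N); last by clear -Ji Ji'; lia.
  rewrite !exprS; have : 0 <= (2^-1 : R) ^+ (i - J.+2) by rewrite exprn_ge0.
  lra.
have E0 : normc (\sum_(0 <= k < ms 0) g k * z ^+ k) * w r <= T.
  rewrite -ler_pdivlMr// (_ : T / w r = 6 * A * Kb * (H / w r)); last by rewrite /T !mulrA.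
  apply: (block_bound hc hH) => //; [exact: ltnW|by rewrite -/r z0 z1].
have part n : normc (\sum_(0 <= k < ms n) g k * z ^+ k) * w r <=
    T + \sum_(J < n) T * (4 * 2^-1 ^+ ((J - i) + (i - J))).
  elim: n => [|n IH]; first by rewrite big_ord0 addr0.
  rewrite big_ord_recr/= addrA (@big_cat_nat _ _ _ (ms n))//=; last exact: ltnW.
  apply: le_trans (ler_wpM2r (ltW wr0) (ncD _ _)) _.
  by rewrite mulrDl lerD// QJ.
(* Partial sums are controlled at the ends of blocks, which are cofinal. The total 13 T is T for the
   initial block plus 4 * 3 T from [sum_two_sided]. *)
rewrite -ler_pdivlMr//; apply: (hassum_le hl) => n0; exists (ms n0) => //.
rewrite ler_pdivlMr//; apply: le_trans (part n0) _.
rewrite -mulr_sumr -mulr_sumr.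
have := sum_two_sided i n0; have : 0 <= (2^-1 : R) ^+ i by rewrite exprn_ge0.
set S := \sum_(J < n0) _; move=> h1 h2.
have h3 : 4 * S <= 12 by lra.
by apply: le_trans (_ : T + T * 12 <= _); [rewrite lerD2l ler_wpM2l|lra].
Qed.

End Multiplier.

(** * Moments and weighted averages *)

Section Moments.
Context {R : realType}.
Variable v : weight R.
Notation mu := (@lebesgue_measure R).
Notation I01 := (`]0, 1[%classic : set R).
Implicit Types (p n : nat) (g b : R -> R).

Let V : R -> R := radial_part v.

Lemma radial_cont (r : R) : `|r| < 1 -> {for r, continuous V}.
Proof.
move=> r1; have rd : disc (r%:C : Cplx R) by rewrite /disc/= ncR.
apply/cvgrPdist_lt => e e0.
have /cvgrPdist_lt /(_ e e0) /nbhsC_P [d d0 hd] := weight_continuous (w := v) rd.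
apply/nbhs_ballP; exists d => // s; rewrite /ball/= => sr.
by apply: hd; rewrite -rmorphB ncR distrC.
Qed.

Lemma radial_gt0 r : 0 <= r < 1 -> 0 < V r.
Proof.
move=> /andP[r0 r1]; apply: weight_gt0.
by rewrite /disc/= ncR ger0_norm.
Qed.

Lemma I01P r : I01 r <-> 0 < r < 1.
Proof. by rewrite /= in_itv. Qed.

Lemma I01_finite : (lebesgue_measure I01 < +oo)%E.
Proof. by rewrite lebesgue_measure_itv/= lte_fin ltr01 oppr0 adde0 ltry. Qed.

Lemma within_I01_measurable g : (forall r, 0 < r < 1 -> {for r, continuous g}) -> measurable_fun I01 g.
Proof.
move=> h; apply: subspace_continuous_measurable_fun => //.
apply: continuous_in_subspaceT => r; rewrite inE/= in_itv/=; exact: h.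
Qed.

Lemma radial_measurable : measurable_fun I01 V.
Proof.
apply: within_I01_measurable => r /andP[r0 r1]; apply: radial_cont.
by rewrite gtr0_norm.
Qed.

(** By monotonicity V r is at most V s for small s > 0, and continuity at 0 bounds V s. *)
Lemma radial_bounded : exists2 B : R, 0 < B & forall r, 0 < r < 1 -> V r <= B.
Proof.
have c0 : {for 0, continuous V} by apply: radial_cont; rewrite normr0.
have /cvgrPdist_lt /(_ 1 ltr01) /nbhs_ballP [d /= d0 hd] := c0.
have V0 : 0 < V 0 by apply: radial_gt0; rewrite lexx ltr01.
exists (V 0 + 1) => [|r /andP[r0 r1]]; first by rewrite addr_gt0.
pose s := Num.min (d / 2) (r / 2).
have s0 : 0 < s by rewrite lt_min !divr_gt0.
have sr : s < r by rewrite gt_min; apply/orP; right; lra.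
have sd : s < d by rewrite gt_min; apply/orP; left; lra.
apply: le_trans (_ : V s <= _).
  exact: weight_noninc.
have := hd s; rewrite /ball/= sub0r normrN gtr0_norm// => /(_ sd).
by rewrite ltr_norml => /andP[h1 h2]; lra.
Qed.

Definition wmom p : R := \int[mu]_(r in I01) (r ^+ p * V r).

Definition wint p g : R := \int[mu]_(r in I01) (r ^+ p * V r * g r).

Definition wintegrable p g := mu.-integrable I01 (EFin \o (fun r => r ^+ p * V r * g r)).

Lemma wmeasurable p g : measurable_fun I01 g -> measurable_fun I01 (fun r => r ^+ p * V r * g r).
Proof.
move=> mg; apply: measurable_funM => //; apply: measurable_funM; last exact: radial_measurable.
by apply: measurable_funX.
Qed.

Lemma bounded_wintegrable p g (B : R) : measurable_fun I01 g ->
  (forall r, 0 < r < 1 -> `|g r| <= B) -> wintegrable p g.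
Proof.
move=> mg gB; apply: measurable_bounded_integrable => //.
- exact: I01_finite.
- exact: wmeasurable.
have [BV BV0 hBV] := radial_bounded.
exists (BV * `|B|); split; first by rewrite num_real.
move=> M hM r /= /I01P r01; have /andP[r0 r1] := r01.
apply: le_trans (ltW hM); rewrite !normrM -[leRHS]mul1r -mulrA.
have h1 : `|r ^+ p| <= 1 by rewrite normrX exprn_ile1// gtr0_norm// ltW.
have h2 : `|V r| * `|g r| <= BV * `|B|.
  apply: ler_pM => //; first by rewrite gtr0_norm ?hBV// radial_gt0// ltW.
  by apply: le_trans (gB r r01) _; exact: ler_norm.
by apply: ler_pM => //; rewrite mulr_ge0.
Qed.

Lemma wint1 p : wint p (fun=> 1) = wmom p.
Proof. by rewrite /wint /wmom; under eq_Rintegral do rewrite mulr1. Qed.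

Lemma wintegrable1 p : wintegrable p (fun=> 1).
Proof. by apply: (@bounded_wintegrable _ _ 1) => // r _; rewrite normr1. Qed.

Lemma wintD p g b : wintegrable p g -> wintegrable p b ->
  wint p (fun r => g r + b r) = wint p g + wint p b.
Proof.
move=> hg hb; rewrite /wint -RintegralD//.
by apply: eq_Rintegral => r _; rewrite mulrDr.
Qed.

Lemma wintegrableZ p k g : wintegrable p g -> wintegrable p (fun r => k * g r).
Proof.
move=> hg; have := integrableZl (mu := mu) (measurable_itv _) k hg.
apply: eq_integrable => // r _ /=; rewrite -EFinM; congr (_%:E); ring.
Qed.

Lemma wintegrableD p g b : wintegrable p g -> wintegrable p b -> wintegrable p (fun r => g r + b r).
Proof.
move=> hg hb; have := integrableD (mu := mu) (measurable_itv _) hg hb.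
apply: eq_integrable => // r _ /=; rewrite -EFinD; congr (_%:E); ring.
Qed.

Lemma wintZ p k g : wintegrable p g -> wint p (fun r => k * g r) = k * wint p g.
Proof.
move=> hg; rewrite /wint -RintegralZl//.
by apply: eq_Rintegral => r _; ring.
Qed.

Lemma le_wint p g b : wintegrable p g -> wintegrable p b ->
  (forall r, 0 < r < 1 -> g r <= b r) -> wint p g <= wint p b.
Proof.
move=> hg hb gb; apply: le_Rintegral => // r /I01P r01.
rewrite ler_wpM2l ?gb//; have /andP[r0 r1] := r01.
by rewrite mulr_ge0 ?exprn_ge0 ?(ltW r0)// ltW// radial_gt0// ltW.
Qed.

Lemma wint_norm p g : wintegrable p g -> `|wint p g| <= wint p (fun r => `|g r|).
Proof.
move=> hg; apply: le_trans (le_normr_Rintegral _ hg) _ => //.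
rewrite le_eqVlt; apply/orP; left; apply/eqP; apply: eq_Rintegral => r.
rewrite inE => /I01P /andP[r0 r1].
rewrite normrM ger0_norm// mulr_ge0 ?exprn_ge0 ?(ltW r0)// ltW// radial_gt0// ltW//.
Qed.

Lemma wintegrable_norm p g : wintegrable p g -> wintegrable p (fun r => `|g r|).
Proof.
move=> hg; have := integrable_abse hg; apply: eq_integrable => // r.
rewrite inE => /I01P /andP[r0 r1] /=; congr (_%:E).
by rewrite normrM ger0_norm// mulr_ge0 ?exprn_ge0 ?(ltW r0)// ltW// radial_gt0// ltW.
Qed.

Lemma wintS p g : wint p.+1 g = wint p (fun r => r * g r).
Proof. by apply: eq_Rintegral => r _; rewrite exprS; ring. Qed.

(** Only the mass of [s, t] with s < t < 1 is kept. Since s may be taken close to 1, contributions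
    from smaller radii are exponentially negligible. *)
Lemma wmom_lower (s : R) : 0 < s < 1 -> exists2 c : R, 0 < c & forall p, c * s ^+ p <= wmom p.
Proof.
move=> /andP[s0 s1]; pose t := (1 + s) / 2.
have st : s < t by rewrite /t; lra.
have t1 : t < 1 by rewrite /t; lra.
have Vt : 0 < V t by apply: radial_gt0; rewrite t1 andbT; lra.
exists (V t * (t - s)); first by rewrite mulr_gt0// subr_gt0.
move=> p.
have ii : mu.-integrable I01 (EFin \o (fun r => r ^+ p * V r)).
  by have := wintegrable1 p; apply: eq_integrable => // r _ /=; rewrite mulr1.
pose f r := (s ^+ p * V t) * \1_(`[s, t]%classic) r.
have mf : measurable_fun I01 f by apply: measurable_funM => //.
have fi : mu.-integrable I01 (EFin \o f).
  apply: le_integrable ii => //; first exact/measurable_EFinP.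
  move=> r /I01P /andP[r0 r1] /=; rewrite lee_fin /f indicE.
  case: (boolP (r \in _)); rewrite ?mulr0 ?normr0// => /set_mem /=.
  rewrite in_itv/= mulr1 => /andP[sr rt].
  rewrite !ger0_norm ?mulr_ge0 ?exprn_ge0 ?(ltW s0) ?(ltW r0) ?(ltW Vt)//; last first.
    by rewrite ltW// radial_gt0// ltW.
  apply: ler_pM; rewrite ?exprn_ge0 ?(ltW s0) ?(ltW Vt)//.
    by rewrite lerXn2r// nnegrE ltW.
  by move: rt; rewrite le_eqVlt => /predU1P[->//|rt]; exact: weight_noninc.
have -> : V t * (t - s) * s ^+ p = \int[mu]_(r in I01) f r.
  rewrite /f (RintegralZl (mu := mu)) //; last first.
    apply: measurable_bounded_integrable => //; first exact: I01_finite.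
    exists 1; split=> // M M1 r _ /=; apply: le_trans (ltW M1).
    by rewrite indicE; case: (_ \in _); rewrite ?normr0 ?normr1.
  have -> : \int[mu]_(r in I01) \1_(`[s, t]%classic) r = t - s.
    transitivity (fine (lebesgue_measure (`[s, t]%classic : set R))); last first.
      by rewrite lebesgue_measure_itv/= lte_fin st.
    rewrite /Rintegral integral_indic// (_ : _ `&` _ = `[s, t]%classic)//.
    apply/seteqP; split => r /=; rewrite !in_itv/=; first by move=> [].
    by move=> /andP[h1 h2]; split; [rewrite h1 h2|apply/andP; split; lra].
  ring.
apply: le_Rintegral => // r /I01P /andP[r0 r1]; rewrite /f indicE.
case: (boolP (r \in _)) => [/set_mem /=|_]; rewrite ?mulr0; last first.
  by rewrite mulr_ge0 ?exprn_ge0 ?(ltW r0)// ltW// radial_gt0// ltW.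
rewrite in_itv/= mulr1 => /andP[sr rt].
apply: ler_pM; rewrite ?exprn_ge0 ?(ltW s0) ?(ltW Vt)//.
  by rewrite lerXn2r// nnegrE ltW.
by move: rt; rewrite le_eqVlt => /predU1P[->//|rt]; exact: weight_noninc.
Qed.

Lemma wmom_gt0 p : 0 < wmom p.
Proof.
have [|c c0 hc] := @wmom_lower 2^-1; first by lra.
by apply: lt_le_trans (hc p); rewrite mulr_gt0// exprn_gt0.
Qed.

(** For p = 2 n + 1 and the radial part of a symbol, this is its Toeplitz coefficient of index n. *)
Definition wavg p g : R := wint p g / wmom p.

(* Chebyshev: g - g(r0) and r^2 - r0^2 have opposite signs, where r0^2 is the
   mean of r^2. *)
Lemma wavg_noninc p g (B : R) : measurable_fun I01 g ->
  (forall r, 0 < r < 1 -> 0 <= g r <= B) ->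
  (forall r s, 0 < r -> r <= s -> s < 1 -> g s <= g r) ->
  wavg p.+2 g <= wavg p g.
Proof.
move=> mg g0 gni.
have m0 := wmom_gt0 p; have m2 := wmom_gt0 p.+2.
have Bg r : 0 < r < 1 -> `|g r| <= B.
  by move=> /g0 /andP[h1 h2]; rewrite ger0_norm.
have Ig q : wintegrable q g by exact: bounded_wintegrable Bg.
pose t := wmom p.+2 / wmom p.
have t0 : 0 < t by rewrite divr_gt0.
have ms k (f : R -> R) : measurable_fun I01 f -> measurable_fun I01 (fun r => r ^+ k * f r).
  by move=> mf; apply: measurable_funM => //; apply: measurable_funX.
have I2 q : wintegrable q (fun r => r ^+ 2).
  apply: (@bounded_wintegrable _ _ 1); first by apply: measurable_funX.
  by move=> r /andP[r0 r1]; rewrite normrX gtr0_norm// exprn_ile1// ltW.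
have I2g q : wintegrable q (fun r => r ^+ 2 * g r).
  apply: (@bounded_wintegrable _ _ B); first exact: ms.
  move=> r r01; have /andP[r0 r1] := r01; rewrite normrM normrX gtr0_norm//.
  rewrite -[leRHS]mul1r; apply: ler_pM => //; rewrite ?exprn_ge0 ?(ltW r0)//; last exact: Bg.
  by rewrite exprn_ile1// ltW.
have E2 : wmom p.+2 = wint p (fun r => r ^+ 2).
  by rewrite -wint1 !wintS; apply: eq_Rintegral => r _; rewrite expr2 mulr1.
have E2g : wint p.+2 g = wint p (fun r => r ^+ 2 * g r).
  by rewrite !wintS; apply: eq_Rintegral => r _; ring.
pose r0 := Num.sqrt t.
have r00 : 0 < r0 by rewrite sqrtr_gt0.
have r0t : r0 ^+ 2 = t by rewrite sqr_sqrtr// ltW.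
(* The value 0 for r0 >= 1 saves a proof that the mean of r^2 is below 1: there r < r0, and g >= 0
   gives the right sign. *)
pose k := if r0 < 1 then g r0 else 0.
have key : wint p (fun r => r ^+ 2 * g r + (- t) * g r) <= wint p (fun r => k * (r ^+ 2 + (- t) * 1)).
  apply: le_wint.
  - by apply: wintegrableD; [exact: I2g|exact/wintegrableZ/Ig].
  - by apply/wintegrableZ/wintegrableD; [exact: I2|exact/wintegrableZ/wintegrable1].
  move=> r r01; have /andP[rr0 rr1] := r01; rewrite mulr1 -r0t.
  rewrite -subr_ge0.
  have -> : k * (r ^+ 2 + - r0 ^+ 2) - (r ^+ 2 * g r + - r0 ^+ 2 * g r) =
    (k - g r) * (r ^+ 2 - r0 ^+ 2) by ring.
  rewrite /k.
  have [r01'|r01'] := ltP r0 1; last first.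
    have /andP[gr _] := g0 r r01.
    rewrite sub0r mulNr -mulrN mulr_ge0// oppr_ge0 subr_le0.
    by rewrite lerXn2r ?nnegrE ?(ltW r00) ?(ltW rr0)// ltW// (lt_le_trans rr1).
  have [rr|rr] := leP r r0.
    by rewrite mulr_le0// ?subr_le0 ?gni// lerXn2r ?nnegrE ?(ltW rr0) ?(ltW r00).
  by rewrite mulr_ge0// subr_ge0 ?gni ?(ltW rr)// lerXn2r ?nnegrE ?(ltW rr0) ?(ltW r00) ?(ltW rr).
move: key; rewrite wintD//; last exact/wintegrableZ/Ig.
rewrite wintZ; last by apply: wintegrableD => //; exact/wintegrableZ/wintegrable1.
rewrite wintD//; last exact/wintegrableZ/wintegrable1.
rewrite !wintZ//; last exact: wintegrable1.
have tm : t * wmom p = wmom p.+2 by rewrite /t divfK ?gt_eqF.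
rewrite wint1 -E2 -E2g !mulNr tm subrr mulr0 subr_le0 => h.
rewrite /wavg ler_pdivrMr//; apply: le_trans h _.
by rewrite le_eqVlt; apply/orP; left; apply/eqP; rewrite /t; ring.
Qed.

End Moments.

(** * Logarithmic decay from the moment condition *)

Section Decay.
Context {R : realType}.
Variable v : weight R.
Notation mu := (@lebesgue_measure R).
Notation I01 := (`]0, 1[%classic : set R).
Implicit Types (p n : nat) (g b : R -> R).

Lemma moment_nat n : moment v n%:R = (wmom v n)%:E.
Proof.
rewrite /moment /wmom /Rintegral fineK.
  by apply: eq_integral => r; rewrite inE => /I01P /andP[r0 _]; rewrite powR_mulrn// ltW.
have := wintegrable1 v n; rewrite /wintegrable => h.
have := integrable_fin_num _ h => /(_ (measurable_itv _)).
rewrite (@eq_integral _ _ _ mu I01 (EFin \o (fun r => r ^+ n * radial_part v r * 1)) (fun r => (r ^+ n * radial_part v r)%:E))//.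
by move=> r _ /=; rewrite mulr1.
Qed.

Lemma moment_ratio : moment_ratio_bounded v -> exists2 eps : R, 0 < eps &
  exists2 C : R, 0 <= C & forall n, (0 < n)%N ->
  (moment v (n%:R - n%:R `^ eps) <= (C * wmom v n)%:E)%E.
Proof.
move=> [eps eps0 hs]; exists eps => //.
set S := (X in ereal_sup X) in hs.
have mge0 (x : R) : (0 <= moment v x)%E.
  apply: integral_ge0 => r /I01P /andP[r0 r1]; rewrite lee_fin mulr_ge0 ?powR_ge0//.
  by apply/ltW/radial_gt0; rewrite (ltW r0).
have ub n : (0 < n)%N -> (moment v (n%:R - n%:R `^ eps) / moment v n%:R <= ereal_sup S)%E.
  by move=> n0; apply: ereal_sup_ubound; exists n.
have m0 n := wmom_gt0 v n.
have s0 : (0 <= ereal_sup S)%E.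
  apply: le_trans (ub 1%N isT); rewrite moment_nat inver gt_eqF ?m0//.
  by rewrite mule_ge0// lee_fin invr_ge0 ltW.
exists (fine (ereal_sup S)); first exact: fine_ge0.
move=> n n0; have := ub n n0.
rewrite moment_nat inver gt_eqF ?m0// lee_pdivrMr// => h.
rewrite EFinM fineK// ge0_fin_numE//.
Qed.

Lemma radial_powR_measurable (x : R) :
  measurable_fun I01 (fun r => r `^ x * radial_part v r).
Proof.
apply: measurable_funM; last exact: radial_measurable.
by apply: measurable_funTS; exact: measurable_powR.
Qed.

Lemma powR_small (r t : R) : 0 < t -> 0 < r -> r <= 1 - t^-1 -> r `^ (t ^+ 2) <= expR (- t).
Proof.
move=> t0 r0 rt; rewrite /powR gt_eqF// ler_expR.
have : ln r <= - t^-1.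
  apply: (@le_trans _ _ (r - 1)); last by lra.
  have := @le_ln1Dx R (r - 1); rewrite [1 + _]addrC subrK; apply; lra.
move=> h; apply: le_trans (ler_wpM2l (sqr_ge0 t) h) _.
by rewrite le_eqVlt; apply/orP; left; apply/eqP; field; rewrite gt_eqF.
Qed.

(* Split at 1 - 1/t: below it, r^n <= r^(n - n^eps) r^(t^2) <= r^(n - n^eps) e^(-t). *)
Lemma wint_split_bound (eps C : R) n g (B b1 t : R) :
  (moment v (n%:R - n%:R `^ eps) <= (C * wmom v n)%:E)%E ->
  0 < t -> t ^+ 2 = n%:R `^ eps -> measurable_fun I01 g ->
  (forall r, 0 < r < 1 -> 0 <= g r <= B) -> 0 <= b1 ->
  (forall r, 0 < r < 1 -> 1 - t^-1 < r -> g r <= b1) ->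
  wint v n g <= (b1 + B * expR (- t) * C) * wmom v n.
Proof.
move=> hC t0 t2 mg gB b10 gb1.
have B0 : 0 <= B by have /andP[] := gB 2^-1 ltac:(lra); exact: le_trans.
have gB' r : 0 < r < 1 -> `|g r| <= B.
  by move=> /gB /andP[g0 g1]; rewrite ger0_norm.
have Ig : wintegrable v n g by exact: bounded_wintegrable gB'.
have V0 r : 0 < r < 1 -> 0 <= radial_part v r.
  by move=> /andP[r0 r1]; apply/ltW/radial_gt0; rewrite ltW.
have c0 : 0 <= B * expR (- t) by rewrite mulr_ge0// expR_ge0.
rewrite -lee_fin /wint /Rintegral fineK; last exact: integrable_fin_num Ig.
pose f1 r := (b1%:E * (r ^+ n * radial_part v r)%:E)%E.
pose f2 r := ((B * expR (- t))%:E * (r `^ (n%:R - n%:R `^ eps) * radial_part v r)%:E)%E.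
have m1 : measurable_fun I01 (fun r => (r ^+ n * radial_part v r)%:E).
  apply/measurable_EFinP; apply: measurable_funM; last exact: radial_measurable.
  by apply: measurable_funX.
have m2 : measurable_fun I01 (fun r => (r `^ (n%:R - n%:R `^ eps) * radial_part v r)%:E).
  by apply/measurable_EFinP; exact: radial_powR_measurable.
have mf1 : measurable_fun I01 f1 by exact: measurable_funeM.
have mf2 : measurable_fun I01 f2 by exact: measurable_funeM.
have p1 r : I01 r -> (0 <= (r ^+ n * radial_part v r)%:E)%E.
  move=> /I01P r01; rewrite lee_fin mulr_ge0 ?V0// exprn_ge0//.
  by case/andP: r01 => /ltW.
have p2 r : I01 r -> (0 <= (r `^ (n%:R - n%:R `^ eps) * radial_part v r)%:E)%E.
  by move=> /I01P r01; rewrite lee_fin mulr_ge0 ?V0// powR_ge0.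
have pf1 r : I01 r -> (0 <= f1 r)%E by move=> h; rewrite /f1 mule_ge0// p1.
have pf2 r : I01 r -> (0 <= f2 r)%E by move=> h; rewrite /f2 mule_ge0// p2.
apply: (@le_trans _ _ (\int[mu]_(r in I01) (f1 r + f2 r))%E).
  apply: ge0_le_integral => //.
  - move=> r /I01P r01; rewrite lee_fin !mulr_ge0 ?V0 ?exprn_ge0//.
      by case/andP: r01 => /ltW.
    by case/andP: (gB r r01).
  - by apply/measurable_EFinP; exact: wmeasurable.
  - exact: emeasurable_funD.
  move=> r /I01P r01; have /andP[r0 r1] := r01; have /andP[g0 g1] := gB r r01.
  rewrite /f1 /f2 -!EFinM -EFinD lee_fin.
  have X0 : 0 <= r ^+ n * radial_part v r by rewrite mulr_ge0 ?V0// exprn_ge0// ltW.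
  have Y0 : 0 <= r `^ (n%:R - n%:R `^ eps) * radial_part v r by rewrite mulr_ge0 ?V0// powR_ge0.
  have [rt|rt] := ltP (1 - t^-1) r.
    apply: ler_wpDr; first exact: mulr_ge0.
    by rewrite mulrC ler_wpM2r// gb1.
  apply: ler_wpDl; first exact: mulr_ge0.
  have E : r ^+ n = r `^ (n%:R - n%:R `^ eps) * r `^ (t ^+ 2).
    rewrite t2 -powRD; last by rewrite (gt_eqF r0) implybT.
    by rewrite subrK powR_mulrn// ltW.
  have h := powR_small t0 r0 rt.
  have -> : r ^+ n * radial_part v r * g r =
    (g r * r `^ (t ^+ 2)) * (r `^ (n%:R - n%:R `^ eps) * radial_part v r) by rewrite E; ring.
  by rewrite ler_wpM2r// ler_pM// powR_ge0.
rewrite ge0_integralD// ge0_integralZl// ge0_integralZl//.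
rewrite mulrDl EFinD; apply: leeD.
  rewrite EFinM lee_wpmul2l// /wmom /Rintegral fineK//.
  have := integrable_fin_num _ (wintegrable1 v n) => /(_ (measurable_itv _)).
  by under eq_integral do rewrite /= mulr1.
by rewrite -mulrA [leRHS]EFinM lee_wpmul2l.
Qed.

(** With t = n^(eps/2), g is at most eta / ln t on ]1 - 1/t, 1[ and the rest is exponentially small
    in t. In 4 / eps, the factor 2 / eps comes from ln n = (2 / eps) ln t and 2 from the two parts.
    That [Cv] depends on v alone is what makes small eta give small coefficients. *)
Lemma wavg_decay : moment_ratio_bounded v -> exists2 Cv : R, 0 <= Cv &
  forall g (B eta : R), measurable_fun I01 g -> (forall r, 0 < r < 1 -> 0 <= g r <= B) ->
  0 < eta -> (exists2 r0, r0 < 1 & forall r, 0 < r < 1 -> r0 < r -> g r * `|ln (1 - r)| <= eta) ->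
  exists N, forall k, (N <= k)%N -> wavg v k.*2.+1 g * lg k <= Cv * eta.
Proof.
move=> /moment_ratio [eps eps0 [C C0 hC]].
exists (4 / eps); first by rewrite divr_ge0// ltW.
move=> g B eta mg gB eta0 [r0 r01 hr0].
have B0 : 0 <= B by have /andP[] := gB 2^-1 ltac:(lra); exact: le_trans.
(* For t >= T the three summands ensure ln t > 0, 1 - 1/t >= r0, and an exponential part of at most
   eta after multiplication by ln t. *)
pose T := 2 + (1 - r0)^-1 + 4 * B * C / eta.
have i0 : 0 < (1 - r0)^-1 by rewrite invr_gt0 subr_gt0.
have i1 : 0 <= 4 * B * C / eta by rewrite divr_ge0 ?mulr_ge0// ltW.
have T2 : 2 <= T by rewrite /T; lra.
have T1 : (1 - r0)^-1 <= T by rewrite /T; lra.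
have T3 : 4 * B * C / eta <= T by rewrite /T; lra.
clearbody T.
exists (Num.truncn (T `^ (2 / eps))).+1 => k Nk.
set n := k.*2.+1.
have nR : 0 < n%:R :> R by rewrite ltr0n.
pose t := n%:R `^ (eps / 2).
have tT : T <= t.
  have -> : T = (T `^ (2 / eps)) `^ (eps / 2).
    rewrite -powRrM (_ : 2 / eps * (eps / 2) = 1) ?powRr1//; first lra.
    by field; rewrite gt_eqF.
  apply: ge0_ler_powR; rewrite ?nnegrE ?powR_ge0//; first by rewrite divr_ge0// ltW.
  apply: le_trans (ltW (truncnS_gt _)) _; rewrite ler_nat /n.
  by apply: leq_trans Nk _; clear; lia.
have t0 : 0 < t by lra.
have t2 : t ^+ 2 = n%:R `^ eps.
  by rewrite /t -powR_mulrn ?powR_ge0// -powRrM; congr (_ `^ _); field.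
have lt0 : 0 < ln t by rewrite ln_gt0//; lra.
have lnt : ln n%:R = 2 / eps * ln t.
  by rewrite /t ln_powR; field; rewrite gt_eqF.
have lgk : lg k <= 2 / eps * ln t.
  rewrite -lnt /lg ler_ln ?posrE ?ltr0n// ler_nat /n.
  have : (0 < k)%N by apply: leq_trans Nk.
  by clear; lia.
have tV : t^-1 <= 1 - r0.
  by rewrite -[leRHS]invrK lef_pV2 ?posrE// (le_trans T1).
have m0 := wmom_gt0 v n.
have b10 : 0 <= eta / ln t by rewrite divr_ge0// ltW.
have gb1 r : 0 < r < 1 -> 1 - t^-1 < r -> g r <= eta / ln t.
  move=> r01' rt; rewrite ler_pdivlMr//.
  have h := hr0 r r01' ltac:(lra).
  have /andP[g0 _] := gB r r01'; have /andP[rr0 rr1] := r01'.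
  apply: le_trans h; rewrite ler_wpM2l//.
  have : ln (1 - r) <= - ln t.
    by rewrite -lnV ?posrE// ler_ln ?posrE ?invr_gt0 ?subr_gt0//; lra.
  by have := ler_norm (- ln (1 - r)); rewrite normrN; lra.
have h := wint_split_bound (hC n isT) t0 t2 mg gB b10 gb1.
have havg : wavg v n g <= eta / ln t + B * expR (- t) * C by rewrite /wavg ler_pdivrMr.
have et : expR (- t) * t <= 4 / t.
  have e2 : t ^+ 2 <= 4 * expR t.
    have := expR_ge1Dx (t / 2) => hh.
    have -> : expR t = expR (t / 2) ^+ 2.
      by rewrite -expRM_natl; congr expR; field.
    have h1 : 0 <= t / 2 by lra.
    have h2 : (t / 2) ^+ 2 <= expR (t / 2) ^+ 2.
      by rewrite lerXn2r ?nnegrE// ?expR_ge0//; lra.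
    by move: h2; rewrite expr_div_n; lra.
  rewrite expRN ler_pdivlMr// -mulrA -expr2 mulrC ler_pdivrMr ?expR_gt0//.
have lnt2 : ln t <= t.
  have := @le_ln1Dx R (t - 1); rewrite [1 + _]addrC subrK => hh.
  by have := hh ltac:(lra); lra.
have BCt : B * C * (4 / t) <= eta.
  have -> : B * C * (4 / t) = 4 * B * C / t by ring.
  rewrite ler_pdivrMr//; move: T3; rewrite ler_pdivrMr// => T3.
  by apply: le_trans T3 _; rewrite mulrC ler_wpM2l// ltW.
have fin : (eta / ln t + B * expR (- t) * C) * ln t <= 2 * eta.
  rewrite mulrDl divfK ?gt_eqF//.
  have : B * expR (- t) * C * ln t <= B * C * (4 / t).
    have -> : B * expR (- t) * C * ln t = B * C * (expR (- t) * ln t) by ring.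
    rewrite ler_wpM2l ?mulr_ge0//; apply: le_trans et.
    by rewrite ler_wpM2l// expR_ge0.
  by lra.
have a0 : 0 <= eta / ln t + B * expR (- t) * C.
  by rewrite addr_ge0// !mulr_ge0// expR_ge0.
apply: le_trans (ler_wpM2r (ltW (lg_gt0 _)) havg) _.
apply: le_trans (ler_wpM2l a0 lgk) _.
rewrite mulrCA; apply: le_trans (ler_wpM2l _ fin) _; first by rewrite divr_ge0// ltW.
by rewrite le_eqVlt; apply/orP; left; apply/eqP; field; rewrite gt_eqF.
Qed.

End Decay.

(** * One-sided limits superior, and integrals of the symbol *)

Section Symbol.
Context {R : realType}.
Variable v : weight R.
Notation mu := (@lebesgue_measure R).
Notation I01 := (`]0, 1[%classic : set R).
Implicit Types (p n : nat) (g b A : R -> R).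

Lemma limf_esup_left_lt (f : R -> R) (x : R) (y : \bar R) :
  (limf_esup (fun r => (f r)%:E) x^'- < y)%E ->
  exists (r0 : R) (s : \bar R), [/\ r0 < x, (s < y)%E &
    forall r, r0 < r < x -> ((f r)%:E <= s)%E].
Proof.
rewrite limf_esupE => /ereal_inf_lt [s [U Ux <-] sy].
have [d /= d0 hd] : exists2 d : R, 0 < d & forall r, `|x - r| < d -> r < x -> U r.
  by move: Ux => /nbhs_ballP [d d0 hd]; exists d.
exists (x - d), (ereal_sup [set (f r)%:E | r in U]); split => //.
  by rewrite ltrBlDr ltrDl.
move=> r /andP[r0 r1]; apply: ereal_sup_ubound; exists r => //; apply: hd => //.
by rewrite gtr0_norm ?subr_gt0//; lra.
Qed.

Lemma limf_esup_left_lty (f : R -> R) (x : R) :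
  (limf_esup (fun r => (f r)%:E) x^'- < +oo)%E ->
  exists r0 K : R, r0 < x /\ forall r, r0 < r < x -> f r <= K.
Proof.
move=> /limf_esup_left_lt [r0 [s [r01 soo hs]]].
exists r0, (fine s); split=> // r hr; have := hs r hr.
case: s soo hs => [s _ _|//|_ _]; first by rewrite lee_fin.
by rewrite leeNy_eq.
Qed.

Lemma limf_esup_left_le (f : R -> R) (x eta : R) : 0 < eta ->
  limf_esup (fun r => (f r)%:E) x^'- = 0%E ->
  exists2 r0 : R, r0 < x & forall r, r0 < r < x -> f r <= eta.
Proof.
move=> eta0 h0; have : (limf_esup (fun r => (f r)%:E) x^'- < eta%:E)%E.
  by rewrite h0 lte_fin.
move=> /limf_esup_left_lt [r0 [s [r01 sE hs]]].
exists r0 => // r hr; rewrite -lee_fin; apply: le_trans (hs r hr) _; exact: ltW.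
Qed.

(* Since fine maps infinite values to 0, the coefficients whose integrand might not
   be integrable need no passage to polar coordinates. *)
Lemma not_integrable_Rintegral0 (f : R -> R) (D : set R) : measurable D ->
  measurable_fun D f -> ~ mu.-integrable D (EFin \o f) ->
  \int[mu]_(r in D) f r = 0.
Proof.
move=> mD mf nint; rewrite /Rintegral integralE.
have mef : measurable_fun D (EFin \o f) by exact/measurable_EFinP.
set F := EFin \o f in nint mef *.
rewrite -[fun x => (f x)%:E]/F.
have p0 : (0 <= \int[mu]_(x in D) F^\+ x)%E by apply: integral_ge0 => x _; exact: funepos_ge0.
have n0 : (0 <= \int[mu]_(x in D) F^\- x)%E by apply: integral_ge0 => x _; exact: funeneg_ge0.
have hh : (\int[mu]_(x in D) F^\+ x + \int[mu]_(x in D) F^\- x = +oo)%E.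
  apply: contra_notP nint => hne; apply/integrableP; split => //.
  rewrite (_ : (fun x => `|F x|)%E = (F^\+ \+ F^\-)%E); last by rewrite -fune_abse.
  rewrite ge0_integralD//; [|exact: measurable_funepos|exact: measurable_funeneg].
  by rewrite ltey; apply/eqP.
case: (\int[mu]_(x in D) F^\+ x)%E p0 hh => [p|_|//]; last first.
  by case: (\int[mu]_(x in D) F^\- x)%E n0.
by case: (\int[mu]_(x in D) F^\- x)%E n0.
Qed.

Lemma wintegrable_mono p m A : measurable_fun I01 A -> wintegrable v p A ->
  wintegrable v (m + p) A.
Proof.
move=> mA; apply: le_integrable => //; first by apply/measurable_EFinP; exact: wmeasurable.
move=> r /I01P /andP[r0 r1] /=; rewrite lee_fin !normrM exprD.
rewrite -mulrA -[leRHS]mulrA ler_wpM2r// normrM ler_piMl//.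
by rewrite normrX exprn_ile1// gtr0_norm// ltW.
Qed.

(** In the non-integrable case both integrals have the default value 0. *)
Lemma wint_opp p A : measurable_fun I01 A -> wint v p (fun r => - A r) = - wint v p A.
Proof.
move=> mA; have mA' : measurable_fun I01 (fun r => - A r) by exact: measurableT_comp.
have e1 : (fun r => - A r) = (fun r => (-1) * A r) by apply/funext => r; rewrite mulN1r.
have e2 : A = (fun r => (-1) * - A r) by apply/funext => r; rewrite mulN1r opprK.
have [h|h] := pselect (wintegrable v p A).
  by rewrite e1 wintZ// mulN1r.
rewrite /wint (not_integrable_Rintegral0 _ _ h)//; last exact: wmeasurable.
rewrite oppr0 not_integrable_Rintegral0//; first exact: wmeasurable.
by move=> h'; apply: h; rewrite e2; exact: wintegrableZ.
Qed.

Lemma wavg_opp p A : measurable_fun I01 A -> wavg v p (fun r => - A r) = - wavg v p A.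
Proof. by move=> mA; rewrite /wavg wint_opp// mulNr. Qed.

(* The part of a symbol that vanishes near the boundary has exponentially small
   coefficients, as soon as they make sense. *)
Lemma wavg_compact_support g n0 (d : R) : 0 < d < 1 -> measurable_fun I01 g ->
  wintegrable v n0.*2.+1 g -> (forall r, d <= r < 1 -> g r = 0) ->
  exists C q : R, [/\ 0 <= C, 0 <= q < 1 &
    forall n, (n0 <= n)%N -> `|wavg v n.*2.+1 g| <= C * q ^+ n].
Proof.
(* The numerator is O(d^(2n)) and the moment is at least a multiple of s^(2n) with d < s < 1, whence
   q = (d / s)^2. *)
move=> /andP[d0 d1] mg Ig g0; pose s := (d + 1) / 2.
have sd : d < s by rewrite /s; lra.
have s1 : s < 1 by rewrite /s; lra.
have s0 : 0 < s by lra.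
have [|c c0 hc] := @wmom_lower _ v s; first by rewrite s0 s1.
pose G := wint v n0.*2.+1 (fun r => `|g r|).
have G0 : 0 <= G by apply: le_trans (wint_norm Ig).
pose q := (d / s) ^+ 2.
have q0 : 0 < q by rewrite exprn_gt0// divr_gt0.
have q1 : q < 1.
  have ds : 0 <= d / s by rewrite divr_ge0// ltW.
  by rewrite /q expr_lt1// ltr_pdivrMr// mul1r.
have csd : 0 < c * s * d ^+ n0.*2 by apply: mulr_gt0; [exact: mulr_gt0|exact: exprn_gt0].
exists (G / (c * s * d ^+ n0.*2)), q; split.
- by rewrite divr_ge0// ltW.
- by rewrite q1 ltW.
move=> n nn0.
have Ign : wintegrable v n.*2.+1 g.
  rewrite (_ : n.*2.+1 = ((n - n0).*2 + n0.*2.+1)%N); first exact: wintegrable_mono.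
  by clear -nn0; lia.
have mm := wmom_gt0 v n.*2.+1.
rewrite /wavg normrM normfV (gtr0_norm mm) ler_pdivrMr//.
apply: le_trans (wint_norm Ign) _.
have h1 : wint v n.*2.+1 (fun r => `|g r|) <= d ^+ (n - n0).*2 * G.
  rewrite /G -wintZ; last exact: wintegrable_norm.
  apply: le_Rintegral => //.
  - exact: wintegrable_norm.
  - by have := wintegrableZ (d ^+ (n - n0).*2) (wintegrable_norm Ig); exact.
  move=> r /I01P /andP[r0 r1].
  have V0 : 0 <= radial_part v r by apply/ltW/radial_gt0; rewrite ltW.
  have [dr|rd] := leP d r; first by rewrite g0 ?dr// normr0 !mulr0.
  rewrite (_ : n.*2.+1 = ((n - n0).*2 + n0.*2.+1)%N); last by clear -nn0; lia.
  rewrite exprD.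
  have -> : r ^+ (n - n0).*2 * r ^+ n0.*2.+1 * radial_part v r * `|g r| =
    r ^+ (n - n0).*2 * (r ^+ n0.*2.+1 * radial_part v r * `|g r|) by ring.
  have -> : r ^+ n0.*2.+1 * radial_part v r * (d ^+ (n - n0).*2 * `|g r|) =
    d ^+ (n - n0).*2 * (r ^+ n0.*2.+1 * radial_part v r * `|g r|) by ring.
  rewrite ler_wpM2r ?mulr_ge0 ?exprn_ge0 ?(ltW r0)//.
  by rewrite lerXn2r ?nnegrE ?(ltW r0) ?(ltW d0) ?(ltW rd).
apply: le_trans h1 _.
have h2 := hc n.*2.+1.
have K0 : 0 <= G / (c * s * d ^+ n0.*2) * q ^+ n.
  by rewrite mulr_ge0 ?exprn_ge0 ?(ltW q0)// divr_ge0// ltW.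
apply: le_trans (ler_wpM2l K0 h2).
rewrite le_eqVlt; apply/orP; left; apply/eqP.
have -> : d ^+ (n - n0).*2 = d ^+ n.*2 / d ^+ n0.*2.
  rewrite -{2}(subnK nn0) doubleD exprD mulfK// expf_neq0// gt_eqF//.
have -> : q ^+ n = d ^+ n.*2 / s ^+ n.*2.
  by rewrite /q -exprM mul2n expr_div_n.
rewrite exprS; field.
by rewrite !expf_neq0 ?gt_eqF.
Qed.

(** With 1 - r = y^2 and - ln y <= 1 / y, the product is at most 2 K y. This shows that the
    correction K0 (1 - r) has logarithmic decay with any small constant. *)
Lemma xlnx_small (K eta : R) : 0 <= K -> 0 < eta ->
  exists2 r0 : R, r0 < 1 & forall r, 0 < r < 1 -> r0 < r -> K * (1 - r) * `|ln (1 - r)| <= eta.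
Proof.
move=> K0 eta0; pose d := (eta / (2 * K + 1)) ^+ 2.
have K1 : 0 < 2 * K + 1 by lra.
have d0 : 0 < d by rewrite exprn_gt0// divr_gt0.
exists (1 - d); first by rewrite ltrBlDr ltrDl.
move=> r /andP[r0 r1] rd; set x := 1 - r.
have x0 : 0 < x by rewrite subr_gt0.
have xd : x < d by rewrite /x; lra.
pose y := Num.sqrt x.
have y0 : 0 < y by rewrite sqrtr_gt0.
have xy : x = y ^+ 2 by rewrite sqr_sqrtr// ltW.
have yd : y <= eta / (2 * K + 1).
  by rewrite -(@ler_pXn2r _ 2%N)// ?nnegrE ?(ltW y0) ?divr_ge0 ?(ltW eta0) ?(ltW K1)// -xy ltW.
have y1 : y < 1.
  have : x < 1 by rewrite /x; lra.
  by rewrite xy expr_lt1// ltW.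
have ly : ln y < 0 by rewrite ln_lt0// y0.
have h : - ln y <= y^-1.
  have := @le_ln1Dx R (y^-1 - 1); rewrite [1 + _]addrC subrK lnV ?posrE// => hh.
  have i1 : 0 < y^-1 by rewrite invr_gt0.
  by have := hh ltac:(lra); lra.
have -> : `|ln x| = - (2 * ln y).
  have ly2 : 2 * ln y < 0 by rewrite pmulr_rlt0.
  by rewrite xy lnXn// -[ln y *+ 2]mulr_natl ltr0_norm.
apply: (@le_trans _ _ (K * x * (2 * y^-1))).
  by rewrite ler_wpM2l ?mulr_ge0 ?(ltW x0)//; lra.
have -> : K * x * (2 * y^-1) = 2 * K * y by rewrite xy; field; rewrite gt_eqF.
move: yd; rewrite ler_pdivlMr// => yd.
by apply: le_trans yd; rewrite mulrC; nra.
Qed.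

End Symbol.

(** * Decomposition of the Toeplitz coefficients *)

Section SymbolSplit.
Context {R : realType}.
Variable v : weight R.
Notation I01 := (`]0, 1[%classic : set R).

(** All that the operator bounds use of the symbol. Both monotone parts obey the same conditions, so
    passing from gam to - gam just exchanges them. *)
Definition log_split (gam bet bet' err : nat -> R) (Ce q Kb : R) : Prop :=
  [/\ forall n, gam n = bet n - bet' n + err n,
      forall n, bet n.+1 <= bet n /\ bet' n.+1 <= bet' n,
      forall n, 0 <= bet n /\ 0 <= bet' n,
      forall n, bet n * lg n <= Kb /\ bet' n * lg n <= Kb &
      0 <= q < 1 /\ forall n, `|err n| <= Ce * q ^+ n].

Lemma noninc_wavg_props (b : R -> R) (B eta0 : R) : moment_ratio_bounded v ->
  measurable_fun I01 b -> (forall r, 0 < r < 1 -> 0 <= b r <= B) ->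
  (forall r s, 0 < r -> r <= s -> s < 1 -> b s <= b r) ->
  0 < eta0 -> (exists2 r0, r0 < 1 & forall r, 0 < r < 1 -> r0 < r -> b r * `|ln (1 - r)| <= eta0) ->
  [/\ forall n, wavg v n.+1.*2.+1 b <= wavg v n.*2.+1 b,
      forall n, 0 <= wavg v n.*2.+1 b &
      exists Kb : R, forall n, wavg v n.*2.+1 b * lg n <= Kb].
Proof.
move=> hv mb b0 bni eta00 heta.
have [Cv Cv0 hCv] := wavg_decay hv.
have [N hN] := hCv b B eta0 mb b0 eta00 heta.
have m0 p := wmom_gt0 v p.
have bB r : 0 < r < 1 -> `|b r| <= B.
  by move=> /b0 /andP[h1 h2]; rewrite ger0_norm.
have Ib p : wintegrable v p b by exact: bounded_wintegrable bB.
have ni n : wavg v n.+1.*2.+1 b <= wavg v n.*2.+1 b by rewrite doubleS; exact: wavg_noninc b0 bni.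
have ge0 n : 0 <= wavg v n.*2.+1 b.
  rewrite divr_ge0 ?(ltW (m0 _))//; apply: Rintegral_ge0 => r /I01P r01.
  have /andP[r0 r1] := r01; have /andP[h1 _] := b0 r r01.
  by rewrite !mulr_ge0 ?exprn_ge0 ?(ltW r0)//; apply/ltW/radial_gt0; rewrite ltW.
split => //.
exists (Num.max (Cv * eta0) (wavg v 1 b * lg N)) => n; rewrite le_max; apply/orP.
have [nN|Nn] := ltnP n N; [right|left; exact: hN].
apply: ler_pM; rewrite ?(ltW (lg_gt0 _)) ?ler_lg ?(ltnW nN)//.
elim: n {nN} => // n IH; exact: le_trans (ni n) IH.
Qed.

(** By the mean value theorem A + K0' (1 - r) is nonincreasing near 1, where K0' = max(K0, 0) makes
    K0' (1 - r) nonincreasing too. The difference of their modifications agrees with A on [d, 1[, so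
    the error comes from smaller radii. *)
Lemma symbol_split_side (A : R -> R) (delta K0 : R) : moment_ratio_bounded v ->
  measurable_fun I01 A -> 0 < delta < 1 ->
  (forall r, delta <= r < 1 -> derivable A r 1) ->
  (exists2 r1, r1 < 1 & forall r, r1 < r < 1 -> derive1 A r <= K0) ->
  (exists r2 K : R, r2 < 1 /\ forall r, r2 < r < 1 -> `|A r * ln (1 - r)| <= K) ->
  exists bet bet' err Ce q Kb,
    log_split (fun n => wavg v n.*2.+1 A) bet bet' err Ce q Kb /\
    ((forall eta, 0 < eta -> exists2 r2, r2 < 1 & forall r, r2 < r < 1 -> `|A r * ln (1 - r)| <= eta) ->
     forall eta, 0 < eta -> exists N, forall k, (N <= k)%N -> bet k * lg k <= eta /\ bet' k * lg k <= eta).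
Proof.
move=> hv mA /andP[de0 de1] dA [r1 r11 hr1] [r2 [K [r21 hK]]].
(* If no defining integral converges, every coefficient has the default value 0 and the
   decomposition is trivial. *)
have [[n0 hn0]|never] := pselect (exists n0, wintegrable v n0.*2.+1 A); last first.
  exists (fun=> 0), (fun=> 0), (fun=> 0), 0, 0, 0; split; last first.
    by move=> _ eta eta0; exists 0%N => k _; rewrite mul0r ltW.
  split => // [n|n|]; rewrite ?mul0r ?lexx ?ltr01//.
    rewrite subrr addr0 /wavg /wint not_integrable_Rintegral0 ?mul0r//.
      exact: wmeasurable.
    by move=> h; apply: never; exists n.
  by split=> // n; rewrite normr0 mul0r.
pose K0' := Num.max K0 0.
have K0'0 : 0 <= K0' by rewrite le_max lexx orbT.
have K0K : K0 <= K0' by rewrite le_max lexx.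
clearbody K0'.
have [d [d0 d1 dd [d1' d2']]] : exists d : R, [/\ 0 < d, d < 1, delta <= d & r1 < d /\ r2 < d].
  exists ((1 + Num.max delta (Num.max r1 r2)) / 2).
  have h1 : delta <= Num.max delta (Num.max r1 r2) by rewrite le_max lexx.
  have h2 : r1 <= Num.max delta (Num.max r1 r2) by rewrite !le_max lexx orbT.
  have h3 : r2 <= Num.max delta (Num.max r1 r2) by rewrite !le_max lexx !orbT.
  have h4 : Num.max delta (Num.max r1 r2) < 1 by rewrite !gt_max de1 r11.
  move: (Num.max delta _) h1 h2 h3 h4 => M h1 h2 h3 h4.
  by split; [lra|lra|lra|split; lra].
have cA r : d <= r < 1 -> {for r, continuous A}.
  move=> /andP[h1 h2]; apply: differentiable_continuous; apply/derivable1_diffP.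
  by apply: dA; rewrite h2 (le_trans dd).
have lipA x y : d <= x -> x < y -> y < 1 -> A y - A x <= K0' * (y - x).
  move=> dx xy y1.
  have [c cxy ->] : exists2 c, c \in `]x, y[%R & A y - A x = derive1 A c * (y - x).
    apply: MVT => //.
      move=> c; rewrite in_itv/= => /andP[xc cy].
      rewrite derive1E; apply/derivableP; apply: dA; apply/andP; split; lra.
    apply: continuous_in_subspaceT => c; rewrite inE/= in_itv/= => /andP[xc cy].
    by apply: cA; apply/andP; split; lra.
  rewrite ler_wpM2r ?subr_ge0 ?(ltW xy)//; apply: le_trans K0K.
  by apply: hr1; move: cxy; rewrite in_itv/= => /andP[xc cy]; apply/andP; split; lra.
have K00 : 0 <= K.
  by apply: le_trans (hK ((1 + d) / 2) _); rewrite ?normr_ge0//; apply/andP; split; lra.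
(* Freezing both functions below d makes them bounded and monotone on all of ]0, 1[ and leaves them
   unchanged near 1. *)
pose b r := A (Num.max r d) + K0' * (1 - Num.max r d).
pose b' r := K0' * (1 - Num.max r d).
have mxd r : d <= Num.max r d by rewrite le_max lexx orbT.
have mx1 r : r < 1 -> Num.max r d < 1 by move=> r1'; rewrite gt_max r1'.
have core x y : d <= x -> x <= y -> y < 1 -> A y + K0' * (1 - y) <= A x + K0' * (1 - x).
  move=> dx; rewrite le_eqVlt => /predU1P[->//|xy] y1.
  by have := lipA x y dx xy y1; lra.
have bni r s : 0 < r -> r <= s -> s < 1 -> b s <= b r.
  move=> _ rs s1; rewrite /b; apply: core => //; last exact: mx1.
  by rewrite ge_max !le_max rs lexx orbT.
have b'ni r s : 0 < r -> r <= s -> s < 1 -> b' s <= b' r.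
  move=> _ rs s1; rewrite /b' ler_wpM2l// lerD2l lerN2.
  by rewrite ge_max !le_max rs lexx orbT.
(* A nonincreasing function dominates its limit at 1, which is 0: for |ln (1 - y)| >= K / e + 1 the
   bound on A(y) ln (1 - y) gives |A(y)| <= e. *)
have core0 x : d <= x -> x < 1 -> 0 <= A x + K0' * (1 - x).
  move=> dx x1; rewrite -oppr_le0; apply/ler_addgt0Pr => e e0; rewrite add0r.
  have t0 : 0 < K / e + 1 by rewrite ltr_wpDl// divr_ge0// ltW.
  pose y := Num.max ((1 + x) / 2) (1 - expR (- (K / e + 1))).
  have y1 : y < 1.
    by rewrite gt_max; apply/andP; split; [lra|rewrite ltrBlDr ltrDl expR_gt0].
  have xy : (1 + x) / 2 <= y by rewrite le_max lexx.
  have ye : 1 - y <= expR (- (K / e + 1)).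
    have : 1 - expR (- (K / e + 1)) <= y by rewrite le_max lexx orbT.
    lra.
  clearbody y.
  have lny : ln (1 - y) <= - (K / e + 1).
    by rewrite -[leRHS]expRK ler_ln ?posrE ?expR_gt0// subr_gt0.
  have hy : `|A y * ln (1 - y)| <= K by apply: hK; apply/andP; split; clear -xy dx d2' x1 y1; lra.
  have Ay : `|A y| <= e.
    have h1 : `|A y| * (K / e + 1) <= K.
      apply: le_trans hy; rewrite normrM ler_wpM2l//.
      have : ln (1 - y) < 0 by lra.
      by move=> /ltr0_norm ->; clear -lny; lra.
    have h2 : e * (K / e + 1) = K + e by field; rewrite gt_eqF.
    rewrite leNgt; apply/negP => h3.
    have : e * (K / e + 1) < `|A y| * (K / e + 1) by rewrite ltr_pM2r.
    by rewrite h2; clear -h1 e0; lra.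
  have h := core x y dx ltac:(lra) y1.
  have h2 : 0 <= K0' * (1 - y) by rewrite mulr_ge0// subr_ge0 ltW.
  by have := ler_norm (- A y); rewrite normrN; clear -h h2 Ay; lra.
have b0 r : 0 < r < 1 -> 0 <= b r <= b d.
  move=> /andP[r0 r1']; rewrite core0 ?mx1//=.
  rewrite /b; apply: core; [exact: mxd| |exact: mx1].
  by rewrite Order.POrderTheory.maxxx; exact: mxd.
have b'0 r : 0 < r < 1 -> 0 <= b' r <= K0'.
  move=> /andP[r0 r1']; have := mx1 r r1'; have := mxd r; rewrite /b' => h1 h2.
  apply/andP; split; first by rewrite mulr_ge0// subr_ge0 ltW.
  by rewrite ler_piMr//; clear -h1 d0; lra.
have mmax : measurable_fun I01 (fun r : R => Num.max r d) by exact: measurable_maxr.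
have mb' : measurable_fun I01 b'.
  by apply: measurable_funM => //; exact: measurable_funB.
have mAm : measurable_fun I01 (fun r => A (Num.max r d)).
  apply: within_I01_measurable => r /andP[r0 r1'].
  have cm : {for r, continuous (fun r : R => Num.max r d)}.
    by apply: continuous_max; [exact: cvg_id|exact: cvg_cst].
  apply: (continuous_comp cm); apply: cA.
  by rewrite mxd mx1.
have mb : measurable_fun I01 b by exact: measurable_funD.
have bE r : d <= r -> b r = A r + K0' * (1 - r) by move=> dr; rewrite /b (max_idPl dr).
have b'E r : d <= r -> b' r = K0' * (1 - r) by move=> dr; rewrite /b' (max_idPl dr).
have b'log eta : 0 < eta -> exists2 r0 : R, r0 < 1 & forall r, 0 < r < 1 -> r0 < r ->
    b' r * `|ln (1 - r)| <= eta.
  move=> eta0; have [r0 r01 hr0] := xlnx_small K0'0 eta0.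
  exists (Num.max r0 d); first by rewrite gt_max r01.
  move=> r r01'; rewrite gt_max => /andP[r0r dr].
  by rewrite b'E ?(ltW dr)//; exact: hr0.
have blog eta (r3 eta' : R) : r3 < 1 -> (forall r, r3 < r < 1 -> `|A r * ln (1 - r)| <= eta') ->
    0 < eta -> exists2 r0 : R, r0 < 1 & forall r, 0 < r < 1 -> r0 < r ->
    b r * `|ln (1 - r)| <= eta' + eta.
  move=> r31 h3 eta0; have [r0 r01 hr0] := xlnx_small K0'0 eta0.
  exists (Num.max r3 (Num.max r0 d)); first by rewrite !gt_max r01 r31.
  move=> r r01'; rewrite !gt_max => /and3P[r3r r0r dr].
  rewrite bE ?(ltW dr)// mulrDl; apply: lerD; last exact: hr0.
  have /andP[_ r1'] := r01'.
  apply: le_trans (h3 r _); last by rewrite r3r.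
  by rewrite normrM ler_wpM2r// ler_norm.
have K10 : 0 < K + 1 by lra.
have [bA bB [Kb hKb]] := noninc_wavg_props hv mb b0 bni K10 (blog _ _ _ r21 hK ltr01).
have [b'A b'B [Kb' hKb']] := noninc_wavg_props hv mb' b'0 b'ni ltr01 (b'log _ ltr01).
pose g r := A r - b r + b' r.
have mg : measurable_fun I01 g by apply: measurable_funD => //; exact: measurable_funB.
have g0 r : d <= r < 1 -> g r = 0.
  by move=> /andP[dr _]; rewrite /g bE// b'E//; ring.
have Ib p : wintegrable v p b.
  apply: (@bounded_wintegrable _ _ _ _ (b d)) => // r /b0 /andP[h1 h2].
  by rewrite ger0_norm.
have Ib' p : wintegrable v p b'.
  apply: (@bounded_wintegrable _ _ _ _ K0') => // r /b'0 /andP[h1 h2].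
  by rewrite ger0_norm.
have IA n : (n0 <= n)%N -> wintegrable v n.*2.+1 A.
  move=> nn0; rewrite (_ : n.*2.+1 = ((n - n0).*2 + n0.*2.+1)%N); first exact: wintegrable_mono.
  by clear -nn0; lia.
have gE : g = fun r => A r + ((-1) * b r + b' r) by apply/funext => r; rewrite /g mulN1r addrA.
have Ig n : (n0 <= n)%N -> wintegrable v n.*2.+1 g.
  by move=> nn0; rewrite gE; apply: wintegrableD; [exact: IA|apply: wintegrableD => //; exact: wintegrableZ].
have wg n : (n0 <= n)%N -> wavg v n.*2.+1 g = wavg v n.*2.+1 A - wavg v n.*2.+1 b + wavg v n.*2.+1 b'.
  move=> nn0; rewrite /wavg gE wintD; [|exact: IA|apply: wintegrableD => //; exact: wintegrableZ].
  rewrite wintD//; last exact: wintegrableZ.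
  by rewrite wintZ//; ring.
have [|C [q [C0 /andP[q0 q1] hC]]] := wavg_compact_support (d := d) _ mg (Ig n0 (leqnn _)) g0.
  by rewrite d0.
pose err n := wavg v n.*2.+1 A - wavg v n.*2.+1 b + wavg v n.*2.+1 b'.
(* A positive ratio allows the errors of index below n0 to be divided by q'^k and absorbed into the
   constant through S. *)
pose q' := Num.max q 2^-1.
have q'0 : 0 < q' by rewrite lt_max; apply/orP; right; clear; lra.
have q'1 : q' < 1 by rewrite gt_max q1; clear; lra.
have qq' : q <= q' by rewrite le_max lexx.
clearbody q'.
pose S := \sum_(k < n0) `|err k| / q' ^+ k.
have S0 : 0 <= S by apply: sumr_ge0 => k _; rewrite divr_ge0// exprn_ge0// ltW.
exists (fun n => wavg v n.*2.+1 b), (fun n => wavg v n.*2.+1 b'), err, (C + S), q', (Num.max Kb Kb').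
split.
  split.
  - by move=> n; rewrite /err; ring.
  - by move=> n; split.
  - by move=> n; split.
  - by move=> n; rewrite !le_max; split; apply/orP; [left; exact: hKb|right; exact: hKb'].
  split; first by rewrite q'1 ltW.
  move=> n; have qn0 : 0 < q' ^+ n by rewrite exprn_gt0.
  have [nn0|nn0] := leqP n0 n.
    rewrite /err -wg//; apply: le_trans (hC n nn0) _.
    rewrite mulrDl; apply: ler_wpDr; first by rewrite mulr_ge0// ltW.
    by rewrite ler_wpM2l// lerXn2r ?nnegrE// ltW.
  rewrite -ler_pdivrMr//; apply: ler_wpDl => //.
  rewrite /S (bigD1 (Ordinal nn0))//= lerDl; apply: sumr_ge0 => k _.
  by rewrite divr_ge0// exprn_ge0// ltW.
move=> hsmall eta eta0.
have [Cv Cv0 hCv] := wavg_decay hv.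
pose e1 := eta / (2 * (Cv + 1)).
have e10 : 0 < e1 by rewrite divr_gt0// mulr_gt0// ltr_wpDl.
have e1E : Cv * (e1 + e1) <= eta.
  have -> : Cv * (e1 + e1) = Cv * (eta / (Cv + 1)).
    by rewrite /e1; field; rewrite gt_eqF// ltr_wpDl.
  by rewrite mulrA ler_pdivrMr ?ltr_wpDl//; clear -Cv0 eta0; nra.
have e1E' : Cv * e1 <= eta by apply: le_trans e1E; rewrite ler_wpM2l// lerDl ltW.
have [r3 r31 h3] := hsmall e1 e10.
have e20 : 0 < e1 + e1 by rewrite addr_gt0.
have [N hN] := hCv b _ _ mb b0 e20 (blog _ _ _ r31 h3 e10).
have [N' hN'] := hCv b' _ _ mb' b'0 e10 (b'log _ e10).
exists (maxn N N') => k; rewrite geq_max => /andP[/hN h1 /hN' h2].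
by split; [exact: le_trans h1 e1E|exact: le_trans h2 e1E'].
Qed.

End SymbolSplit.

(** * Multiplier operators on H_v^oo *)

Section MultiplierOperator.
Context {R : realType}.
Variable v : weight R.
Implicit Types (c : nat -> R[i]) (h : R[i] -> R[i]) (z l : R[i]) (H : R).

Let w := weight_ext v.

Let w_gt0 s : 0 <= s < 1 -> 0 < w s. Proof. exact: weight_ext_gt0. Qed.

Let nc_itv z : normc z < 1 -> 0 <= normc z < 1.
Proof. by move=> ->; rewrite normc_ge0. Qed.

Lemma wbounded_ge0 h H : wbounded v h H -> 0 <= H.
Proof.
move=> /(_ 0); rewrite normc0 => /(_ ltr01); apply: le_trans.
by rewrite mulr_ge0 ?normc_ge0// ltW// w_gt0// lexx ltr01.
Qed.

Lemma lg_le n : lg n <= n.+1%:R :> R.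
Proof.
by have := @le_ln1Dx R n.+1%:R; rewrite /lg addrC natr1; apply; rewrite (lt_le_trans _ (ler0n _ _)) ?ltrN10.
Qed.

(** A term is the difference of two consecutive partial sums, each bounded by Landau's theorem. The
    polynomial loss is harmless, as it always meets a geometric factor. *)
Lemma coef_wbound c h H k z : pseries c h 1 -> wbounded v h H -> normc z < 1 ->
  normc (c k * z ^+ k) * w (normc z) <= 18 * k.+1%:R ^+ 2 * H.
Proof.
move=> hc hH z1; have H0 := wbounded_ge0 hH.
have wz := w_gt0 (nc_itv z1).
have k1 : 1 <= k.+1%:R :> R by rewrite ler1n.
have [z0|z0] := eqVneq z 0.
  have le1 : H <= 18 * k.+1%:R ^+ 2 * H by rewrite ler_peMl//; nra.
  case: k k1 le1 => [|k] k1 le1.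
    apply: le_trans le1; rewrite expr0 mulr1 -(pseries_at0 ltr01 hc).
    by have := hH 0; rewrite z0 normc0; apply.
  by rewrite z0 expr0n/= mulr0 normc0 mul0r !mulr_ge0 ?exprn_ge0.
have r01 : 0 < normc z < 1 by rewrite nc_gt0 z0.
have hM y : normc y = normc z -> normc (h y) <= H / w (normc z).
  by move=> yz; rewrite ler_pdivlMr// -yz hH// yz.
have t1 := pseries_trunc hc r01 hM k.+1 (erefl _).
have t2 := pseries_trunc hc r01 hM k (erefl _).
rewrite -ler_pdivlMr//.
have -> : c k * z ^+ k = \sum_(i < k.+1) c i * z ^+ i - \sum_(i < k) c i * z ^+ i.
  by rewrite big_ord_recr/=; ring.
apply: le_trans (ncB _ _) _; apply: le_trans (lerD t1 t2) _.
have M0 : 0 <= H / w (normc z) by rewrite divr_ge0// ltW.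
have l1 := lg_le k.+1; have l2 : lg k <= lg k.+1 :> R by rewrite ler_lg.
have e2 : k.+2%:R = k.+1%:R + 1 :> R by rewrite -natr1.
rewrite -mulrDl -[leRHS]mulrA; apply: ler_wpM2r => //.
rewrite e2 in l1; nra.
Qed.

Lemma mult_hassum c h (gam : nat -> R) (G : R) : pseries c h 1 -> (forall k, `|gam k| <= G) ->
  forall z, normc z < 1 -> exists l, hassum (fun k => (gam k)%:C * c k * z ^+ k) l.
Proof.
move=> hc hG z z1; pose s := (normc z + 1) / 2.
have z0 := normc_ge0 z.
have s01 : 0 < s < 1 by rewrite /s; lra.
have zs : normc z <= s by rewrite /s; lra.
have [C [q [q01 hq]]] := pseries_geo hc s01.
have [|l hl _] := @geo_hassum _ (fun k => (gam k)%:C * c k * z ^+ k) (G * C) q q01; last by exists l.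
move=> k; rewrite !normcM ncX ncR -mulrA -[leRHS]mulrA; apply: ler_pM => //.
  by rewrite mulr_ge0 ?exprn_ge0 ?normc_ge0.
apply: le_trans (hq k); rewrite ler_wpM2l ?normc_ge0// lerXn2r ?nnegrE//.
by rewrite ltW//; case/andP: s01.
Qed.

Lemma geo_tail_sum (q : R) (N n : nat) : 0 <= q < 1 ->
  \sum_(N <= k < n) q ^+ k <= q ^+ N / (1 - q).
Proof.
move=> /andP[q0 q1]; have q1' : 0 < 1 - q by rewrite subr_gt0.
rewrite ler_pdivlMr//.
have [Nn|nN] := leqP N n; last by rewrite big_geq ?(ltnW nN)// mul0r exprn_ge0.
have -> : (\sum_(N <= k < n) q ^+ k) * (1 - q) = q ^+ N - q ^+ n.
  rewrite mulr_suml (eq_bigr (fun k => (- q ^+ k.+1) - (- q ^+ k))) => [|k _]; last first.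
    by rewrite exprSr; ring.
  by rewrite (telescope_sumr (fun k => - q ^+ k) Nn); ring.
by rewrite lerBlDr lerDl exprn_ge0.
Qed.

(** C and q2 depend neither on N nor on Kn. With N = 0 this gives boundedness, and with N large and
    Kn small it gives small tails. The monotone parts use [multiplier_bound], the error is summed
    term by term. *)
Lemma log_split_tail gam bet bet' err Ce q Kb : condB v ->
  log_split gam bet bet' err Ce q Kb ->
  exists C q2 : R, [/\ 0 <= C, 0 <= q2 < 1 & forall N Kn,
    (forall k, (N <= k)%N -> bet k * lg k <= Kn /\ bet' k * lg k <= Kn) ->
    forall c h H, pseries c h 1 -> wbounded v h H ->
    forall z l, normc z < 1 -> hassum (fun k => (tail_from N gam k)%:C * c k * z ^+ k) l ->
    normc l * w (normc z) <= C * (Kn + q2 ^+ N) * H].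
Proof.
move=> /multiplier_bound [C C0 hC] [hgam hni hge hKb [q01 herr]].
have [q2 [C2 [q201 hq2]]] := poly_geo q01.
have C20 : 0 <= C2 by have := hq2 0%N; rewrite !expr0 !mulr1; exact: le_trans.
have Ce0 : 0 <= Ce by have := herr 0%N; rewrite expr0 mulr1; exact: le_trans.
have /andP[q20 q21] := q201.
have q2' : 0 < 1 - q2 by rewrite subr_gt0.
pose C3 := 18 * (Ce * C2) / (1 - q2).
have C30 : 0 <= C3 by rewrite divr_ge0 ?mulr_ge0// ltW.
exists (2 * C + C3), q2; split => //; first by rewrite addr_ge0// mulr_ge0.
move=> N Kn hKn c h H hc hH z l z1 hl.
have H0 := wbounded_ge0 hH.
have wz := w_gt0 (nc_itv z1).
have lg0 n := @lg_gt0 R n.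
have bdd (b : nat -> R) : (forall n, b n.+1 <= b n) -> (forall n, 0 <= b n) ->
    forall k, `|tail_from N b k| <= b 0%N.
  move=> bn b0 k; rewrite /tail_from; case: ifP => _; last by rewrite normr0.
  by rewrite ger0_norm//; elim: k => // k; exact: le_trans.
have [l1 hl1] := mult_hassum hc (bdd bet (fun n => (hni n).1) (fun n => (hge n).1)) z1.
have [l2 hl2] := mult_hassum hc (bdd bet' (fun n => (hni n).2) (fun n => (hge n).2)) z1.
have b1 := hC c h H bet N Kn hc hH (fun k _ => (hni k).1) (fun k _ => (hge k).1) (fun k Nk => (hKn k Nk).1) z l1 z1 hl1.
have b2 := hC c h H bet' N Kn hc hH (fun k _ => (hni k).2) (fun k _ => (hge k).2) (fun k Nk => (hKn k Nk).2) z l2 z1 hl2.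
have hl3 : hassum (fun k => (tail_from N err k)%:C * c k * z ^+ k) (l - l1 + l2).
  apply: hassum_ext (hassumD (hassumB hl hl1) hl2) => k.
  rewrite /tail_from; case: ifP => _; last by rewrite !mul0r subr0 addr0.
  by rewrite hgam rmorphD rmorphB/=; ring.
have b3 : normc (l - l1 + l2) * w (normc z) <= C3 * q2 ^+ N * H.
  rewrite -ler_pdivlMr//; apply: (hassum_bounded hl3) => n.
  apply: le_trans (nc_sum _ _ _) _.
  apply: (@le_trans _ _ (\sum_(N <= k < n) 18 * (Ce * C2) * H / w (normc z) * q2 ^+ k)); last first.
    rewrite -mulr_sumr; apply: le_trans (ler_wpM2l _ (geo_tail_sum N n q201)) _.
      by rewrite divr_ge0 ?(ltW wz)// !mulr_ge0.
    rewrite le_eqVlt; apply/orP; left; apply/eqP; rewrite /C3; field.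
    by rewrite !gt_eqF.
  have [Nn|nN] := leqP N n; last first.
    rewrite [leRHS]big_geq ?(ltnW nN)// big_nat big1// => k /andP[_ kn].
    by rewrite /tail_from leqNgt (ltn_trans kn nN)/= !mul0r normc0.
  rewrite (@big_cat_nat _ _ _ N)//= [X in X + _]big_nat big1 ?add0r; last first.
    by move=> k /andP[_ kN]; rewrite /tail_from leqNgt kN/= !mul0r normc0.
  rewrite !big_nat; apply: ler_sum => k /andP[Nk _].
  rewrite /tail_from Nk -mulrA normcM ncR.
  have h1 := coef_wbound k hc hH z1.
  rewrite -ler_pdivlMr// in h1.
  apply: le_trans (ler_pM (normr_ge0 _) (normc_ge0 _) (herr k) h1) _.
  have -> : Ce * q ^+ k * (18 * k.+1%:R ^+ 2 * H / w (normc z)) =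
     (18 * Ce * H / w (normc z)) * (k.+1%:R ^+ 2 * q ^+ k) by ring.
  have -> : 18 * (Ce * C2) * H / w (normc z) * q2 ^+ k =
     (18 * Ce * H / w (normc z)) * (C2 * q2 ^+ k) by ring.
  by rewrite ler_wpM2l// divr_ge0 ?(ltW wz)// !mulr_ge0.
have -> : l = (l - l1 + l2) + l1 - l2 by ring.
apply: le_trans (ler_wpM2r (ltW wz) (ncB _ _)) _.
rewrite mulrDl; apply: le_trans (lerD (ler_wpM2r (ltW wz) (ncD _ _)) (lexx _)) _.
rewrite mulrDl; apply: le_trans (lerD (lerD b3 b1) b2) _.
have Kn0 : 0 <= Kn.
  apply: le_trans (hKn N (leqnn N)).1; rewrite mulr_ge0 ?(ltW (lg0 _))//.
  by have [] := hge N.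
have Q0 : 0 <= q2 ^+ N by rewrite exprn_ge0.
rewrite -subr_ge0.
have -> : (2 * C + C3) * (Kn + q2 ^+ N) * H - (C3 * q2 ^+ N * H + C * Kn * H + C * Kn * H) =
  C3 * Kn * H + 2 * C * q2 ^+ N * H by ring.
by clearbody C3; apply: addr_ge0; apply: mulr_ge0 => //; apply: mulr_ge0 => //; apply: mulr_ge0.
Qed.

Lemma Hinfty_holo (h : Hinfty v) z : normc z < 1 -> exists d, cdiff h z d.
Proof.
move=> z1; have := Hinfty_funP h; rewrite Hinfty_predP inE => -[hh _ _].
by apply: derivable_cdiff; exact: hh.
Qed.

Lemma Hinfty_off (h : Hinfty v) z : ~ normc z < 1 -> h z = 0.
Proof. by have := Hinfty_funP h; rewrite Hinfty_predP inE => -[_ _ h0] /h0. Qed.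

Lemma Hinfty_pseries (h : Hinfty v) : pseries (taylor_coef h) h 1.
Proof. by apply: holo_pseries => z; exact: Hinfty_holo. Qed.

Lemma Hinfty_wbounded (h : Hinfty v) : wbounded v h (Hnorm h).
Proof. by move=> z z1; rewrite /weight_ext z1; exact: Hnorm_ub. Qed.

Lemma Hinfty_of_pseries c h (H : R) : pseries c h 1 -> wbounded v h H ->
  (forall z, ~ normc z < 1 -> h z = 0) -> (h : Cplx R -> Cplx R) \in Hinfty_pred v.
Proof.
move=> hc hH h0; rewrite Hinfty_predP inE; split => //.
- move=> z z1; have [d _] := pseries_deriv hc z1; exact: cdiff_derivable.
- exists H => _ [z z1 <-].
  have := hH z z1; rewrite /weight_ext.
  by rewrite (_ : normc z < 1 = true).
Qed.

(** The chosen sum is unique by [hassum_unique]; the value 0 off the disc is required for membership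
    in [Hinfty]. *)
Definition psum c z : R[i] :=
  if normc z < 1 then xget 0 [set l | hassum (fun k => c k * z ^+ k) l] else 0.

Lemma psum_pseries c : (forall z, normc z < 1 -> exists l, hassum (fun k => c k * z ^+ k) l) ->
  pseries c (psum c) 1.
Proof. by move=> hc z z1; rewrite /psum z1; case: xgetP => [l _ //|]; have [l hl] := hc z z1 => /(_ l)/(_ hl). Qed.

Lemma psum_off c z : ~ normc z < 1 -> psum c z = 0.
Proof. by move=> /negP/negbTE; rewrite /psum => ->. Qed.

Section Operator.
Variables (gam : nat -> R) (G M : R).
Hypothesis gamG : forall k, `|gam k| <= G.
Hypothesis gamM : forall c h H, pseries c h 1 -> wbounded v h H ->
  forall z l, normc z < 1 -> hassum (fun k => (gam k)%:C * c k * z ^+ k) l ->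
  normc l * w (normc z) <= M * H.

Definition mcoef (h : Hinfty v) k : R[i] := (gam k)%:C * taylor_coef h k.

Lemma mult_pseries (h : Hinfty v) : pseries (mcoef h) (psum (mcoef h)) 1.
Proof. by apply: psum_pseries; apply: mult_hassum gamG; exact: Hinfty_pseries. Qed.

Lemma mult_wbounded (h : Hinfty v) : wbounded v (psum (mcoef h)) (M * Hnorm h).
Proof.
by move=> z z1; apply: (gamM (Hinfty_pseries h) (Hinfty_wbounded h) z1); exact: mult_pseries.
Qed.

Definition multop (h : Hinfty v) : Hinfty v :=
  MkHinfty (Hinfty_of_pseries (mult_pseries h) (mult_wbounded h) (@psum_off (mcoef h))).

Lemma multopE (h : Hinfty v) z : normc z < 1 ->
  hassum (fun k => (gam k)%:C * taylor_coef h k * z ^+ k) (multop h z).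
Proof. exact: mult_pseries. Qed.

Lemma taylor_coef_comb (a : R[i]) (f g : Hinfty v) k :
  taylor_coef (a *: f + g) k = a * taylor_coef f k + taylor_coef g k.
Proof.
have h : pseries (fun k => a * taylor_coef f k + taylor_coef g k) (a *: f + g) 1.
  move=> z z1; have -> : (a *: f + g) z = a * f z + g z by [].
  apply: hassum_ext (hassumD (hassumZ a (Hinfty_pseries f z1)) (Hinfty_pseries g z1)) => j.
  by ring.
exact: (taylor_coef_pseries k ltr01 h).
Qed.

Lemma multop_linear : linear multop.
Proof.
move=> a f g; apply: val_inj; apply/funext => z.
have -> : val (a *: multop f + multop g) z = a * multop f z + multop g z by [].
have [z1|z1] := pselect (normc z < 1); last first.
  rewrite (Hinfty_off (multop f) z1) (Hinfty_off (multop g) z1) mulr0 addr0.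
  exact: (Hinfty_off (multop (a *: f + g)) z1).
apply: (hassum_unique (multopE _ z1)).
apply: hassum_ext (hassumD (hassumZ a (multopE f z1)) (multopE g z1)) => k.
by rewrite taylor_coef_comb; ring.
Qed.

Lemma multop_norm (h : Hinfty v) : Hnorm (multop h) <= M * Hnorm h.
Proof.
apply: Hnorm_le => z z1; have := mult_wbounded h z1.
by rewrite /weight_ext (_ : normc z < 1 = true).
Qed.

End Operator.

End MultiplierOperator.

(** * Limits along ultrafilters *)

Section UltraLimits.
Context {R : realType} {T : Type} {U : set_system T} {UF : UltraFilter U}.

(** Compactness of [- C, C] provides a cluster point, and an ultrafilter converges to its cluster
    points: otherwise it would contain the complement of a ball around l. *)
Lemma ultra_lim_real (phi : T -> R) (C : R) : U [set t | `|phi t| <= C] ->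
  exists l, forall e : R, 0 < e -> U [set t | `|phi t - l| < e].
Proof.
move=> UC.
have PF : ProperFilter (phi x @[x --> U]) by exact: fmap_proper_filter.
have sub : [set t | `|phi t| <= C] `<=` phi @^-1` `[- C, C].
  by move=> t /= ht; rewrite in_itv/= -ler_norml.
have [l [_ hl]] := @segment_compact R (- C) C (phi x @[x --> U]) PF (filterS sub UC).
exists l => e e0.
have [//|hc] := in_ultra_setVsetC [set t | `|phi t - l| < e] UF.
have sub' : ~` [set t | `|phi t - l| < e] `<=` phi @^-1` [set y | e <= `|y - l|].
  by move=> t /= /negP; rewrite -leNgt.
have [y [/= ye yl]] := hl [set y | e <= `|y - l|] (ball l e) (filterS sub' hc)
  (nbhsx_ballx l e e0).
by move: ye; rewrite leNgt -distrC (yl : `|l - y| < e).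
Qed.

Lemma ultra_lim_cplx (phi : T -> R[i]) (C : R) : U [set t | normc (phi t) <= C] ->
  exists l, forall e : R, 0 < e -> U [set t | normc (phi t - l) < e].
Proof.
move=> UC.
have [|a ha] := @ultra_lim_real (fun t => complex.Re (phi t)) C.
  by apply: (filterS _ UC) => t /=; exact: le_trans (nc_Re _).
have [|b hb] := @ultra_lim_real (fun t => complex.Im (phi t)) C.
  by apply: (filterS _ UC) => t /=; exact: le_trans (nc_Im _).
exists (a +i* b) => e e0; have e20 : 0 < e / 2 by rewrite divr_gt0.
apply: (filterS2 _ _ (ha _ e20) (hb _ e20)) => t /= h1 h2.
by apply: le_lt_trans (ncRI _) _; rewrite ReB ImB/= (splitr e) ltrD.
Qed.

Lemma filter_forall_lt (P : nat -> T -> Prop) n : (forall k, U [set t | P k t]) ->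
  U [set t | forall k, (k < n)%N -> P k t].
Proof.
move=> h; elim: n => [|n IH]; first by apply: filterE => t k.
apply: (filterS2 _ _ IH (h n)) => t /= h1 h2 k; rewrite ltnS leq_eqVlt => /predU1P[->//|].
exact: h1.
Qed.

End UltraLimits.

(** * Compactness of multipliers with small tails *)

Section Compactness.
Context {R : realType}.
Variable v : weight R.
Let w := weight_ext v.

Let w_gt0 s : 0 <= s < 1 -> 0 < w s. Proof. exact: weight_ext_gt0. Qed.

Let nc_itv (z : R[i]) : normc z < 1 -> 0 <= normc z < 1.
Proof. by move=> ->; rewrite normc_ge0. Qed.

(** C and q are found before the sequence c, so the tails at z are small uniformly over a ball of
    H_v^oo. *)
Lemma coef_geo (M : R) (z : R[i]) : 0 <= M -> normc z < 1 -> exists C q : R, 0 <= q < 1 /\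
  forall c : nat -> R[i],
  (forall k (y : R[i]), normc y < 1 -> normc (c k * y ^+ k) * w (normc y) <= 18 * k.+1%:R ^+ 2 * M) ->
  forall k, normc (c k * z ^+ k) <= C * q ^+ k.
Proof.
move=> M0 z1; have z0 := normc_ge0 z; pose s := (normc z + 1) / 2.
have s01 : 0 < s < 1 by rewrite /s; lra.
have /andP[s0 s1] := s01.
have q01 : 0 <= normc z / s < 1 by rewrite divr_ge0 ?(ltW s0)//= ltr_pdivrMr// mul1r /s; lra.
have [q2 [C2 [q201 hq2]]] := poly_geo q01.
have sn : normc s%:C = s by rewrite ncR gtr0_norm.
have ws : 0 < w s by rewrite w_gt0// ltW.
exists (18 * M / w s * C2), q2; split => // c hc k.
have := hc k s%:C; rewrite sn => /(_ s1); rewrite normcM ncX sn -ler_pdivlMr// => h.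
have -> : normc (c k * z ^+ k) = normc (c k) * s ^+ k * (normc z / s) ^+ k.
  by rewrite normcM ncX -mulrA -exprMn [s * _]mulrC divfK// gt_eqF.
apply: le_trans (ler_wpM2r _ h) _; first by rewrite exprn_ge0//; case/andP: q01.
have -> : 18 * k.+1%:R ^+ 2 * M / w s * (normc z / s) ^+ k =
  (18 * M / w s) * (k.+1%:R ^+ 2 * (normc z / s) ^+ k) by ring.
by rewrite -[leRHS]mulrA ler_wpM2l// divr_ge0 ?(ltW ws)// mulr_ge0.
Qed.

(* Montel's theorem for the coefficientwise convergence. *)
Lemma ball_limit (M : R) (U : set_system (Hinfty v)) : UltraFilter U -> 0 <= M ->
  U [set h | Hnorm h <= M] ->
  exists2 h0 : Hinfty v, Hnorm h0 <= M & forall k (e : R), 0 < e ->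
    U [set h : Hinfty v | normc (taylor_coef h k - taylor_coef h0 k) < e].
Proof.
move=> UF M0 UM.
have hB (h : Hinfty v) : Hnorm h <= M -> wbounded v h M.
  by move=> hM z z1; apply: le_trans hM; exact: Hinfty_wbounded.
have cB (h : Hinfty v) : Hnorm h <= M -> forall k (y : R[i]), normc y < 1 ->
    normc (taylor_coef h k * y ^+ k) * w (normc y) <= 18 * k.+1%:R ^+ 2 * M.
  by move=> hM k y y1; apply: coef_wbound => //; [exact: Hinfty_pseries|exact: hB].
have w2 : 0 < w 2^-1 by apply: w_gt0; lra.
have ex k : exists l : R[i], forall e : R, 0 < e ->
    U [set h : Hinfty v | normc (taylor_coef h k - l) < e].
  apply: (@ultra_lim_cplx _ _ _ _ _ (18 * k.+1%:R ^+ 2 * M / w 2^-1 / 2^-1 ^+ k)).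
  apply: (filterS _ UM) => h /= hM.
  have n2 : normc (2^-1 : R)%:C = 2^-1 by rewrite ncR ger0_norm.
  have := cB h hM k (2^-1)%:C; rewrite n2 normcM ncX n2 => /(_ ltac:(lra)).
  by rewrite -ler_pdivlMr// -ler_pdivlMr ?exprn_gt0.
have [c hc] := choice ex.
have cc k (z : R[i]) : normc z < 1 -> normc (c k * z ^+ k) * w (normc z) <= 18 * k.+1%:R ^+ 2 * M.
  move=> z1; have wz := w_gt0 (nc_itv z1).
  apply/ler_addgt0Pr => e e0.
  have [h [/= h1 h2]] := filter_ex (filterI UM (hc k _ (divr_gt0 e0 wz))).
  have h3 := cB h h1 k z z1.
  have zk : normc z ^+ k <= 1 by rewrite exprn_ile1// ?normc_ge0 ?ltW.
  have h4 : normc (c k * z ^+ k - taylor_coef h k * z ^+ k) <= e / w (normc z).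
    rewrite -mulrBl normcM ncX nc_distC -[leRHS]mulr1.
    by apply: ler_pM; rewrite ?normc_ge0 ?exprn_ge0 ?normc_ge0// ltW.
  apply: le_trans (ler_wpM2r (ltW wz) (nc_triB _ (taylor_coef h k * z ^+ k))) _.
  rewrite mulrDl; apply: lerD => //.
  by rewrite -ler_pdivlMr.
have cps : pseries c (psum c) 1.
  apply: psum_pseries => z z1; have [C [q [q01 hq]]] := coef_geo M0 z1.
  by have [l hl _] := geo_hassum q01 (hq c (fun k y => @cc k y)); exists l.
have cwb : wbounded v (psum c) M.
  move=> z z1; have wz := w_gt0 (nc_itv z1).
  rewrite -ler_pdivlMr//; apply/ler_addgt0Pr => e e0.
  have e40 : 0 < e / 4 by rewrite divr_gt0.
  have [C [q [q01 hq]]] := coef_geo M0 z1.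
  have [n /(_ n (leqnn n)) hn] := geo_small (2 * (C / (1 - q))) q01 e40.
  have tl (d : nat -> R[i]) f : pseries d f 1 ->
      (forall k (y : R[i]), normc y < 1 -> normc (d k * y ^+ k) * w (normc y) <= 18 * k.+1%:R ^+ 2 * M) ->
      normc (f z - \sum_(0 <= k < n) d k * z ^+ k) <= e / 4.
    move=> hd dB; have [l hl hl2] := geo_hassum q01 (hq d dB).
    rewrite (hassum_unique (hd z z1) hl); apply: le_trans (hl2 n) _; exact: ltW.
  have e'0 : 0 < e / (4 * n.+1%:R) by rewrite divr_gt0// mulr_gt0.
  (* Some h in the ball agrees with c on the first n coefficients up to e / 4 in total; with two
     tails of at most e / 4 each, its bound M passes to the limit. *)
  have [h [/= h1 h2]] := filter_ex (filterI UM
    (filter_forall_lt n (fun k => hc k _ e'0))).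
  have t1 := tl c (psum c) cps (fun k y => @cc k y).
  have t2 := tl (taylor_coef h) h (Hinfty_pseries h) (cB h h1).
  have t3 : normc (\sum_(0 <= k < n) c k * z ^+ k - \sum_(0 <= k < n) taylor_coef h k * z ^+ k) <= e / 4.
    rewrite -sumrB; apply: le_trans (nc_sum _ _ _) _.
    apply: (@le_trans _ _ (\sum_(0 <= k < n) e / (4 * n.+1%:R))).
      rewrite !big_nat; apply: ler_sum => k /andP[_ kn].
      rewrite -mulrBl normcM ncX nc_distC -[leRHS]mulr1.
      apply: ler_pM; rewrite ?normc_ge0 ?exprn_ge0 ?normc_ge0//; first exact/ltW/h2.
      by rewrite exprn_ile1// ?normc_ge0 ?ltW.
    rewrite sumr_const_nat subn0 -[leLHS]mulr_natr.
    have n1 : n%:R <= n.+1%:R :> R by rewrite ler_nat.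
    have n0 : 0 < n.+1%:R :> R by rewrite ltr0n.
    rewrite [X in X <= _]mulrAC ler_pdivrMr ?mulr_gt0//.
    have -> : e / 4 * (4 * n.+1%:R) = e * n.+1%:R by field.
    by rewrite ler_wpM2l// ltW.
  have t4 : normc (h z) <= M / w (normc z) by rewrite ler_pdivlMr//; exact: hB.
  set Sc := \sum_(0 <= k < n) c k * z ^+ k in t1 t3.
  set Sh := \sum_(0 <= k < n) _ in t2 t3.
  have -> : psum c z = (psum c z - Sc) + (Sc - Sh) + (h z - (h z - Sh)) by ring.
  apply: le_trans (ncD _ _) _; apply: le_trans (lerD (ncD _ _) (ncB _ _)) _.
  lra.
pose h0 := MkHinfty (Hinfty_of_pseries cps cwb (@psum_off _ c)).
exists h0.
  by apply: Hnorm_le => z z1; have := cwb z z1; rewrite /weight_ext (_ : normc z < 1 = true).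
move=> k e e0; apply: (filterS _ (hc k e e0)) => h /=.
by rewrite (taylor_coef_pseries k ltr01 (cps : pseries c h0 1)).
Qed.

Lemma weight_ext_bounded : exists2 W : R, 0 <= W & forall r, 0 <= r < 1 -> w r <= W.
Proof.
have [B B0 hB] := radial_bounded v.
exists (Num.max B (w 0)); first by rewrite le_max ltW.
move=> r /andP[r0 r1]; rewrite le_max.
move: r0; rewrite le_eqVlt => /predU1P[<-|r0]; first by rewrite lexx orbT.
by rewrite /w /weight_ext r1 hB// r0.
Qed.

(** Coefficientwise convergence of h to h0 in a ball becomes norm convergence of T h: finitely many
    coefficients control the head, and the tail is small uniformly on the ball. So the image of a
    closed ball is compact. *)
Lemma compact_of_small_tails (gam : nat -> R) (G : R) (T : {linear Hinfty v -> Hinfty v}) :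
  (forall k, `|gam k| <= G) ->
  (forall (h : Hinfty v) (z : R[i]), normc z < 1 ->
    hassum (fun k => (gam k)%:C * taylor_coef h k * z ^+ k) (T h z)) ->
  (forall eps : R, 0 < eps -> exists N, forall (h : Hinfty v) (z l : R[i]), normc z < 1 ->
    hassum (fun k => (tail_from N gam k)%:C * taylor_coef h k * z ^+ k) l ->
    normc l * w (normc z) <= eps * Hnorm h) ->
  compact_operator (T : Hinfty v -> Hinfty v).
Proof.
move=> hG hT htail A [x [xreal hx]].
have [x0 xE] : exists x0, x = x0%:C.
  by exists (complex.Re x); apply/esym; exact: RRe_real.
pose M := Num.max 0 (x0 + 1).
have M0 : 0 <= M by rewrite le_max lexx.
have AM h : A h -> Hnorm h <= M.
  move=> Ah; have := hx (x0 + 1)%:C; rewrite xE ltcR ltrDl => /(_ ltr01 h Ah).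
  by rewrite /= HnormE lecR => h1; rewrite le_max h1 orbT.
exists (T @` [set h | Hnorm h <= M]).
  by move=> _ [h Ah <-]; exists h => //=; exact: AM.
suff cK : compact (T @` [set h | Hnorm h <= M]).
  by split=> //; apply: compact_closed cK; exact: norm_hausdorff.
move=> F FF FK.
(* The pullback of F along T, restricted to the ball; an ultrafilter above it supplies the
   coefficientwise limit. *)
pose G0 : set_system (Hinfty v) := [set E | exists2 D, F D & forall h, Hnorm h <= M -> D (T h) -> E h].
have G0F : Filter G0.
  split.
  - by exists setT; [exact: filterT|].
  - move=> P Q [D FD hD] [D' FD' hD']; exists (D `&` D'); first exact: filterI.
    by move=> h hM [d1 d2]; split; [exact: hD|exact: hD'].
  - by move=> P Q PQ [D FD hD]; exists D => // h hM /hD h1; exact/PQ/h1.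
have G0P : ProperFilter G0.
  split=> //; move=> [D FD hD].
  have [y [Dy [h hM hy]]] := filter_ex (filterI FD FK).
  by apply: (hD h hM); rewrite hy.
have [U [UF GU]] := ultraFilterLemma G0P.
have UM : U [set h | Hnorm h <= M] by apply: GU; exists setT; [exact: filterT|move=> h].
have [h0 h0M hlim] := ball_limit UF M0 UM.
have [W W0 hW] := weight_ext_bounded.
have conv (e : R) : 0 < e -> U [set h | Hnorm (T h - T h0) <= e].
  (* Half of e is for the tail of h - h0, whose norm is at most 2 M, and half for the head through
     [del]; the summands 1 keep the denominators positive. *)
  move=> e0; pose eps := e / (2 * (2 * M + 1)).
  have M1 : 0 < 2 * M + 1 by lra.
  have eps0 : 0 < eps by rewrite divr_gt0// mulr_gt0.
  have [N hN] := htail eps eps0.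
  have GW0 : 0 <= (`|G| + 1) * (W + 1) * N.+1%:R by rewrite !mulr_ge0// addr_ge0.
  pose del := e / (2 * ((`|G| + 1) * (W + 1) * N.+1%:R + 1)).
  have del0 : 0 < del by rewrite divr_gt0// mulr_gt0// ltr_wpDl.
  apply: (filterS2 _ _ UM (filter_forall_lt N (fun k => hlim k del del0))) => h /= hM hk.
  rewrite -raddfB; set f := h - h0.
  have fM : Hnorm f <= 2 * M.
    have : (Hnorm f)%:C <= (Hnorm h)%:C + (Hnorm h0)%:C by rewrite -!HnormE; exact: ler_normB.
    rewrite -rmorphD lecR => hh; apply: le_trans hh _; lra.
  have fk k : (k < N)%N -> normc (taylor_coef f k) <= del.
    move=> kN; apply/ltW; have := hk k kN.
    have -> : taylor_coef f k = taylor_coef h k - taylor_coef h0 k.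
      rewrite /f (_ : h - h0 = (-1) *: h0 + h); last by rewrite scaleN1r addrC.
      by rewrite taylor_coef_comb mulN1r addrC.
    by [].
  apply: Hnorm_le => z z1.
  have -> : v (normc z)%:C = w (normc z).
    by rewrite /w /weight_ext (_ : normc z < 1 = true).
  have wz := w_gt0 (nc_itv z1).
  pose Sn := \sum_(0 <= k < N) (gam k)%:C * taylor_coef f k * z ^+ k.
  have htl : hassum (fun k => (tail_from N gam k)%:C * taylor_coef f k * z ^+ k) (T f z - Sn).
    move=> d d0; have [n0 hn0] := hT f z z1 d d0.
    exists (maxn n0 N) => n; rewrite geq_max => /andP[/hn0 h1 Nn].
    suff -> : \sum_(0 <= k < n) (tail_from N gam k)%:C * taylor_coef f k * z ^+ k =
        \sum_(0 <= k < n) (gam k)%:C * taylor_coef f k * z ^+ k - Sn by rewrite opprB addrA subrK.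
    rewrite !(@big_cat_nat _ _ _ N 0 n)//= [X in X + _]big_nat big1 ?add0r; last first.
      by move=> k /andP[_ kN]; rewrite /tail_from leqNgt kN/= !mul0r.
    rewrite -/Sn addrC addrK; apply: eq_big_nat => k /andP[Nk _].
    by rewrite /tail_from Nk.
  have b1 := hN f z _ z1 htl.
  have b2 : normc Sn * w (normc z) <= e / 2.
    apply: (@le_trans _ _ (\sum_(0 <= k < N) (`|G| + 1) * del * (W + 1))).
      rewrite -ler_pdivlMr// mulr_suml; apply: le_trans (nc_sum _ _ _) _.
      rewrite !big_nat; apply: ler_sum => k /andP[_ kN].
      rewrite ler_pdivlMr// (normcM _ (z ^+ k)) (normcM (gam k)%:C) ncX ncR.
      have g1 : `|gam k| <= `|G| + 1.
        by apply: le_trans (hG k) _; apply: le_trans (ler_norm _) _; rewrite lerDl.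
      have zk : normc z ^+ k <= 1 by rewrite exprn_ile1// ?normc_ge0 ?ltW.
      have w1 : w (normc z) <= W + 1 by apply: le_trans (hW _ (nc_itv z1)) _; rewrite lerDl.
      apply: ler_pM => //; rewrite ?mulr_ge0 ?exprn_ge0 ?normc_ge0 ?(ltW wz)//.
      rewrite -[leRHS]mulr1; apply: ler_pM => //; rewrite ?mulr_ge0 ?exprn_ge0 ?normc_ge0//.
      by apply: ler_pM => //; [exact: normc_ge0|exact: fk].
    rewrite sumr_const_nat subn0 -[leLHS]mulr_natr.
    have Nn : N%:R <= N.+1%:R :> R by rewrite ler_nat.
    apply: (@le_trans _ _ ((`|G| + 1) * del * (W + 1) * N.+1%:R)).
      have GA := normr_ge0 G; rewrite ler_wpM2l//.
      by apply: mulr_ge0; [apply: mulr_ge0; [exact: addr_ge0|exact: ltW]|exact: addr_ge0].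
    have -> : (`|G| + 1) * del * (W + 1) * N.+1%:R = del * ((`|G| + 1) * (W + 1) * N.+1%:R) by ring.
    move: GW0; set Z := (`|G| + 1) * (W + 1) * N.+1%:R => GW0.
    rewrite /del -/Z mulrAC ler_pdivrMr; last by rewrite mulr_gt0// ltr_wpDl.
    have -> : e / 2 * (2 * (Z + 1)) = e * Z + e by field.
    by rewrite lerDl ltW.
  have b3 : eps * Hnorm f <= e / 2.
    apply: le_trans (ler_wpM2l (ltW eps0) fM) _.
    rewrite /eps mulrAC ler_pdivrMr ?mulr_gt0//.
    have -> : e / 2 * (2 * (2 * M + 1)) = e * (2 * M) + e by field.
    by rewrite lerDl ltW.
  have -> : T f z = (T f z - Sn) + Sn by rewrite subrK.
  apply: le_trans (ler_wpM2r (ltW wz) (ncD _ _)) _; rewrite mulrDl.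
  by apply: le_trans (lerD (le_trans b1 b3) b2) _; lra.
exists (T h0); split; first by exists h0.
move=> D V FD /nbhs_ballP [d /posC_real [d' d'0 ->] hV].
have U1 : U [set h | D (T h)] by apply: GU; exists D.
have [h [/= h1 h2]] := filter_ex (filterI U1 (conv _ (divr_gt0 d'0 (@ltr0Sn R 1)))).
exists (T h); split => //; apply: hV.
rewrite -ball_normE /ball_ /= HnormE ltcR.
have -> : Hnorm (T h0 - T h) = Hnorm (T h - T h0).
  by apply: (@complexI R); rewrite -!HnormE distrC.
by apply: le_lt_trans h2 _; lra.
Qed.

End Compactness.

(** * The Toeplitz operator *)

Section ToeplitzOperator.
Context {R : realType}.
Variable v : weight R.
Notation I01 := (`]0, 1[%classic : set R).

Lemma log_split_opp (gam bet bet' err : nat -> R) (Ce q Kb : R) :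
  log_split gam bet bet' err Ce q Kb ->
  log_split (fun n => - gam n) bet' bet (fun n => - err n) Ce q Kb.
Proof.
move=> [h1 h2 h3 h4 [q01 h5]]; split=> [n|n|n|n|].
- by rewrite h1; ring.
- by have [] := h2 n.
- by have [] := h3 n.
- by have [] := h4 n.
- by split=> // n; rewrite normrN.
Qed.

(** A lower bound on A' is an upper bound on the derivative of - A, and negating the symbol
    exchanges the two monotone parts. *)
Lemma symbol_split (A : R -> R) (delta : R) : moment_ratio_bounded v ->
  measurable_fun I01 A -> 0 < delta < 1 ->
  (forall r, delta <= r < 1 -> derivable A r 1) ->
  (limf_esup (fun r => (derive1 A r)%:E) 1^'- < +oo)%E \/
  (-oo < limf_einf (fun r => (derive1 A r)%:E) 1^'-)%E ->
  (limf_esup (fun r => `|A r * ln (1 - r)|%:E) 1^'- < +oo)%E ->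
  exists bet bet' err Ce q Kb,
    log_split (fun n => wavg v n.*2.+1 A) bet bet' err Ce q Kb /\
    (limf_esup (fun r => `|A r * ln (1 - r)|%:E) 1^'- = 0%E ->
     forall eta, 0 < eta -> exists N, forall k, (N <= k)%N ->
       bet k * lg k <= eta /\ bet' k * lg k <= eta).
Proof.
move=> hv mA d01 dA hder hA.
have /andP[d0 d1] := d01.
have [r2 [K [r21 hK]]] := limf_esup_left_lty hA.
have small : limf_esup (fun r => `|A r * ln (1 - r)|%:E) 1^'- = 0%E ->
    forall eta, 0 < eta -> exists2 r2, r2 < 1 & forall r, r2 < r < 1 -> `|A r * ln (1 - r)| <= eta.
  by move=> h0 eta eta0; exact: limf_esup_left_le.
case: hder => [/limf_esup_left_lty [r1 [K0 [r11 hK0]]]|hinf].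
  have [||bet [bet' [err [Ce [q [Kb [h1 h2]]]]]]] := @symbol_split_side _ v A delta K0 hv mA d01 dA.
  - by exists r1.
  - by exists r2, K.
  by exists bet, bet', err, Ce, q, Kb; split => // /small/h2.
have hsup : (limf_esup (fun r => (- derive1 A r)%:E) 1^'- < +oo)%E.
  by move: hinf; rewrite /limf_einf lteNr.
have [r1 [K0 [r11 hK0]]] := limf_esup_left_lty hsup.
have mAN : measurable_fun I01 (fun r => - A r) by exact: measurableT_comp.
have nA r : `|- A r * ln (1 - r)| = `|A r * ln (1 - r)| by rewrite mulNr normrN.
have [|||bet [bet' [err [Ce [q [Kb [h1 h2]]]]]]] :=
    @symbol_split_side _ v (fun r => - A r) delta K0 hv mAN d01.
- by move=> r hr; apply: derivableN; exact: dA.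
(* Beyond delta differentiability is available, so that the derivative of - A is - A'. *)
- exists (Num.max r1 delta) => [|r /andP[]]; first by rewrite gt_max r11.
  rewrite gt_max => /andP[rr1 rd] r1'.
  have dAr : derivable A r 1 by apply: dA; rewrite ltW.
  by rewrite derive1E deriveN// -derive1E hK0// rr1.
- by exists r2, K; split=> // r /hK; rewrite nA.
exists bet', bet, (fun n => - err n), Ce, q, Kb; split.
  have -> : (fun n => wavg v n.*2.+1 A) = (fun n => - wavg v n.*2.+1 (fun r => - A r)).
    by apply/funext => n; rewrite wavg_opp// opprK.
  exact: log_split_opp.
move=> /small sm eta eta0.
have [|N hN] := h2 _ eta eta0; last by exists N => k /hN [].
by move=> e /sm [r3 r31 h3]; exists r3 => // r /h3; rewrite nA.
Qed.

Lemma measurable_disc_xy : measurable (@disc_xy R).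
Proof.
have -> : @disc_xy R = (fun p : R * R => p.1 ^+ 2 + p.2 ^+ 2) @^-1` `]-oo, 1[.
  apply/seteqP; split => -[x y]; rewrite /disc_xy /disc /= in_itv/=.
    by rewrite -[X in _ < X -> _]sqrtr1 ltr_sqrt.
  by rewrite -[X in _ -> _ < X]sqrtr1 ltr_sqrt.
rewrite -[X in measurable X]setTI.
have m1 : measurable_fun setT (fun p : R * R => p.1 ^+ 2 + p.2 ^+ 2).
  by apply: measurable_funD; apply: measurable_funX; [exact: measurable_fst|exact: measurable_snd].
by apply: m1 => //; exact: measurable_itv.
Qed.

(** The radius is a null set of the plane, but measurability passes to it by composition with the
    measurable map r |-> (r, 0). *)
Lemma L1_disc_radial_measurable (a : Cplx R -> R) : L1_disc a -> measurable_fun I01 (radial_part a).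
Proof.
move=> /measurable_int /measurable_EFinP ma.
have mr : measurable_fun I01 (fun r : R => (r, 0 : R)).
  apply: measurable_funTS; exact: measurable_fun_pair.
have : measurable_fun I01 ((fun p : R * R => a (p.1 +i* p.2)) \o (fun r : R => (r, 0 : R))).
  apply: (measurable_comp measurable_disc_xy _ ma mr).
  move=> _ [r /= + <-]; rewrite in_itv/= => /andP[r0 r1].
  by change (normc r%:C < 1); rewrite ncR gtr0_norm.
by [].
Qed.

Lemma toeplitz_operator (a : Cplx R -> R) (bet bet' err : nat -> R) (Ce q Kb : R) : condB v ->
  log_split (toeplitz_coef v a) bet bet' err Ce q Kb ->
  exists T : {linear Hinfty v -> Hinfty v}, [/\ is_toeplitz a T, bounded_operator T &
    (forall eta, 0 < eta -> exists N, forall k, (N <= k)%N ->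
       bet k * lg k <= eta /\ bet' k * lg k <= eta) -> compact_operator T].
Proof.
move=> hB hs; have [C [q2 [C0 q201 htail]]] := log_split_tail hB hs.
have [hgam hni hge hKb [/andP[q0 q1] herr]] := hs.
pose gam := toeplitz_coef v a.
have hG k : `|gam k| <= bet 0%N + bet' 0%N + Ce.
  have mono (b : nat -> R) : (forall n, b n.+1 <= b n) -> b k <= b 0%N.
    by move=> hb; elim: k => // k; exact: le_trans.
  have b1 := mono bet (fun n => (hni n).1); have b2 := mono bet' (fun n => (hni n).2).
  have [g1 g2] := hge k.
  have Ce0 : 0 <= Ce by have := herr 0%N; rewrite expr0 mulr1; exact: le_trans.
  have e1 : `|err k| <= Ce.
    by apply: le_trans (herr k) _; rewrite ler_piMr// exprn_ile1// ltW.
  rewrite /gam hgam; apply: le_trans (ler_normD _ _) _; apply: lerD => //.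
  by apply: le_trans (ler_normB _ _) _; rewrite !ger0_norm// lerD.
have hM c h (H : R) : pseries c h 1 -> wbounded v h H ->
    forall z l, normc z < 1 -> hassum (fun k => (gam k)%:C * c k * z ^+ k) l ->
    normc l * weight_ext v (normc z) <= C * (Kb + 1) * H.
  move=> hc hb z l z1 hl.
  (* The tail from 0 is the whole sequence, and the summand 1 is q2^0. *)
  exact: (htail 0%N Kb (fun k _ => hKb k) c h H hc hb z l z1).
pose T : {linear Hinfty v -> Hinfty v} :=
  HB.pack (multop hG hM) (GRing.isLinear.Build _ _ _ _ _ (multop_linear hG hM)).
exists T; split.
- by move=> h z z1; apply/hassumP; exact: multopE.
- exists (C * (Kb + 1)) => h; rewrite !HnormE -rmorphM lecR; exact: multop_norm.
move=> hsmall; apply: (compact_of_small_tails hG) => [h z z1|eps eps0].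
  exact: multopE.
have C1 : 0 < C + 1 by rewrite ltr_wpDl.
(* One half is for the logarithmic bound of the monotone parts, the other for q2^N. *)
have ep0 : 0 < eps / (C + 1) / 2 by rewrite !divr_gt0.
have [N1 hN1] := hsmall _ ep0.
have [N2 hN2] := geo_small 1 q201 ep0.
exists (maxn N1 N2) => h z l z1 hl.
have hk k : (maxn N1 N2 <= k)%N -> bet k * lg k <= eps / (C + 1) / 2 /\ bet' k * lg k <= eps / (C + 1) / 2.
  by rewrite geq_max => /andP[/hN1].
apply: le_trans (htail _ _ hk _ _ _ (Hinfty_pseries h) (Hinfty_wbounded h) z l z1 hl) _.
apply: ler_wpM2r; first exact: Hnorm_ge0.
have := hN2 _ (leq_maxr N1 N2); rewrite mul1r; set Q := q2 ^+ _ => hQ.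
apply: (@le_trans _ _ (C * (eps / (C + 1)))).
  by apply: ler_wpM2l => //; rewrite [leRHS]splitr lerD// ltW.
by rewrite mulrA ler_pdivrMr// mulrC ler_wpM2l ?(ltW eps0)// lerDl.
Qed.

End ToeplitzOperator.

Theorem theorem1p2 (R : realType) (v : weight R) (a : Cplx R -> R)
  (hB : condB v) (hv : moment_ratio_bounded v)
  (ha1 : L1_disc a) (har : radial_ae a)
  (hdiff : exists2 delta : R, 0 < delta < 1 &
     forall r : R, delta <= r < 1 -> derivable (radial_part a) r 1)
  (hder :
     (limf_esup (fun r : R => (derive1 (radial_part a) r)%:E) 1^'- < +oo)%E \/
     (-oo < limf_einf (fun r : R => (derive1 (radial_part a) r)%:E) 1^'-)%E) :
  ((limf_esup (fun r : R => `|radial_part a r * ln (1 - r)|%:E) 1^'- < +oo)%E ->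
     exists T : {linear Hinfty v -> Hinfty v},
       is_toeplitz a T /\ bounded_operator T) /\
  (limf_esup (fun r : R => `|radial_part a r * ln (1 - r)|%:E) 1^'- = 0%E ->
     exists T : {linear Hinfty v -> Hinfty v},
       is_toeplitz a T /\ compact_operator T).

Proof.
have mA := L1_disc_radial_measurable ha1.
have [delta d01 dA] := hdiff.
have key (hA : (limf_esup (fun r : R => `|radial_part a r * ln (1 - r)|%:E) 1^'- < +oo)%E) :
    exists T : {linear Hinfty v -> Hinfty v}, [/\ is_toeplitz a T, bounded_operator T &
      limf_esup (fun r : R => `|radial_part a r * ln (1 - r)|%:E) 1^'- = 0%E ->
      compact_operator T].
  have [bet [bet' [err [Ce [q [Kb [hs hsmall]]]]]]] := symbol_split hv mA d01 dA hder hA.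
  have [T [T1 T2 T3]] := toeplitz_operator hB hs.
  by exists T; split=> // /hsmall.
split=> h; first by have [T [? ? _]] := key h; exists T.
have [|T [T1 _ T3]] := key; first by rewrite h ltry.
by exists T; split=> //; exact: T3.
Qed.
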